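(* Let $\Omega$ be a bounded domain of $\mathbb{R}^N$, $N\ge 1$, let $f\in C^1(\mathbb{R})$ be a convex function such that $f(0)=0$, and let $\lambda_1$ be the principal eigenvalue of $-\Delta$ in $\Omega$ with homogeneous Dirichlet boundary conditions. Assume that $u\in H^1_0(\Omega)$, $f(u)\in L^1_{loc}(\Omega)$ and that $u$ is a stable solution to $$-\Delta u=f(u)\ \text{ in }\mathcal D'(\Omega),\qquad u\ge 0\ \text{ a.e. on }\Omega .$$ Then, either $u\equiv 0$, or $f(t)=\lambda_1 t$ on $(0,\sup_\Omega u)$ and $u\in C^\infty(\Omega)\cap H^1_0(\Omega)$ is a positive first eigenfunction of $-\Delta$ with homogeneous Dirichlet boundary conditions.
   Context: A solution $u\in H^1_{loc}(\Omega)$ with $f(u)\in L^1_{loc}(\Omega)$ of $-\Delta u=f(u)$ in $\mathcal D'(\Omega)$ is called stable in $\Omega$ if $f'(u)\in L^1_{loc}(\Omega)$ and $\int_\Omega f'(u)\varphi^2\le\int_\Omega|\nabla\varphi|^2$ for every $\varphi\in C^1_c(\Omega)$. Here $\sup_\Omega$ is the essential supremum (possibly $+\infty$), and equalities such as $u\equiv0$ are a.e. *)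

(* Defs.v *)
From HB Require Import structures.
From mathcomp Require Import all_boot all_order all_algebra lra.
From mathcomp Require Import all_classical all_reals all_analysis.
From mathcomp Require Import measurable_realfun.

Set Implicit Arguments.
Unset Strict Implicit.
Unset Printing Implicit Defensive.

Import Order.TTheory GRing.Theory Num.Theory.
Import numFieldNormedType.Exports.

Local Open Scope classical_set_scope.
Local Open Scope ring_scope.

Definition rV_display : measure_display. Proof. exact: default_measure_display. Qed.

Section measurable_rV.
Context {R : realType}.
Variable n : nat.

Let coords : 'I_n -> 'rV[R]_n -> R := fun i x => x ord0 i.

Let rV_set0 : g_sigma_preimage coords set0.
Proof. exact: sigma_algebra0. Qed.

Let rV_setC A : g_sigma_preimage coords A -> g_sigma_preimage coords (~` A).
Proof. exact: sigma_algebraC. Qed.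

Let rV_bigcup (F : (set 'rV[R]_n)^nat) :
  (forall i, g_sigma_preimage coords (F i)) ->
  g_sigma_preimage coords (\bigcup_i (F i)).
Proof. exact: sigma_algebra_bigcup. Qed.

(* The sigma-algebra generated by the coordinates, i.e. the Borel one, see
   [open_measurable_rV]. *)
HB.instance Definition _ := @isMeasurable.Build rV_display 'rV[R]_n
  (g_sigma_preimage coords) rV_set0 rV_setC rV_bigcup.

End measurable_rV.

Section measurable_rV_theory.
Context {R : realType}.

Lemma measurable_coord n (i : 'I_n) :
  measurable_fun [set: 'rV[R]_n] (fun x : 'rV[R]_n => x ord0 i).
Proof.
move=> _ Y mY; rewrite setTI; apply: sub_sigma_algebra => /=.
rewrite -bigcup_seq/=; exists i => /=; first by rewrite mem_index_enum.
by exists Y => //; rewrite setTI.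
Qed.

Lemma measurable_fun_rVP d (T : measurableType d) n (f : T -> 'rV[R]_n) :
  measurable_fun [set: T] f <->
  forall i, measurable_fun [set: T] (fun x => f x ord0 i).
Proof.
split=> [mf i|mf].
  exact: (measurableT_comp (@measurable_coord n i) mf).
move=> _ A; rewrite setTI; move: A; apply: smallest_sub.
  split => /=.
  - by rewrite preimage_set0.
  - by move=> B mB; rewrite setTD; exact: measurableC.
  - by move=> F mF; rewrite preimage_bigcup; exact: bigcupT_measurable.
rewrite -bigcup_seq => B [i _ [C mC <-]].
rewrite /= setTI -comp_preimage -[X in measurable X]setTI.
exact: mf.
Qed.

Definition cons_rV n (p : R * 'rV[R]_n) : 'rV[R]_n.+1 :=
  \row_i (if unlift ord0 i is Some j then p.2 ord0 j else p.1).

Lemma cons_rV0 n (p : R * 'rV[R]_n) : cons_rV p ord0 ord0 = p.1.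
Proof. by rewrite mxE unlift_none. Qed.

Lemma cons_rVS n (p : R * 'rV[R]_n) j : cons_rV p ord0 (lift ord0 j) = p.2 ord0 j.
Proof. by rewrite mxE liftK. Qed.

Definition behead_rV n (x : 'rV[R]_n.+1) : R * 'rV[R]_n :=
  (x ord0 ord0, \row_j x ord0 (lift ord0 j)).

Lemma cons_rVK n : cancel (@cons_rV n) (@behead_rV n).
Proof.
move=> [a x]; rewrite /behead_rV cons_rV0; congr pair.
by apply/rowP => j; rewrite mxE cons_rVS.
Qed.

Lemma behead_rVK n : cancel (@behead_rV n) (@cons_rV n).
Proof.
move=> x; apply/rowP => i; case: (unliftP ord0 i) => [j|] ->.
  by rewrite cons_rVS mxE.
by rewrite cons_rV0.
Qed.

Lemma measurable_cons_rV n : measurable_fun [set: R * 'rV[R]_n] (@cons_rV n).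
Proof.
apply/measurable_fun_rVP => i; case: (unliftP ord0 i) => [j|] ->.
  under eq_fun do rewrite cons_rVS.
  exact: (measurableT_comp (@measurable_coord n j) measurable_snd).
under eq_fun do rewrite cons_rV0.
exact: measurable_fst.
Qed.

Lemma measurable_behead_rV n :
  measurable_fun [set: 'rV[R]_n.+1] (@behead_rV n).
Proof.
apply/measurable_fun_pairP; split; first exact: measurable_coord.
apply/measurable_fun_rVP => i.
rewrite (_ : (fun _ => _) = fun x : 'rV[R]_n.+1 => x ord0 (lift ord0 i)).
  exact: measurable_coord.
by apply/funext => x /=; rewrite mxE.
Qed.

End measurable_rV_theory.

Section lebesgue_rV_step.
Local Open Scope ereal_scope.
Context {R : realType} {n : nat}.
Variable m : {sigma_finite_measure set 'rV[R]_n -> \bar R}.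

Definition lebesgue_rV_step : set 'rV[R]_n.+1 -> \bar R :=
  pushforward (@lebesgue_measure R \x m) (@cons_rV R n).

Let mcons A : measurable A -> measurable (@cons_rV R n @^-1` A).
Proof.
move=> mA; rewrite -[X in measurable X]setTI; exact: measurable_cons_rV.
Qed.

Let step0 : lebesgue_rV_step set0 = 0.
Proof. by rewrite /lebesgue_rV_step /pushforward preimage_set0 measure0. Qed.

Let step_ge0 A : 0 <= lebesgue_rV_step A.
Proof. exact: (@measure_ge0 _ _ _ (@lebesgue_measure R \x m)). Qed.

Let step_sigma_additive : semi_sigma_additive lebesgue_rV_step.
Proof.
move=> F mF tF mUF; rewrite /lebesgue_rV_step /pushforward preimage_bigcup.
apply: measure_semi_sigma_additive => [k||]; first exact: mcons.
- apply/trivIsetP => /= i j _ _ ij; rewrite -preimage_setI.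
  by move/trivIsetP : tF => /(_ _ _ _ _ ij) ->//; rewrite preimage_set0.
- by rewrite -preimage_bigcup; exact: mcons.
Qed.

HB.instance Definition _ := isMeasure.Build _ _ _
  lebesgue_rV_step step0 step_ge0 step_sigma_additive.

Let step_sigma_finite : sigma_finite setT lebesgue_rV_step.
Proof.
have /sigma_finiteP[F [TF ndF Foo]] := sigma_finiteT (@lebesgue_measure R).
have /sigma_finiteP[G [TG ndG Goo]] := sigma_finiteT m.
exists (fun k => @behead_rV R n @^-1` (F k `*` G k)).
  apply/seteqP; split => // x _.
  have [i _ Fi] : (\bigcup_i F i) (behead_rV x).1 by rewrite -TF.
  have [j _ Gj] : (\bigcup_i G i) (behead_rV x).2 by rewrite -TG.
  exists (maxn i j) => //; split.
  - by move: Fi; exact/subsetPset/ndF/leq_maxl.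
  - by move: Gj; exact/subsetPset/ndG/leq_maxr.
move=> k; have [mF Fk] := Foo k; have [mG Gk] := Goo k; split.
  rewrite -[X in measurable X]setTI; apply: measurable_behead_rV => //.
  exact: measurableX.
rewrite /lebesgue_rV_step /pushforward -comp_preimage.
rewrite (_ : _ \o _ = id); last by rewrite funeqE => x; exact: cons_rVK.
by rewrite preimage_id product_measure1E// lte_mul_pinfty// ge0_fin_numE.
Qed.

HB.instance Definition _ := Measure_isSigmaFinite.Build _ _ _
  lebesgue_rV_step step_sigma_finite.

End lebesgue_rV_step.

Fixpoint sigma_finite_lebesgue_rV (R : realType) n :
    {sigma_finite_measure set 'rV[R]_n -> \bar R} :=
  match n with
  | 0 => \d_(0 : 'rV[R]_0)
  | n'.+1 => lebesgue_rV_step (sigma_finite_lebesgue_rV R n')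
  end.

Definition lebesgue_rV (R : realType) n : set 'rV[R]_n -> \bar R :=
  sigma_finite_lebesgue_rV R n.

HB.instance Definition _ (R : realType) n :=
  SigmaFiniteMeasure.on (@lebesgue_rV R n).

Section lebesgue_rV_theory.
Local Open Scope ereal_scope.
Context {R : realType}.

Lemma lebesgue_rV0 (A : set 'rV[R]_0) : lebesgue_rV A = \d_(0%R : 'rV[R]_0) A.
Proof. by []. Qed.

Lemma lebesgue_rVS n (A : set 'rV[R]_n.+1) :
  lebesgue_rV A = (lebesgue_measure \x @lebesgue_rV R n) (@cons_rV R n @^-1` A).
Proof. by []. Qed.

Lemma measurable_box n (A : 'I_n -> set R) : (forall i, measurable (A i)) ->
  measurable [set x : 'rV[R]_n | forall i, A i (x ord0 i)].
Proof.
move=> mA; rewrite (_ : [set _ | _] =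
    \bigcap_(i in [set: 'I_n]) [set x : 'rV[R]_n | A i (x ord0 i)]); last first.
  by apply/seteqP; split=> x /= Ax i => [_|]; exact: Ax.
apply: fin_bigcap_measurable => [|i _]; first exact: finite_finset.
by rewrite -[X in measurable X]setTI; exact: measurable_coord.
Qed.

Lemma lebesgue_rV_box n (A : 'I_n -> set R) : (forall i, measurable (A i)) ->
  lebesgue_rV [set x : 'rV[R]_n | forall i, A i (x ord0 i)] =
  \prod_(i < n) lebesgue_measure (A i).
Proof.
elim: n A => [|n IH] A mA.
  rewrite big_ord0 lebesgue_rV0 diracE.
  by rewrite mem_set// => -[].
rewrite big_ord_recl lebesgue_rVS.
rewrite (_ : _ @^-1` _ = A ord0 `*`
    [set x : 'rV[R]_n | forall i, A (lift ord0 i) (x ord0 i)]).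
  rewrite product_measure1E//.
    by congr (_ * _); apply: (IH (fun i => A (lift ord0 i))) => i; exact: mA.
    exact: mA.
  by apply: (@measurable_box _ (fun i => A (lift ord0 i))) => i; exact: mA.
apply/seteqP; split => -[a x] /=.
  move=> h; split; first by have := h ord0; rewrite cons_rV0.
  by move=> i; have := h (lift ord0 i); rewrite cons_rVS.
move=> [h0 h] i; case: (unliftP ord0 i) => [j|] ->.
  by rewrite cons_rVS.
by rewrite cons_rV0.
Qed.

Lemma open_measurable_rV n (U : set 'rV[R]_n) : open U -> measurable U.
Proof.
move=> oU.
pose box (c : {ffun 'I_n -> rat} * nat) : set 'rV[R]_n :=
  [set y | forall i, ball (ratr (c.1 i) : R) c.2.+1%:R^-1 (y ord0 i)].
rewrite (_ : U = \bigcup_(c in [set c | box c `<=` U]) box c); last first.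
  apply/seteqP; split => [x Ux|x [c /= + xc]]; last exact.
  have /nbhs_ballP[e /= e0 xeU] := open_nbhs_nbhs (conj oU Ux).
  have [k ke] : exists k, (k.+1%:R^-1 < e / 2 :> R)%R.
    have [k _ /(_ k (leqnn k))] := near_infty_natSinv_lt (PosNum (divr_gt0 e0 (ltr0n R 2))).
    by exists k.
  have /choice[q qx] : forall i, exists r : rat, ball (ratr r : R) k.+1%:R^-1 (x ord0 i).
    move=> i.
    have [|r] := @rat_in_itvoo R (x ord0 i - k.+1%:R^-1) (x ord0 i + k.+1%:R^-1).
      by rewrite ltrD2l (@lt_trans _ _ 0%R) ?oppr_lt0 ?invr_gt0.
    rewrite in_itv/= => /andP[r1 r2]; exists r.
    move: r1 r2; rewrite /ball/= ltr_distlC; set d := (_^-1)%R; set z := x _ _ => r1 r2.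
    by apply/andP; split; lra.
  exists ([ffun i => q i], k) => /=; last by move=> i /=; rewrite ffunE.
  move=> y yc; apply: xeU; split => // i j; rewrite !ord1.
  have := yc j; have := qx j; rewrite /= ffunE => /ball_sym xq qy.
  apply: le_ball (ball_triangle xq qy).
  by move: ke; set d := (_^-1)%R => ke; lra.
rewrite bigcup_mkcond.
apply: countable_bigcupT_measurable => // c; case: ifPn => // _.
apply: (@measurable_box _ (fun i => ball (ratr (c.1 i) : R) c.2.+1%:R^-1)) => i.
apply: open_measurable; exact: ball_open.
Qed.

End lebesgue_rV_theory.

Section function_spaces.
Context {R : realType} {n : nat}.
Implicit Types (Omega : set 'rV[R]_n) (u v phi : 'rV[R]_n -> R).

Local Notation mu := (@lebesgue_rV R n).

Definition domain Omega := [/\ open Omega, connected Omega & Omega !=set0].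

Definition partial (i : 'I_n) u : 'rV[R]_n -> R := 'D_(delta_mx ord0 i) u.

Definition grad_norm2 u (x : 'rV[R]_n) : R := \sum_(i < n) partial i u x ^+ 2.

Definition laplacian u (x : 'rV[R]_n) : R :=
  \sum_(i < n) partial i (partial i u) x.

(* Meant for open D: the derivatives are two-sided. *)
Fixpoint Ck (k : nat) (D : set 'rV[R]_n) u : Prop :=
  (forall x, D x -> {for x, continuous u}) /\
  match k with
  | 0 => True
  | k'.+1 => forall i, (forall x, D x -> derivable u x (delta_mx ord0 i)) /\
                       Ck k' D (partial i u)
  end.

Definition Cinfty D u := forall k, Ck k D u.

Definition compact_support Omega phi :=
  compact (closure [set x | phi x != 0]) /\
  closure [set x | phi x != 0] `<=` Omega.

(* Compactly supported functions are extended by 0 to the whole space, and it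
   is on the whole space that they are differentiable. *)
Definition Ckc k Omega phi := Ck k setT phi /\ compact_support Omega phi.

Definition Cinftyc Omega phi := Cinfty setT phi /\ compact_support Omega phi.

(* Elements of function spaces are Borel representatives; only their values on
   Omega matter. *)
Definition L1loc Omega u := measurable_fun Omega u /\
  forall K, compact K -> K `<=` Omega -> mu.-integrable K (EFin \o u).

Definition L2 (D : set 'rV[R]_n) u := measurable_fun D u /\
  mu.-integrable D (fun x => (u x ^+ 2)%:E).

Definition L2loc Omega u := measurable_fun Omega u /\
  forall K, compact K -> K `<=` Omega -> L2 K u.

Definition weak_partial Omega (i : 'I_n) u v :=
  [/\ L1loc Omega u, L1loc Omega v & forall phi, Cinftyc Omega phi ->
    \int[mu]_(x in Omega) (u x * partial i phi x) =
    - (\int[mu]_(x in Omega) (v x * phi x))].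

Definition H1loc Omega u := L2loc Omega u /\
  forall i, exists2 v, L2loc Omega v & weak_partial Omega i u v.

(* [H1grad Omega u g]: u belongs to H^1(Omega), with weak gradient g. *)
Definition H1grad Omega u (g : 'I_n -> 'rV[R]_n -> R) := L2 Omega u /\
  forall i, L2 Omega (g i) /\ weak_partial Omega i u (g i).

(* The closure of C^oo_c(Omega) in H^1(Omega). *)
Definition H10 Omega u := exists2 g, H1grad Omega u g &
  exists2 phi : ('rV[R]_n -> R)^nat, forall k, Cinftyc Omega (phi k) &
    (\int[mu]_(x in Omega) ((phi k x - u x) ^+ 2 +
       \sum_(i < n) (partial i (phi k) x - g i x) ^+ 2)%:E)%E
      @[k --> \oo] --> 0%E.

(* The restriction to Omega of [ess_sup]. *)
Definition ess_sup_on Omega u : \bar R :=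
  ereal_inf [set y | \forall x \ae mu, Omega x -> ((u x)%:E <= y)%E].

(* - Delta u = h in D'(Omega). *)
Definition distr_poisson Omega u h := [/\ L1loc Omega u, L1loc Omega h &
  forall phi, Cinftyc Omega phi ->
    - (\int[mu]_(x in Omega) (u x * laplacian phi x)) =
    \int[mu]_(x in Omega) (h x * phi x)].

Definition stable_solution Omega (f : R -> R) u :=
  [/\ H1loc Omega u, L1loc Omega (f \o u), distr_poisson Omega u (f \o u),
      L1loc Omega (derive1 f \o u) &
      forall phi, Ckc 1 Omega phi ->
        \int[mu]_(x in Omega) (derive1 f (u x) * phi x ^+ 2) <=
        \int[mu]_(x in Omega) grad_norm2 phi x].

Definition dirichlet_eigenfunction Omega (lambda : R) u :=
  [/\ H10 Omega u, ~ (u = cst 0 %[ae mu in Omega]) &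
      distr_poisson Omega u (fun x => lambda * u x)].

Definition dirichlet_eigenvalue Omega (lambda : R) :=
  exists u, dirichlet_eigenfunction Omega lambda u.

(* The smallest eigenvalue; on a bounded domain the set is nonempty, bounded
   below by 0, and the infimum is attained. *)
Definition principal_eigenvalue Omega : R :=
  inf [set lambda | dirichlet_eigenvalue Omega lambda].

End function_spaces.

Definition C1_real (R : realType) (f : R -> R) :=
  (forall t, derivable f t 1) /\ continuous (derive1 f).

(* Main.v *)
Require Import Defs.
From mathcomp Require Import all_boot all_order all_algebra lra ring.
From mathcomp Require Import all_classical all_reals all_analysis.
From mathcomp Require Import measurable_realfun.

Set Implicit Arguments.
Unset Strict Implicit.
Unset Printing Implicit Defensive.

Import Order.TTheory GRing.Theory Num.Theory.
Import numFieldNormedType.Exports.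

Local Open Scope classical_set_scope.
Local Open Scope ring_scope.

(** Write c = f'(0), m = f'(u) - c and h = f(u) - c u. As f is convex,
    f(0) = 0 and u >= 0, one has 0 <= h <= m u. If u itself could be used as a
    test function, stability would read
      int m u^2 + c int u^2 <= int |grad u|^2,
    and the equation would read
      int h u + c int u^2 = int |grad u|^2.
    Subtracting, int (m u^2 - h u) <= 0, whose integrand is nonnegative, so that
    m u^2 = h u, that is f'(u) u = f(u), almost everywhere. Geometrically, the
    tangent to the graph of f at u(x) passes through the origin; by convexity f
    is then linear on [0, u(x)], with slope c. Therefore f(t) = c t below the
    essential supremum of u, and - Laplacian u = c u.

    Stability also gives c int phi^2 <= int |grad phi|^2 for all test functions
    phi, so that no Dirichlet eigenvalue is smaller than c. If u is not 0, then c
    is an eigenvalue; hence it is the smallest one.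

    Two points need work. First, u is not a test function, and m is only
    locally integrable. Let phi_k be test functions converging to u in H^1.
    Stability tested with phi_k - phi_l, with m truncated, l tending to infinity
    and the truncation then removed, shows that int m (phi_k - u)^2 tends to 0
    ([weighted_gap]). Then stability and the equation can be tested with phi_k
    and the limit taken ([source_eq_weight]). The same statement with h = 0 and
    a constant weight gives the comparison with the other eigenvalues
    ([eigenvalue_ge]).

    Second, u must be shown to be smooth and positive. As c >= 0, the function
    e^(ks) u(x) with k = sqrt c is weakly harmonic in one more variable
    ([lift_fun_weak]), so it is enough to prove Weyl's lemma ([weyl]). For this
    a radial kernel rho_a, supported in the ball of radius 1/a, is chosen such
    that its derivative in a is the Laplacian of a compactly supported function
    ([drho_laplacian]). The convolution of a weakly harmonic function with
    rho_a is then locally independent of a, so it is, up to normalization, the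
    function itself. If that function is nonnegative, its mollification can
    only vanish at a point if it vanishes near that point, and connectedness
    of Omega concludes ([positive_of_open_zeros]). *)

(** * Calculus of C^k functions *)

Lemma continuous_near_eq (T U : topologicalType) (f g : T -> U) x :
  {near x, f =1 g} -> {for x, continuous g} -> {for x, continuous f}.
Proof.
move=> fg; rewrite /prop_for /continuous_at (nbhs_singleton fg).
move=> cg; apply: cvg_trans cg; apply: near_eq_cvg.
by apply: filterS fg => y ->.
Qed.

Section Ck_calculus.
Context {R : realType} {n : nat}.
Implicit Types (D U : set 'rV[R]_n) (f g : 'rV[R]_n -> R).

Lemma Ck_cont k D f x : Ck k D f -> D x -> {for x, continuous f}.
Proof. by case: k => [|k] [h _]; exact: h. Qed.

Lemma Ck_derivable k D f x i : Ck k.+1 D f -> D x ->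
  derivable f x (delta_mx ord0 i).
Proof. by case=> _ /(_ i)[h _]; exact: h. Qed.

Lemma Ck_partial k D f i : Ck k.+1 D f -> Ck k D (partial i f).
Proof. by case=> _ /(_ i)[]. Qed.

Lemma CkW k D f : Ck k.+1 D f -> Ck k D f.
Proof.
elim: k f => [|k IH] f [cf df]; split=> // i; have [h1 h2] := df i.
by split=> //; exact: IH.
Qed.

Lemma Cinfty_partial D f i : Cinfty D f -> Cinfty D (partial i f).
Proof. by move=> h k; exact: (Ck_partial _ (h k.+1)). Qed.

Lemma Cinfty_cont f : Cinfty setT f -> continuous f.
Proof. by move=> h x; exact: (Ck_cont (h 0%N) I). Qed.

Lemma Cinfty_derivable f i x : Cinfty setT f -> derivable f x (delta_mx ord0 i).
Proof. by move=> h; exact: Ck_derivable (h 1%N) I. Qed.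

Lemma open_near_eq U f g x : open U -> U x -> {in U, f =1 g} ->
  {near x, f =1 g}.
Proof.
move=> oU Ux fg; near=> y; apply: fg; rewrite inE; near: y.
exact: open_nbhs_nbhs.
Unshelve. all: by end_near. Qed.

(** The solution will be obtained by gluing mollifications at different scales;
    smoothness is then checked one neighbourhood at a time. *)
Lemma Ck_local k D f :
  (forall x, D x -> exists U g, [/\ open U, U x, Ck k U g & {in U, f =1 g}]) ->
  Ck k D f.
Proof.
have cont k' D' f' :
    (forall x, D' x -> exists U g,
      [/\ open U, U x, Ck k' U g & {in U, f' =1 g}]) ->
    forall x, D' x -> {for x, continuous f'}.
  move=> h x Dx; have [U [g [oU Ux Ckg fg]]] := h x Dx.
  exact: continuous_near_eq (open_near_eq oU Ux fg) (Ck_cont Ckg Ux).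
elim: k D f => [|k IH] D f h; split=> //; try exact: cont h.
move=> i; split=> [x Dx|].
  have [U [g [oU Ux Ckg fg]]] := h x Dx.
  apply: near_eq_derivable (Ck_derivable Ckg Ux).
  by apply: (open_near_eq oU Ux) => y /fg.
apply: IH => x Dx; have [U [g [oU Ux Ckg fg]]] := h x Dx.
exists U, (partial i g); split=> //; first exact: Ck_partial Ckg.
move=> y; rewrite inE => Uy; apply: near_eq_derive.
exact: open_near_eq fg.
Qed.

Lemma Ck_ext k D f g : open D -> {in D, f =1 g} -> Ck k D g -> Ck k D f.
Proof. by move=> oD fg Cg; apply: Ck_local => x Dx; exists D, g. Qed.

Lemma CkS k D U f : D `<=` U -> Ck k U f -> Ck k D f.
Proof.
move=> DU; elim: k f => [|k IH] f [cf df]; split=> //.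
- by move=> x /DU; exact: cf.
- by move=> x /DU; exact: cf.
- move=> i; have [h1 h2] := df i; split; last exact: IH.
  by move=> x /DU; exact: h1.
Qed.

Lemma Ck_cst k D (a : R) : Ck k D (cst a).
Proof.
have cc (b : R) (x : 'rV[R]_n) : {for x, continuous (cst b)}.
by exact: (@cst_continuous _ _ b x).
elim: k a => [|k IH] a; split=> // i; split=> [x _|].
  exact: derivable_cst.
rewrite (_ : partial i _ = cst 0) ?IH//.
by apply/funext => x; rewrite /partial derive_cst.
Qed.

Lemma CkD k D f g : open D -> Ck k D f -> Ck k D g -> Ck k D (f \+ g).
Proof.
move=> oD; elim: k f g => [|k IH] f g Cf Cg; split=> //.
- by move=> x Dx; apply: continuousD; [exact: Ck_cont Cf Dx|exact: Ck_cont Cg Dx].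
- by move=> x Dx; apply: continuousD; [exact: Ck_cont Cf Dx|exact: Ck_cont Cg Dx].
- move=> i; split=> [x Dx|].
    by apply: derivableD; [exact: Ck_derivable Cf Dx|exact: Ck_derivable Cg Dx].
  apply: (@Ck_ext _ _ _ (partial i f \+ partial i g)) => //.
    move=> x; rewrite inE => Dx; apply: deriveD.
      exact: Ck_derivable Cf Dx.
    exact: Ck_derivable Cg Dx.
  by apply: IH; [exact: Ck_partial Cf|exact: Ck_partial Cg].
Qed.

Lemma CkM k D f g : open D -> Ck k D f -> Ck k D g -> Ck k D (f \* g).
Proof.
move=> oD; elim: k f g => [|k IH] f g Cf Cg; split=> //.
- by move=> x Dx; apply: continuousM; [exact: Ck_cont Cf Dx|exact: Ck_cont Cg Dx].
- by move=> x Dx; apply: continuousM; [exact: Ck_cont Cf Dx|exact: Ck_cont Cg Dx].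
- move=> i; split=> [x Dx|].
    by apply: derivableM; [exact: Ck_derivable Cf Dx|exact: Ck_derivable Cg Dx].
  apply: (@Ck_ext _ _ _ ((f \* partial i g) \+ (g \* partial i f))) => //.
    move=> x; rewrite inE => Dx; apply: deriveM.
      exact: Ck_derivable Cf Dx.
    exact: Ck_derivable Cg Dx.
  by apply: CkD => //; apply: IH; (try exact: CkW Cf); (try exact: CkW Cg);
    [exact: Ck_partial Cg|exact: Ck_partial Cf].
Qed.

Lemma Ck_sum k D (m : nat) (F : 'I_m -> 'rV[R]_n -> R) : open D ->
  (forall j, Ck k D (F j)) -> Ck k D (fun x => \sum_(j < m) F j x).
Proof.
move=> oD; elim: m F => [|m IH] F CF.
  rewrite (_ : (fun _ => _) = cst 0); first exact: Ck_cst.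
  by apply/funext => x; rewrite big_ord0.
rewrite (_ : (fun _ => _) = F ord0 \+
    (fun x => \sum_(j < m) F (lift ord0 j) x)).
  by apply: CkD => //; apply: IH => j; exact: CF.
by apply/funext => x; rewrite big_ord_recl.
Qed.

Lemma is_derive_coord (j : 'I_n) (x v : 'rV[R]_n) :
  is_derive x v (fun y : 'rV[R]_n => y ord0 j) (v ord0 j).
Proof.
apply: DeriveDef.
  apply/cvg_ex; exists (v ord0 j); apply: cvg_near_cst; near=> h.
  rewrite /= !mxE addrK /GRing.scale/= mulrA mulVf ?mul1r//.
  by near: h; exact: nbhs_dnbhs_neq.
apply: lim_near_cst => //; near=> h.
rewrite /= !mxE addrK /GRing.scale/= mulrA mulVf ?mul1r//.
by near: h; exact: nbhs_dnbhs_neq.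
Unshelve. all: by end_near. Qed.

Lemma Ck_coord k D j : Ck k D (fun x : 'rV[R]_n => x ord0 j).
Proof.
have cc (x : 'rV[R]_n) : {for x, continuous (fun x : 'rV[R]_n => x ord0 j)}.
  exact: coord_continuous.
case: k => [|k]; split=> // i; split=> [x _|].
  by have [] := is_derive_coord j x (delta_mx ord0 i).
rewrite (_ : partial i _ = cst ((delta_mx ord0 i : 'rV[R]_n) ord0 j)).
  exact: Ck_cst.
by apply/funext => x; have [_] := is_derive_coord j x (delta_mx ord0 i).
Qed.

(** Turns directional derivatives into one-variable ones, for which there is a
    chain rule and a mean value theorem. *)
Lemma is_derive_line f (x v : 'rV[R]_n) (t l : R) :
  is_derive (x + t *: v) v f l <->
  is_derive t (1 : R) (fun s => f (x + s *: v)) l.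
Proof.
have E : (fun h : R => h^-1 *: (f (h *: v + (x + t *: v)) - f (x + t *: v))) =
         (fun h => h^-1 *: (f (x + (h *: (1 : R) + t) *: v) - f (x + t *: v))).
  apply/funext => h; congr (_ *: (f _ - _)).
  by rewrite scaler1 scalerDl addrCA.
split=> -[d1 d2]; apply: DeriveDef.
- by move: d1; rewrite /derivable E.
- by move: d2; rewrite /derive E.
- by move: d1; rewrite /derivable E.
- by move: d2; rewrite /derive E.
Qed.

Lemma is_derive_line0 f (x v : 'rV[R]_n) (l : R) :
  is_derive x v f l <-> is_derive (0 : R) (1 : R) (fun s => f (x + s *: v)) l.
Proof. by rewrite -is_derive_line scale0r addr0. Qed.

Lemma is_derive_comp1 (h : R -> R) f (x v : 'rV[R]_n) (a b : R) :
  is_derive (f x) (1 : R) h a -> is_derive x v f b -> is_derive x v (h \o f) (a * b).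
Proof.
move=> dh /is_derive_line0 df; apply/is_derive_line0.
have := @is_derive1_comp R h (fun s => f (x + s *: v)) 0 a b.
by apply=> //; rewrite scale0r addr0.
Qed.

Definition smooth (h : R -> R) := forall j t, derivable (derive1n j h) t 1.

Lemma smooth_derive1 h : smooth h -> smooth (derive1 h).
Proof.
move=> sh j t; have := sh j.+1 t.
rewrite (_ : derive1n j.+1 h = derive1n j (derive1 h))//.
by rewrite /derive1n iterSr.
Qed.

Lemma smooth_is_derive (h : R -> R) (t : R) : smooth h -> is_derive t (1 : R) h (derive1 h t).
Proof. by move=> /(_ 0%N t) d; apply: DeriveDef => //; rewrite derive1E. Qed.

Lemma smooth_cont h : smooth h -> continuous h.
Proof.
move=> sh t; apply: differentiable_continuous; apply/derivable1_diffP.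
exact: (sh 0%N).
Qed.

Lemma Ck_comp k D f h : open D -> smooth h -> Ck k D f -> Ck k D (h \o f).
Proof.
move=> oD; elim: k f h => [|k IH] f h sh Cf; split=> //.
- move=> x Dx; apply: continuous_comp; first exact: Ck_cont Cf Dx.
  exact: smooth_cont.
- move=> x Dx; apply: continuous_comp; first exact: Ck_cont Cf Dx.
  exact: smooth_cont.
- have dhf i x : D x -> is_derive x (delta_mx ord0 i) (h \o f)
      (derive1 h (f x) * partial i f x).
    move=> Dx; apply: is_derive_comp1; first exact: smooth_is_derive.
    by apply: DeriveDef => //; exact: Ck_derivable Cf Dx.
  move=> i; split=> [x Dx|]; first by have [] := dhf i x Dx.
  apply: (@Ck_ext _ _ _ ((derive1 h \o f) \* partial i f)) => //.
    by move=> x; rewrite inE => Dx; have [_] := dhf i x Dx.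
  apply: CkM => //; last exact: Ck_partial Cf.
  by apply: IH; [exact: smooth_derive1|exact: CkW].
Qed.

End Ck_calculus.

(** * The exponential bump *)

Section exponential_bump.
Context {R : realType}.

(** The polynomial factor makes this family stable under differentiation, so
    that one derivative computation covers all the derivatives of
    exp(-1/(1-t)). *)
Definition expbump (p : {poly R}) (t : R) : R :=
  if t < 1 then p.[(1 - t)^-1] * expR (- (1 - t)^-1) else 0.

(** With s = 1/(1-t) one has s' = s^2, hence
    (p(s) e^-s)' = s^2 (p'(s) - p(s)) e^-s. *)
Definition expbump_deriv (p : {poly R}) : {poly R} := 'X^2 * (p^`() - p).

Lemma expbump_ge1 p t : 1 <= t -> expbump p t = 0.
Proof. by rewrite /expbump ltNge => ->. Qed.

Lemma expbump_lt1 p t : t < 1 ->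
  expbump p t = p.[(1 - t)^-1] * expR (- (1 - t)^-1).
Proof. by rewrite /expbump => ->. Qed.

(** Up to a factorial, s^(i+1) is a term of the expansion of e^s. *)
Lemma poly_expRN_le (p : {poly R}) :
  exists2 C, 0 <= C & forall s, 0 < s -> `|p.[s] * expR (- s)| <= C * s^-1.
Proof.
exists (\sum_(i < size p) `|p`_i| * (i.+1)`!%:R).
  by apply: sumr_ge0 => i _; rewrite mulr_ge0.
move=> s s0; rewrite horner_coef !mulr_suml.
apply: le_trans (ler_norm_sum _ _ _) _; apply: ler_sum => i _.
rewrite !normrM -!mulrA ler_wpM2l// (ger0_norm (expR_ge0 _)).
rewrite (ger0_norm (exprn_ge0 i (ltW s0))) expRN ler_pdivlMr// mulrAC.
rewrite -exprSr ler_pdivrMr ?expR_gt0//.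
rewrite -ler_pdivrMl ?ltr0n ?fact_gt0// mulrC.
by apply: le_trans (expR_ge1Dxn i (ltW s0)); rewrite lerDr.
Qed.

Lemma expbump_le p : exists2 C, 0 <= C & forall t, `|expbump p t| <= C * `|1 - t|.
Proof.
have [C C0 hC] := poly_expRN_le p; exists C => // t.
have [t1|t1] := ltP t 1; last by rewrite expbump_ge1// normr0 mulr_ge0.
rewrite expbump_lt1// (gtr0_norm (_ : 0 < 1 - t)) ?subr_gt0//.
by rewrite -[X in C * X]invrK; apply: hC; rewrite invr_gt0 subr_gt0.
Qed.

Lemma is_derive_expbump_lt1 p (t : R) : t < 1 ->
  is_derive t (1 : R) (expbump p) (expbump (expbump_deriv p) t).
Proof.
move=> t1; pose f (t : R) : R := p.[(1 - t)^-1] * expR (- (1 - t)^-1).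
have t10 : 1 - t != 0 by rewrite subr_eq0 gt_eqF.
apply: (@near_eq_is_derive _ _ _ f).
  near=> s; rewrite expbump_lt1//; near: s; exact: lt_nbhsl.
rewrite expbump_lt1//.
have d1 : is_derive t (1 : R) (fun t => 1 - t) (- 1).
  by apply: is_derive_eq; rewrite add0r mul1r.
have d2 : is_derive t (1 : R) (fun t => (1 - t)^-1) ((1 - t)^-1 ^+ 2).
  have h := @is_deriveV R (fun t => 1 - t) t _ _ t10 d1.
  by apply: (is_derive_eq h); rewrite /GRing.scale/= mulrN1 opprK exprVn.
have d3 := @is_derive1_comp _ (horner p) _ _ _ _ (is_derive_poly p _) d2.
have d4 : is_derive t (1 : R) (fun t => - (1 - t)^-1) (- (1 - t)^-1 ^+ 2).
  exact: is_deriveN.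
have d5 := @is_derive1_comp _ expR _ _ _ _ (is_derive_expR _) d4.
apply: (is_derive_eq (is_deriveM d3 d5)).
rewrite /expbump_deriv /= hornerM hornerXn hornerD hornerN /GRing.scale/=.
set s := (1 - t)^-1; set e := expR _; ring.
Unshelve. all: by end_near. Qed.

Lemma is_derive_expbump p (t : R) :
  is_derive t (1 : R) (expbump p) (expbump (expbump_deriv p) t).
Proof.
have [t1|t1|->] := ltgtP t 1; first exact: is_derive_expbump_lt1.
  rewrite expbump_ge1 ?ltW//; apply: (@near_eq_is_derive _ _ _ (cst 0)).
    near=> s; rewrite expbump_ge1 ?ltW//; near: s; exact: lt_nbhsr.
rewrite [X in is_derive _ _ _ X]expbump_ge1//.
(* At t = 1: multiplying p by X divides the bump by 1 - t, so the linear
bound for 'X * p is a quadratic bound for p. *)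
have [C C0 hC] := expbump_le ('X * p).
have bd h : `|expbump p (h + 1)| <= C * `|h| ^+ 2.
  have [h0|h0] := ltP h 0; last first.
    by rewrite expbump_ge1 ?lerDr// normr0 mulr_ge0// exprn_ge0.
  have h1 : h + 1 < 1 by rewrite -ltrBrDr subrr.
  have : expbump p (h + 1) = (1 - (h + 1)) * expbump ('X * p) (h + 1).
    rewrite !expbump_lt1// hornerM hornerX !mulrA mulfV ?mul1r//.
    by rewrite subr_eq0 gt_eqF.
  move=> ->; rewrite normrM opprD addrA addrAC subrr sub0r normrN expr2 mulrCA.
  by rewrite ler_wpM2l//; have := hC (h + 1);
     rewrite opprD addrA addrAC subrr sub0r normrN.
have cv : (fun h : R => h^-1 *: (expbump p (h *: 1 + 1) - expbump p 1)) @ 0^' --> (0 : R).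
  apply/cvgr0Pnorm_lt => e e0; near=> h.
  have h0 : h != 0 by near: h; exact: nbhs_dnbhs_neq.
  rewrite scaler1 [expbump p 1]expbump_ge1// subr0 normrZ normfV.
  apply: (@le_lt_trans _ _ (C * `|h|)).
    rewrite mulrC ler_pdivrMr ?normr_gt0// -mulrA -expr2; exact: bd.
  apply: (@le_lt_trans _ _ ((C + 1) * `|h|)); first by rewrite ler_wpM2r// lerDl.
  rewrite mulrC -ltr_pdivlMr ?ltr_wpDl//.
  near: h; apply: dnbhs0_lt; first by rewrite divr_gt0// ltr_wpDl.
apply: DeriveDef; first by apply/cvg_ex; exists 0.
exact: cvg_lim cv.
Unshelve. all: by end_near. Qed.

Lemma derive1_expbump p : derive1 (expbump p) = expbump (expbump_deriv p).
Proof.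
by apply/funext => t; rewrite derive1E; have [_ ->] := is_derive_expbump p t.
Qed.

Lemma smooth_expbump p : smooth (expbump p).
Proof.
move=> j; elim: j p => [|j IH] p t; first by have [] := is_derive_expbump p t.
rewrite (_ : derive1n j.+1 _ = derive1n j (derive1 (expbump p))).
  by rewrite derive1_expbump.
by rewrite /derive1n iterSr.
Qed.

Lemma expbump_bounded p : exists2 M, 0 <= M & forall t, 0 <= t -> `|expbump p t| <= M.
Proof.
have [C C0 hC] := expbump_le p; exists C => // t t0.
have [t1|t1] := ltP t 1; last by rewrite expbump_ge1// normr0.
apply: le_trans (hC t) _; rewrite -[leRHS]mulr1 ler_wpM2l//.
by rewrite ger0_norm ?subr_ge0 ?(ltW t1)// gerBl.
Qed.

End exponential_bump.

(** * Test functions and radial functions *)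

Section compact_supports.
Context {R : realType} {n : nat}.
Implicit Types (D U : set 'rV[R]_n) (f g : 'rV[R]_n -> R).

Lemma compact_supportI K D f : compact K -> K `<=` D ->
  (forall x, ~ K x -> f x = 0) -> compact_support D f.
Proof.
move=> cK KD f0.
have clK : closed K by apply: compact_closed => //; exact: norm_hausdorff.
have sK : closure [set x | f x != 0] `<=` K.
  rewrite closureE; apply: smallest_sub => // x /= fx.
  by apply: contrapT => /f0 fx0; rewrite fx0 eqxx in fx.
split; last exact: subset_trans sK KD.
by apply: subclosed_compact cK sK; exact: closed_closure.
Qed.

Lemma compact_supportE D f : compact_support D f ->
  exists K, [/\ compact K, closed K, K `<=` D & forall x, ~ K x -> f x = 0].
Proof.
move=> [cK KD]; exists (closure [set x | f x != 0]); split=> //.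
  exact: closed_closure.
move=> x nKx; apply/eqP; apply: contra_notT nKx => fx.
exact: subset_closure.
Qed.

Lemma compact_support_partial D f i : compact_support D f ->
  compact_support D (partial i f).
Proof.
move=> /compact_supportE[K [cK clK KD f0]].
apply: (compact_supportI cK KD) => x nKx.
have : {near x, f =1 cst 0}.
  near=> y; apply: f0; near: y; apply: open_nbhs_nbhs; split=> //.
  exact: closed_openC.
by move=> /near_eq_derive; rewrite /partial => ->; rewrite derive_cst.
Unshelve. all: by end_near. Qed.

Lemma compact_support_lin D f g (a b : R) : compact_support D f ->
  compact_support D g -> compact_support D (fun x => a * f x + b * g x).
Proof.
move=> /compact_supportE[K [cK clK KD f0]] /compact_supportE[L [cL clL LD g0]].
apply: (@compact_supportI (K `|` L)); first exact: compactU.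
  by move=> x [/KD|/LD].
move=> x /not_orP[/f0 -> /g0 ->]; by rewrite !mulr0 addr0.
Qed.

Lemma Cinftyc_partial D f i : Cinftyc D f -> Cinftyc D (partial i f).
Proof.
move=> [Cf sf]; split; [exact: Cinfty_partial|exact: compact_support_partial].
Qed.

Lemma Cinftyc_sub D f g : Cinftyc D f -> Cinftyc D g ->
  Cinftyc D (fun x => f x - g x).
Proof.
move=> [Cf sf] [Cg sg].
have -> : (fun x => f x - g x) = (fun x => 1 * f x + (- 1) * g x).
  by apply/funext => x; rewrite mul1r mulN1r.
split; last exact: compact_support_lin.
move=> k; apply: CkD; [exact: openT| |]; apply: CkM;
  by [exact: openT|exact: Ck_cst|exact: Cf|exact: Cg].
Qed.

Lemma Cinftyc_scale D f (a : R) : Cinftyc D f -> Cinftyc D (fun x => a * f x).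
Proof.
move=> [Cf sf]; split.
  by move=> k; apply: CkM; [exact: openT|exact: Ck_cst|exact: Cf].
have := compact_support_lin a 0 sf sf.
by congr compact_support; apply/funext => x; rewrite mul0r addr0.
Qed.

Lemma Cinftyc_Ckc k D f : Cinftyc D f -> Ckc k D f.
Proof. by move=> [Cf sf]; split. Qed.

Lemma partial_sub i f g x : Cinfty setT f -> Cinfty setT g ->
  partial i (fun x => f x - g x) x = partial i f x - partial i g x.
Proof.
by move=> Cf Cg; apply: deriveB; exact: Cinfty_derivable.
Qed.

Lemma Cinftyc_sub_dom D D' f : D `<=` D' -> Cinftyc D f -> Cinftyc D' f.
Proof. by move=> DD' [Cf [c s]]; split=> //; split=> // x /s /DD'. Qed.

Lemma laplacian_off D f x : compact_support D f -> ~ D x -> laplacian f x = 0.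
Proof.
move=> sf nDx; rewrite /laplacian big1// => i _.
have := compact_support_partial i (compact_support_partial i sf).
by move=> /compact_supportE[K [_ _ KD ->]] => // /KD.
Qed.

Lemma Cinftyc_laplacian D f : Cinftyc D f -> Cinftyc D (laplacian f).
Proof.
move=> Cf; split.
  move=> k; apply: Ck_sum; first exact: openT.
  by move=> i; exact: (Cinftyc_partial i (Cinftyc_partial i Cf)).1.
have [_ /compact_supportE[K [cK clK KD f0]]] := Cf.
apply: (compact_supportI cK KD) => x; apply: laplacian_off.
exact: compact_supportI cK (@subset_refl _ _) f0.
Qed.

Lemma compact_support_bounded D f : continuous f -> compact_support D f ->
  exists2 M, 0 <= M & forall x, `|f x| <= M.
Proof.
move=> cf /compact_supportE[K [cK clK KD f0]].
have cfK : compact (f @` K).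
  by apply: continuous_compact => //; exact: continuous_subspaceT.
have /= [M [_ hM]] := compact_bounded (cfK : compact (f @` K : set R^o)).
exists (Num.max 0 M + 1); first by rewrite addr_ge0// le_max lexx.
move=> x; have [Kx|/f0 ->] := pselect (K x); last first.
  by rewrite normr0 addr_ge0// le_max lexx.
apply: hM; last by exists x.
by rewrite ltr_pwDr// le_max lexx orbT.
Qed.

Lemma compact_support_radius D f : compact_support D f ->
  exists2 A, 0 < A & forall x, A < `|x| -> f x = 0.
Proof.
move=> /compact_supportE[K [cK clK KD f0]].
have /= [M [_ hM]] := compact_bounded cK.
exists (Num.max 0 M + 1); first by rewrite ltr_wpDl// le_max lexx.
move=> x Ax; apply: f0 => Kx; suff /hM/(_ _ Kx) : M < Num.max 0 M + 1 by rewrite /= leNgt Ax.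
by rewrite ltr_pwDr// le_max lexx orbT.
Qed.

End compact_supports.

Section radial.
Context {R : realType} {n : nat}.
Implicit Types (x y : 'rV[R]_n).

Definition sqnorm x : R := \sum_(j < n) x ord0 j ^+ 2.

Lemma sqnorm_ge0 x : 0 <= sqnorm x.
Proof. by apply: sumr_ge0 => i _; exact: sqr_ge0. Qed.

Lemma sqnormC x y : sqnorm (x - y) = sqnorm (y - x).
Proof. by apply: eq_bigr => i _; rewrite !mxE -sqrrN opprB. Qed.

Lemma coord_le_norm x j : `|x ord0 j| <= `|x|.
Proof. by rewrite [leRHS]mx_normrE; exact: (le_bigmax _ _ (ord0, j)). Qed.

Lemma norm_le_coord x (b : R) : 0 <= b -> (forall j, `|x ord0 j| <= b) ->
  `|x| <= b.
Proof.
by move=> b0 xb; rewrite [leLHS]mx_normrE; apply: bigmax_le => // -[i j] _; rewrite ord1.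
Qed.

(** The norm of row vectors is the sup norm, which is only comparable to the
    Euclidean one. *)
Lemma norm_sqnorm x : `|x| ^+ 2 <= sqnorm x.
Proof.
rewrite -[leRHS]sqr_sqrtr ?sqnorm_ge0// lerXn2r ?nnegrE ?sqrtr_ge0//.
apply: norm_le_coord => [|j]; first exact: sqrtr_ge0.
rewrite -sqrtr_sqr ler_wsqrtr// /sqnorm (bigD1 j)//= lerDl.
by apply: sumr_ge0 => i _; exact: sqr_ge0.
Qed.

Lemma sqnorm_norm x : sqnorm x <= n%:R * `|x| ^+ 2.
Proof.
rewrite mulr_natl -[X in _ *+ X]card_ord -sumr_const; apply: ler_sum => j _.
by rewrite -real_normK ?num_real// lerXn2r ?nnegrE//; exact: coord_le_norm.
Qed.

Lemma Cinfty_sqnorm x : Cinfty setT (fun y => sqnorm (y - x)).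
Proof.
move=> k; rewrite /sqnorm; apply: Ck_sum; first exact: openT.
move=> j; rewrite (_ : (fun _ => _) =
  ((fun y => y ord0 j) \+ cst (- x ord0 j)) \* ((fun y => y ord0 j) \+ cst (- x ord0 j))).
  apply: CkM; [exact: openT| |];
    by apply: CkD; [exact: openT|exact: Ck_coord|exact: Ck_cst].
by apply/funext => y; rewrite !mxE expr2.
Qed.

Lemma is_derive_sqnorm x y i :
  is_derive y (delta_mx ord0 i) (fun y => sqnorm (y - x))
    (2 * (y ord0 i - x ord0 i)).
Proof.
rewrite (_ : (fun y => _) = \sum_(j < n) (fun y => (y ord0 j - x ord0 j) ^+ 2)); last first.
  by apply/funext => z; rewrite fct_sumE; apply: eq_bigr => j _; rewrite !mxE.
have d j : is_derive y (delta_mx ord0 i : 'rV[R]_n)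
    (fun y : 'rV[R]_n => (y ord0 j - x ord0 j) ^+ 2)
    (2 * (y ord0 j - x ord0 j) * (i == j)%:R).
  have h := is_deriveB (is_derive_coord j y (delta_mx ord0 i))
    (is_derive_cst (x ord0 j) y (delta_mx ord0 i : 'rV[R]_n)).
  rewrite (_ : (fun _ => _) = ((fun y : 'rV[R]_n => y ord0 j) - cst (x ord0 j)) *
    ((fun y : 'rV[R]_n => y ord0 j) - cst (x ord0 j))).
    apply: (is_derive_eq (is_deriveM h h)).
    by rewrite /GRing.scale/= subr0 mxE eqxx/= eq_sym -mulrDl mulr_natl mulr2n.
  by apply/funext => z; rewrite expr2.
apply: (is_derive_eq (is_derive_sum d)).
rewrite (bigD1 i)//= eqxx mulr1 big1 ?addr0// => j ji.
by rewrite eq_sym (negbTE ji) mulr0.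
Qed.

(** Written as a function of the squared distance, to be smooth at the centre. *)
Definition radial (h : R -> R) (b : R) x y : R := h (b * sqnorm (y - x)).

Lemma Cinfty_radial h b x : smooth h -> Cinfty setT (radial h b x).
Proof.
move=> sh k; apply: (@Ck_comp _ _ _ _ (fun y => b * sqnorm (y - x))) => //.
  exact: openT.
by apply: CkM; [exact: openT|exact: Ck_cst|exact: Cinfty_sqnorm].
Qed.

Lemma is_derive_radial h b x y i : smooth h ->
  is_derive y (delta_mx ord0 i) (radial h b x)
    (2 * b * (y ord0 i - x ord0 i) * radial (derive1 h) b x y).
Proof.
move=> sh.
have h1 := is_deriveZ b (is_derive_sqnorm x y i).
have h2 := smooth_is_derive (b * sqnorm (y - x)) sh.
apply: (is_derive_eq (is_derive_comp1 h2 h1)).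
by rewrite /GRing.scale/= /radial; ring.
Qed.

(** For t = b |y-x|^2 the gradient is 2b(y-x) and the Laplacian is 2bn, so that
    h(t) has Laplacian 2bn h'(t) + 4b t h''(t). *)
Lemma laplacian_radial h b x y : smooth h ->
  laplacian (radial h b x) y =
  2 * b * (n%:R * radial (derive1 h) b x y +
           2 * (b * sqnorm (y - x)) * radial (derive1 (derive1 h)) b x y).
Proof.
move=> sh; have sh' := smooth_derive1 sh.
transitivity (\sum_(i < n) (2 * b * radial (derive1 h) b x y +
   (2 * b) ^+ 2 * radial (derive1 (derive1 h)) b x y * (y ord0 i - x ord0 i) ^+ 2)).
  apply: eq_bigr => i _.
  have E : partial i (radial h b x) =
      (fun y => 2 * b * (y ord0 i - x ord0 i)) \* radial (derive1 h) b x.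
    by apply/funext => z; have [_] := is_derive_radial b x z i sh.
  have h1 := is_deriveZ (2 * b) (is_deriveB (is_derive_coord i y (delta_mx ord0 i))
    (is_derive_cst (x ord0 i) y (delta_mx ord0 i : 'rV[R]_n))).
  have [_ h3] := is_deriveM h1 (is_derive_radial b x y i sh').
  rewrite [LHS](_ : _ = 'D_(delta_mx ord0 i)
    ((2 * b \*: ((fun y : 'rV[R]_n => y ord0 i) - cst (x ord0 i))) *
       radial (derive1 h) b x) y); last by rewrite /partial -/(partial i _) E.
  rewrite h3 (_ : (_ \*: (_ - cst _)) y = 2 * b * (y ord0 i - x ord0 i))//.
  by rewrite /GRing.scale/= mxE !eqxx/=; ring.
rewrite big_split/= sumr_const card_ord -[_ *+ n]mulr_natr -mulr_sumr.
have -> : \sum_(i < n) (y ord0 i - x ord0 i) ^+ 2 = sqnorm (y - x).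
  by apply: eq_bigr => i _; rewrite !mxE.
ring.
Qed.

Lemma radial_bump_support (p : {poly R}) (b : R) x y : 0 < b -> b^-1 <= `|y - x| ^+ 2 ->
  radial (expbump p) b x y = 0.
Proof.
move=> b0 bxy; apply: expbump_ge1.
rewrite -ler_pdivrMl// mulr1; exact: le_trans bxy (norm_sqnorm _).
Qed.

Lemma Cinftyc_radial (p : {poly R}) (b r : R) x D : 0 < b -> 0 < r -> b^-1 < r ^+ 2 ->
  ball x r `<=` D -> Cinftyc D (radial (expbump p) b x).
Proof.
move=> b0 r0 br xD; split.
  by apply: Cinfty_radial; exact: smooth_expbump.
pose s := Num.sqrt b^-1.
have s0 : 0 < s by rewrite sqrtr_gt0 invr_gt0.
have s2 : s ^+ 2 = b^-1 by rewrite sqr_sqrtr// invr_ge0 ltW.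
have sr : s < r.
  by rewrite -(ltr_pXn2r (ltn0Sn 1)) ?nnegrE ?s2// ltW.
apply: (@compact_supportI _ _ (closed_ball x s)).
- apply: bounded_closed_compact; last exact: closed_ball_closed.
  rewrite closed_ballE//; exists (`|x| + s); split; first exact: num_real.
  move=> M hM y /= xy; rewrite (le_trans _ (ltW hM))//.
  by rewrite -[y](subKr x) (le_trans (ler_normB _ _))// lerD2l.
- apply: subset_trans xD; rewrite closed_ballE// => y /= xy.
  by rewrite -ball_normE/=; exact: le_lt_trans xy sr.
- move=> y /= nxy; apply: radial_bump_support => //.
  have sxy : s <= `|y - x|.
    rewrite leNgt; apply/negP => xy; apply: nxy.
    by rewrite closed_ballE//; rewrite /closed_ball_/= distrC ltW.
  by rewrite -s2 lerXn2r ?nnegrE// ltW.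
Qed.

End radial.

(** * Real-valued integrals *)

Section integration_helpers.
Context d (T : measurableType d) (R : realType) (mu : {measure set T -> \bar R}).
Implicit Types (D : set T) (f g h : T -> R).

Lemma le_integrableR D f g : measurable D -> measurable_fun D f ->
  mu.-integrable D (EFin \o g) -> (forall x, D x -> `|f x| <= g x) ->
  mu.-integrable D (EFin \o f).
Proof.
move=> mD mf ig fg; apply: le_integrable ig => //; first exact/measurable_EFinP.
by move=> x Dx /=; rewrite lee_fin (le_trans (fg x Dx))// ler_norm.
Qed.

Lemma integrableM_bdd D f h (M : R) : measurable D ->
  mu.-integrable D (EFin \o f) -> measurable_fun D h ->
  (forall x, D x -> `|h x| <= M) ->
  mu.-integrable D (EFin \o (fun x => f x * h x)).
Proof.
move=> mD fi mh hM.
rewrite (_ : EFin \o _ = ((EFin \o f) \* (EFin \o h))%E); last first.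
  by apply/funext => x /=; rewrite EFinM.
apply: integrableMl => //; exists M; split; first exact: num_real.
by move=> M' MM' x Dx; rewrite /= (le_trans (hM x Dx))// ltW.
Qed.

Lemma integrable_lin D f g (a b : R) : measurable D ->
  mu.-integrable D (EFin \o f) -> mu.-integrable D (EFin \o g) ->
  mu.-integrable D (EFin \o (fun x => a * f x + b * g x)).
Proof.
move=> mD fi gi.
have := integrableD mD (integrableZl mD a fi) (integrableZl mD b gi).
by apply: eq_integrable => // x _ /=; rewrite EFinD !EFinM.
Qed.

Lemma integrable_addR D f g : measurable D ->
  mu.-integrable D (EFin \o f) -> mu.-integrable D (EFin \o g) ->
  mu.-integrable D (EFin \o (fun x => f x + g x)).
Proof. by move=> mD fi gi; have := integrableD mD fi gi. Qed.

Lemma integrable_subR D f g : measurable D ->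
  mu.-integrable D (EFin \o f) -> mu.-integrable D (EFin \o g) ->
  mu.-integrable D (EFin \o (fun x => f x - g x)).
Proof. by move=> mD fi gi; have := integrableB mD fi gi. Qed.

Lemma integrable_scaleR D f (a : R) : measurable D ->
  mu.-integrable D (EFin \o f) ->
  mu.-integrable D (EFin \o (fun x => a * f x)).
Proof. by move=> mD fi; have := integrableZl mD a fi. Qed.

Lemma integrable_sumR D m (F : 'I_m -> T -> R) : measurable D ->
  (forall i, mu.-integrable D (EFin \o F i)) ->
  mu.-integrable D (EFin \o (fun x => \sum_(i < m) F i x)).
Proof.
move=> mD Fi.
have := integrable_sum mD (index_enum 'I_m) (P := xpredT) (fun i _ => Fi i).
by apply: eq_integrable => // x _ /=; rewrite -sumEFin.
Qed.

Lemma Rintegral_sumR D m (F : 'I_m -> T -> R) : measurable D ->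
  (forall i, mu.-integrable D (EFin \o F i)) ->
  \int[mu]_(x in D) (\sum_(i < m) F i x) = \sum_(i < m) \int[mu]_(x in D) F i x.
Proof.
move=> mD; elim: m F => [|m IH] F Fi.
  rewrite big_ord0 (_ : (fun _ => _) = cst 0) ?Rintegral_cst ?mul0r//.
  by apply/funext => x; rewrite big_ord0.
rewrite big_ord_recl -IH; last by move=> i; exact: Fi.
rewrite -RintegralD//; last by apply: integrable_sumR => // i; exact: Fi.
by congr Rintegral; apply/funext => x; rewrite big_ord_recl.
Qed.

Lemma EFin_Rintegral D f : measurable D -> mu.-integrable D (EFin \o f) ->
  (\int[mu]_(x in D) f x)%:E = (\int[mu]_(x in D) (f x)%:E)%E.
Proof. by move=> mD fi; exact: fineK (integrable_fin_num mD fi). Qed.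

Lemma ae_eq_Rintegral D f g : measurable D ->
  measurable_fun D f -> measurable_fun D g ->
  (\forall x \ae mu, D x -> f x = g x) ->
  \int[mu]_(x in D) f x = \int[mu]_(x in D) g x.
Proof.
move=> mD mf mg fg; congr fine; apply: ae_eq_integral => //.
- exact/measurable_EFinP.
- exact/measurable_EFinP.
- by apply: filterS fg => x h Dx; rewrite h.
Qed.

Lemma ae_eq_integrable D f g : measurable D ->
  measurable_fun D f -> measurable_fun D g ->
  (\forall x \ae mu, D x -> f x = g x) ->
  mu.-integrable D (EFin \o f) -> mu.-integrable D (EFin \o g).
Proof.
move=> mD mf mg fg /integrableP[_ fi]; apply/integrableP.
split; first exact/measurable_EFinP.
rewrite (_ : integral _ _ _ = (\int[mu]_(x in D) `|(EFin \o f) x|)%E)//.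
apply: ae_eq_integral => //.
- by apply: measurableT_comp => //; exact/measurable_EFinP.
- by apply: measurableT_comp => //; exact/measurable_EFinP.
- by apply: filterS fg => x h Dx /=; rewrite h.
Qed.

Lemma le_Rintegral_ae D f g : measurable D ->
  mu.-integrable D (EFin \o f) -> mu.-integrable D (EFin \o g) ->
  (\forall x \ae mu, D x -> f x <= g x) ->
  \int[mu]_(x in D) f x <= \int[mu]_(x in D) g x.
Proof.
move=> mD fi gi fg.
have mf : measurable_fun D f by apply/measurable_EFinP; exact: measurable_int fi.
have mg : measurable_fun D g by apply/measurable_EFinP; exact: measurable_int gi.
have mm : measurable_fun D (fun x => Num.max (f x) (g x)) by exact: measurable_maxr.
have E : \forall x \ae mu, D x -> g x = Num.max (f x) (g x).
  by apply: filterS fg => x h /h /max_idPr.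
rewrite [leRHS](ae_eq_Rintegral mD mg mm E).
apply: le_Rintegral => //; first exact: (ae_eq_integrable mD mg mm E gi).
by move=> x _; rewrite le_max lexx.
Qed.

Lemma Rintegral_ge0_eq0 D f : measurable D -> mu.-integrable D (EFin \o f) ->
  (\forall x \ae mu, D x -> 0 <= f x) ->
  \int[mu]_(x in D) f x <= 0 -> \forall x \ae mu, D x -> f x = 0.
Proof.
move=> mD fi f0 int0.
have mf : measurable_fun D f by apply/measurable_EFinP; exact: measurable_int fi.
have E : \int[mu]_(x in D) `|f x| = \int[mu]_(x in D) f x.
  apply: ae_eq_Rintegral => //; first exact: measurableT_comp.
  by apply: filterS f0 => x h /h /ger0_norm.
have i0 : (\int[mu]_(x in D) `|(f x)%:E| = 0)%E.
  have fin := integrable_fin_num mD (integrable_norm fi).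
  have e : (\int[mu]_(x in D) `|(f x)%:E|)%E = (\int[mu]_(x in D) (EFin \o (Num.norm \o f)) x)%E by [].
  rewrite e -(fineK fin); congr (_%:E); apply/eqP; rewrite eq_le.
  have -> : fine (\int[mu]_(x in D) (EFin \o (Num.norm \o f)) x)%E = \int[mu]_(x in D) `|f x| by [].
  by rewrite E int0 -E Rintegral_ge0.
have /(ae_eq_integral_abs mu mD _).1 := i0.
move=> /(_ (measurable_int _ fi)).
by apply: filterS => x h Dx; have /= := h Dx; case.
Qed.

Lemma Rintegral_dominated_cvg D (F : nat -> T -> R) f g : measurable D ->
  (forall k, measurable_fun D (F k)) -> measurable_fun D f ->
  (\forall x \ae mu, D x -> F k x @[k --> \oo] --> f x) ->
  mu.-integrable D (EFin \o g) -> (forall k x, D x -> `|F k x| <= g x) ->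
  \int[mu]_(x in D) F k x @[k --> \oo] --> \int[mu]_(x in D) f x.
Proof.
move=> mD mF mf Ff gi Fg.
have [] := @dominated_convergence _ _ R mu D mD (fun k x => (F k x)%:E)
  (EFin \o f) (EFin \o g).
- by move=> k; exact/measurable_EFinP.
- exact/measurable_EFinP.
- by apply: filterS Ff => x h Dx; apply: cvg_EFin; [exact: nearW|exact: h].
- exact: gi.
- by apply: aeW => x k Dx; rewrite lee_fin; exact: Fg.
- move=> fi _; have fin := integrable_fin_num mD fi.
  by rewrite -(fineK fin) => /fine_cvg.
Qed.

End integration_helpers.

(** * Lebesgue measure on R^n *)

Section lebesgue_rV_facts.
Context {R : realType}.

Lemma measurable_fun_open n (D : set 'rV[R]_n) (f : 'rV[R]_n -> R) :
  open D -> (forall x, D x -> {for x, continuous f}) -> measurable_fun D f.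
Proof.
move=> oD cf; apply: (measurability _ (RGenOpens.measurableE R)).
move=> _ [_ [a [b ->] <-]].
have oB := interval_open (a := BRight a) (b := BLeft b) isT isT.
apply: open_measurable_rV; rewrite openE => x [/= Dx Bx].
apply: filterI; first by apply: open_nbhs_nbhs.
by apply: (cf x Dx); apply: open_nbhs_nbhs.
Qed.

Lemma measurable_continuous n (f : 'rV[R]_n -> R) :
  continuous f -> measurable_fun setT f.
Proof.
by move=> cf; apply: measurable_fun_open => [|x _]; [exact: openT|exact: cf].
Qed.

Lemma norm_le_box n (A : R) : 0 <= A -> [set x : 'rV[R]_n | `|x| <= A] =
  [set x : 'rV[R]_n | forall i, `[- A, A]%classic (x ord0 i)].
Proof.
move=> A0; apply/seteqP; split=> x /= xA.
  by move=> i; rewrite in_itv/= -ler_norml (le_trans (coord_le_norm _ _)).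
by apply: norm_le_coord => // j; have := xA j; rewrite in_itv/= -ler_norml.
Qed.

Lemma measurable_norm_le n (A : R) : 0 <= A ->
  measurable [set x : 'rV[R]_n | `|x| <= A].
Proof.
by move=> A0; rewrite norm_le_box//; apply: (@measurable_box _ n (fun=> _)).
Qed.

Lemma lebesgue_rV_norm_le n (A : R) : 0 <= A ->
  (@lebesgue_rV R n [set x : 'rV[R]_n | `|x| <= A]%R < +oo)%E.
Proof.
move=> A0; rewrite norm_le_box// (@lebesgue_rV_box _ n (fun=> _))//.
have [] : (0 <= \prod_(i < n) @lebesgue_measure R `[(- A)%R, A] /\
           \prod_(i < n) @lebesgue_measure R `[(- A)%R, A] < +oo)%E; last by [].
apply: (@big_ind _ (fun y => 0 <= y /\ y < +oo)%E) => [|x y [x0 xoo] [y0 yoo]|i _].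
- by rewrite lee_fin ltry.
- by split; [exact: mule_ge0|rewrite lte_mul_pinfty// ge0_fin_numE].
- by split; [exact: measure_ge0|rewrite lebesgue_measure_itv/=; case: ifP; rewrite ltry].
Qed.

Lemma ge0_integral_rVS n (F : 'rV[R]_n.+1 -> \bar R) :
  measurable_fun setT F -> (forall x, 0 <= F x)%E ->
  (\int[@lebesgue_rV R n.+1]_x F x =
   \int[@lebesgue_measure R]_s \int[@lebesgue_rV R n]_x F (cons_rV (s, x)))%E.
Proof.
move=> mF F0.
have mc : measurable_fun [set: (measurableTypeR R * 'rV[R]_n)%type]
  (@cons_rV R n) by exact: measurable_cons_rV.
have mFc : measurable_fun [set: (measurableTypeR R * 'rV[R]_n)%type]
  (F \o @cons_rV R n) by exact: measurableT_comp.
transitivity (\int[(@lebesgue_measure R) \x (@lebesgue_rV R n)]_z F (cons_rV z))%E.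
  have := @ge0_integral_pushforward _ _ _ _ R _ mc
    ((@lebesgue_measure R) \x (@lebesgue_rV R n))%E setT F measurableT mF.
  rewrite preimage_setT => <-; last by move=> z _; exact: F0.
  by apply: eq_measure_integral => A mA _; exact: lebesgue_rVS.
have := fubini_tonelli1 (m1 := @lebesgue_measure R) (m2 := @lebesgue_rV R n) (F \o @cons_rV R n) mFc.
by apply => z; exact: F0.
Qed.

Lemma lebesgue_measure_translation (a : R) (A : set R) : measurable A ->
  @lebesgue_measure R [set t | A (t + a)] = @lebesgue_measure R A.
Proof.
move=> mA.
have mt : measurable_fun setT (fun t : R => t + a : measurableTypeR R).
  exact: measurable_funD.
apply/esym; rewrite -[RHS]/(pushforward (@lebesgue_measure R) (fun t : R => t + a : measurableTypeR R) A).
apply: lebesgue_measure_unique => //= _ [[b c]] _ <-.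
rewrite /pushforward /preimage/=.
rewrite [X in _ = lebesgue_measure X](_ : _ = `](b - a), (c - a)]%classic); last first.
  by apply/seteqP; split=> t /=; rewrite !in_itv/= ltrBlDr lerBrDr.
by rewrite !lebesgue_measure_itv/= !lte_fin ltrD2r -!EFinB opprD opprK addrACA addNr addr0.
Qed.

Lemma ge0_integral_translation1 (a : R) (F : R -> \bar R) :
  measurable_fun setT F -> (forall x, 0 <= F x)%E ->
  (\int[@lebesgue_measure R]_s F (s + a)%R = \int[@lebesgue_measure R]_s F s)%E.
Proof.
move=> mF F0.
have mt : measurable_fun [set: measurableTypeR R]
    (fun t : measurableTypeR R => t + a : measurableTypeR R).
  exact: measurable_funD.
have := @ge0_integral_pushforward _ _ _ _ R _ mt (@lebesgue_measure R) setT F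
  measurableT mF.
rewrite preimage_setT => <-; last by move=> z _; exact: F0.
by apply: eq_measure_integral => A mA _; exact: lebesgue_measure_translation.
Qed.

Lemma measurable_translation n (y : 'rV[R]_n) :
  measurable_fun setT (fun x : 'rV[R]_n => x + y).
Proof.
apply/measurable_fun_rVP => i.
rewrite (_ : (fun x => _) = (fun x : 'rV[R]_n => x ord0 i + y ord0 i)).
  by apply: measurable_funD => //; exact: measurable_coord.
by apply/funext => x; rewrite mxE.
Qed.

(** Induction on the dimension: a translation acts separately on the two
    factors of the product measure. *)
Lemma ge0_integral_translation n (y : 'rV[R]_n) (F : 'rV[R]_n -> \bar R) :
  measurable_fun setT F -> (forall x, 0 <= F x)%E ->
  (\int[@lebesgue_rV R n]_x F (x + y)%R = \int[@lebesgue_rV R n]_x F x)%E.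
Proof.
elim: n y F => [|n IH] y F mF F0.
  apply: eq_integral => x _; congr F; apply/rowP; case; by [].
have mFy : measurable_fun setT (fun x : 'rV[R]_n.+1 => F (x + y)%R).
  exact: measurableT_comp mF (measurable_translation y).
rewrite (ge0_integral_rVS mFy (fun x => F0 _)) (ge0_integral_rVS mF F0).
have E s x : (cons_rV (s, x) + y = cons_rV (s + y ord0 ord0, x + (behead_rV y).2))%R.
  apply/rowP => i; rewrite /cons_rV !mxE.
  by case: (unliftP ord0 i) => [j|] ->; rewrite ?liftK ?unlift_none/= ?mxE.
have mFs s : measurable_fun setT (fun x : 'rV[R]_n => F (cons_rV (s, x))).
  apply: measurableT_comp => //.
  apply: (measurableT_comp (@measurable_cons_rV _ _)).
  exact: measurable_pair1.
under eq_integral => s _.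
  under eq_integral do rewrite E.
  rewrite (IH _ (fun x => F (cons_rV (s + y ord0 ord0, x)))); [|exact: mFs|by []].
  over.
apply: (@ge0_integral_translation1 (y ord0 ord0)
  (fun s => (\int[@lebesgue_rV R n]_x F (cons_rV (s, x)))%E)).
- apply: (measurable_fun_fubini_tonelli_F (F \o @cons_rV R n)) => //.
    by apply: measurableT_comp => //; exact: measurable_cons_rV.
  by move=> z; exact: F0.
- by move=> s; apply: integral_ge0.
Qed.

Lemma Rintegral_translation n (y : 'rV[R]_n) (f : 'rV[R]_n -> R) :
  (@lebesgue_rV R n).-integrable setT (EFin \o f) ->
  \int[@lebesgue_rV R n]_x f (x + y) = \int[@lebesgue_rV R n]_x f x.
Proof.
move=> fi; have mf := measurable_int _ fi.
have mp := measurable_funepos mf; have mn := measurable_funeneg mf.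
have Ep := @ge0_integral_translation n y (EFin \o f)^\+%E mp (funepos_ge0 _).
have En := @ge0_integral_translation n y (EFin \o f)^\-%E mn (funeneg_ge0 _).
rewrite /Rintegral.
rewrite [X in fine X = _]integralE.
rewrite [X in _ = fine X]integralE.
congr (fine (_ - _)%E).
  rewrite -[RHS]Ep; apply: eq_integral => x _; by rewrite !funeposE.
rewrite -[RHS]En; apply: eq_integral => x _; by rewrite !funenegE.
Qed.

Lemma integrable_translation n (y : 'rV[R]_n) (f : 'rV[R]_n -> R) :
  (@lebesgue_rV R n).-integrable setT (EFin \o f) ->
  (@lebesgue_rV R n).-integrable setT (EFin \o (fun x => f (x + y))).
Proof.
move=> /integrableP[/measurable_EFinP mf foo]; apply/integrableP; split.
  apply/measurable_EFinP.
  exact: (measurableT_comp (f := f) mf (measurable_translation y)).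
rewrite (@ge0_integral_translation n y (fun x => `|(f x)%:E|%E))//.
by apply/measurableT_comp => //; exact/measurable_EFinP.
Qed.

Lemma integrable_bounded_ball n (A M : R) : 0 <= A ->
  (@lebesgue_rV R n).-integrable setT
    (EFin \o (fun x : 'rV[R]_n => M * \1_[set x : 'rV[R]_n | `|x| <= A] x)).
Proof.
move=> A0; have mA := @measurable_norm_le n A A0.
apply: integrable_scaleR => //; apply/integrableP; split.
  by apply/measurable_EFinP; exact: measurable_indic.
under eq_integral => x _ do rewrite /= ger0_norm//.
by rewrite integral_indic// setIT; exact: lebesgue_rV_norm_le.
Qed.

Lemma integrable_cs n (f : 'rV[R]_n -> R) D : continuous f ->
  compact_support D f -> (@lebesgue_rV R n).-integrable setT (EFin \o f).
Proof.
move=> cf sf; have [M M0 fM] := compact_support_bounded cf sf.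
have [A A0 fA] := compact_support_radius sf.
have mf := measurable_continuous cf.
apply: (@le_integrableR _ _ _ _ _ _ (fun x => M * \1_[set x : 'rV[R]_n | `|x| <= A] x)) => //.
  exact: integrable_bounded_ball (ltW A0).
move=> x _; rewrite indicE; have [xA|xA] := leP `|x| A.
  by rewrite mem_set ?mulr1.
by rewrite fA// normr0 mulr_ge0.
Qed.

End lebesgue_rV_facts.

(** * Convolution with test functions *)

(** Continuity from sequences, the form in which dominated convergence
    provides it. *)
Lemma seq_continuous (R : realType) (T : pseudoMetricType R) (f : T -> R) (x : T) :
  (forall u : nat -> T, u @ \oo --> x -> f (u k) @[k --> \oo] --> f x) ->
  {for x, continuous f}.
Proof.
move=> h; apply: contrapT => /cvgrPdist_lt nc.
have [e /not_implyP[e0 he]] : exists e : R,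
    ~ (0 < e -> \forall t \near x, `|f x - f t| < e).
  by apply/existsNP => hh; apply: nc => e e0; exact: hh.
have /choice[u hu] : forall k : nat, exists y : T,
    ball x k.+1%:R^-1 y /\ ~ `|f x - f y| < e.
  move=> k; apply: contrapT => hk; apply: he.
  apply/nbhs_ballP; exists k.+1%:R^-1 => /=; first by rewrite invr_gt0.
  by move=> y xy; apply: contrapT => hy; apply: hk; exists y.
have ux : u @ \oo --> x.
  apply/cvg_ballP => r r0.
  have [k _ hk] := near_infty_natSinv_lt (PosNum r0).
  exists k => // j /= kj; apply: le_ball (hu j).1.
  exact/ltW/(hk j kj).
have /cvgrPdist_lt/(_ e e0)[k _ /(_ k (leqnn k))] := h u ux.
by have [_] := hu k.
Qed.

Section convolution.
Context {R : realType} {n : nat}.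
Local Notation mu := (@lebesgue_rV R n).
Implicit Types (w f : 'rV[R]_n -> R) (x y : 'rV[R]_n).

Definition convol w f x := \int[mu]_y (w y * f (x - y)).

Lemma measurable_reflect x : measurable_fun setT (fun y : 'rV[R]_n => x - y).
Proof.
apply/measurable_fun_rVP => i.
rewrite (_ : (fun y => _) = (fun y : 'rV[R]_n => x ord0 i - y ord0 i)).
  by apply: measurable_funB => //; exact: measurable_coord.
by apply/funext => y; rewrite !mxE.
Qed.

Lemma measurable_fun_reflect f x : continuous f ->
  measurable_fun setT (fun y => f (x - y)).
Proof.
move=> /measurable_continuous mf.
exact: (measurableT_comp (f := f) mf (measurable_reflect x)).
Qed.

Lemma integrable_convol w f x (M : R) : mu.-integrable setT (EFin \o w) ->
  continuous f -> (forall y, `|f y| <= M) ->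
  mu.-integrable setT (EFin \o (fun y => w y * f (x - y))).
Proof.
move=> wi cf fM; apply: (integrableM_bdd (M := M)) => //.
exact: measurable_fun_reflect.
Qed.

Lemma convol_continuous w f (M : R) : mu.-integrable setT (EFin \o w) ->
  continuous f -> (forall y, `|f y| <= M) -> continuous (convol w f).
Proof.
move=> wi cf fM x; apply: seq_continuous => u ux.
have mw : measurable_fun setT w.
  by apply/measurable_EFinP; exact: measurable_int wi.
apply: (Rintegral_dominated_cvg (g := fun y => M * `|w y|)) => //.
- move=> k; apply: measurable_funM => //; exact: measurable_fun_reflect.
- apply: measurable_funM => //; exact: measurable_fun_reflect.
- apply: aeW => y _; apply: (@cvgM _ _ _ _ (cst (w y))); first exact: cvg_cst.
  have uy : (fun k => u k - y) @ \oo --> x - y.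
    by apply: cvgB => //; exact: cvg_cst.
  exact: (cvg_comp _ _ uy (cf (x - y))).
- by apply: integrable_scaleR => //; exact: integrable_norm.
- by move=> k y _; rewrite normrM mulrC ler_wpM2r.
Qed.

(** Differentiation under the integral sign, dominated by a multiple of |w|. *)
Lemma convol_is_derive w f x i : mu.-integrable setT (EFin \o w) ->
  Cinftyc setT f ->
  is_derive x (delta_mx ord0 i) (convol w f) (convol w (partial i f) x).
Proof.
move=> wi Cf; have [Cf' sf] := Cf.
have [M M0 fM] := compact_support_bounded (Cinfty_cont Cf') sf.
have [Cp sp] := Cinftyc_partial i Cf.
have [L L0 pL] := compact_support_bounded (Cinfty_cont Cp) sp.
set e := delta_mx ord0 i.
pose F (t : R) (y : 'rV[R]_n) := w y * f (x + t *: e - y).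
have dF t y : is_derive t (1 : R) (F ^~ y) (w y * partial i f (x + t *: e - y)).
  have h : is_derive (x - y + t *: e) e f (partial i f (x + t *: e - y)).
    rewrite (_ : x + t *: e - y = x - y + t *: e); last by rewrite addrAC.
    by apply: DeriveDef => //; exact: Cinfty_derivable.
  have /is_derive_line h' := h.
  have := is_deriveZ (w y) h'.
  rewrite (_ : _ \*: _ = F ^~ y)//; apply/funext => s.
  by rewrite /F /=  addrAC.
have intF t : `](-1), 1[%classic t -> mu.-integrable setT (EFin \o F t).
  move=> _; exact: (integrable_convol _ wi (Cinfty_cont Cf') fM).
have I0 : `](-1), 1[%classic (0 : R) by rewrite /= in_itv/= ltrN10 ltr01.
have iG : mu.-integrable setT (EFin \o (fun y => L * `|w y|)).
  by apply: integrable_scaleR => //; exact: integrable_norm.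
have G0 y : 0 <= L * `|w y| by rewrite mulr_ge0.
have derF t y : `](-1), 1[%classic t -> setT y -> derivable (F ^~ y) t 1.
  by move=> _ _; have [] := dF t y.
have d1F t y : partial1of2 F t y = w y * partial i f (x + t *: e - y).
  by rewrite partial1of2E; have [_] := dF t y.
have Gub t y : `](-1), 1[%classic t -> setT y -> `|partial1of2 F t y| <= L * `|w y|.
  by move=> _ _; rewrite d1F normrM mulrC ler_wpM2r.
have D := derivable_under_integral measurableT I0 intF derF G0 iG Gub.
have E := differentiation_under_integral measurableT I0 intF derF G0 iG Gub.
apply/is_derive_line0; apply: DeriveDef; first exact: D.
rewrite -derive1E [LHS]E; apply: eq_Rintegral => y _.
rewrite -[RHS]/(w y * partial i f (x - y)).
by rewrite -[LHS]/(partial1of2 F 0 y) d1F scale0r addr0.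
Qed.

Lemma convol_Cinfty w f : mu.-integrable setT (EFin \o w) -> Cinftyc setT f ->
  Cinfty setT (convol w f).
Proof.
move=> wi Cf k; elim: k f Cf => [|k IH] f Cf.
  have [Cf' sf] := Cf.
  have [M M0 fM] := compact_support_bounded (Cinfty_cont Cf') sf.
  split=> // x _; apply: (convol_continuous wi (Cinfty_cont Cf') fM).
split=> [x _|i].
  exact: Ck_cont (IH f Cf) I.
split=> [x _|]; first by have [] := convol_is_derive x i wi Cf.
rewrite (_ : partial i _ = convol w (partial i f)).
  by apply: IH; exact: Cinftyc_partial.
by apply/funext => x; have [_] := convol_is_derive x i wi Cf.
Qed.

Lemma norm_delta_mx i : `|delta_mx ord0 i : 'rV[R]_n| <= 1.
Proof.
apply: norm_le_coord => // j; rewrite mxE eqxx/=.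
by case: (j == i); rewrite ?normr1 ?normr0.
Qed.

(** The integral of f(. + t e_i) does not depend on t, and its derivative at
    t = 0 is the integral of the partial derivative. *)
Lemma Rintegral_partial f i : Cinftyc setT f -> \int[mu]_x partial i f x = 0.
Proof.
move=> Cf; have [Cf' sf] := Cf.
have [Cp sp] := Cinftyc_partial i Cf.
have [L L0 pL] := compact_support_bounded (Cinfty_cont Cp) sp.
have [A A0 pA] := compact_support_radius sp.
pose e : 'rV[R]_n := delta_mx ord0 i.
pose F (t : R) (y : 'rV[R]_n) := f (y + t *: e).
have dF t y : is_derive t (1 : R) (F ^~ y) (partial i f (y + t *: e)).
  by apply/is_derive_line; apply: DeriveDef => //; exact: Cinfty_derivable.
have if0 : mu.-integrable setT (EFin \o f).
  exact: integrable_cs (Cinfty_cont Cf') sf.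
have intF t : `](-1), 1[%classic t -> mu.-integrable setT (EFin \o F t).
  by move=> _; exact: integrable_translation.
have I0 : `](-1), 1[%classic (0 : R) by rewrite /= in_itv/= ltrN10 ltr01.
pose G (y : 'rV[R]_n) := L * \1_[set y : 'rV[R]_n | `|y| <= A + 1] y.
have iG : mu.-integrable setT (EFin \o G).
  by apply: integrable_bounded_ball; rewrite addr_ge0// ltW.
have G0 y : 0 <= G y by rewrite mulr_ge0.
have derF t y : `](-1), 1[%classic t -> setT y -> derivable (F ^~ y) t 1.
  by move=> _ _; have [] := dF t y.
have d1F t y : partial1of2 F t y = partial i f (y + t *: e).
  by rewrite partial1of2E; have [_] := dF t y.
have Gub t y : `](-1), 1[%classic t -> setT y -> `|partial1of2 F t y| <= G y.
  rewrite /= in_itv/= -ltr_norml => t1 _; rewrite d1F /G indicE.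
  have [yA|yA] := leP `|y| (A + 1); first by rewrite mem_set ?mulr1.
  rewrite pA ?normr0 ?mulr_ge0//.
  have : `|y| <= `|y + t *: e| + `|t *: e|.
    by rewrite -[y in leLHS](addrK (t *: e)) (le_trans (ler_normB _ _)).
  rewrite normrZ => h.
  have : `|t| * `|e| <= 1.
    rewrite -[leRHS]mulr1; apply: ler_pM => //; [exact: ltW|exact: norm_delta_mx].
  by move: h yA; set a := `|y|; set b := `|_ + _|; set c := _ * _; lra.
have E := differentiation_under_integral measurableT I0 intF derF G0 iG Gub.
transitivity (\int[mu]_y partial1of2 F 0 y).
  by apply: eq_Rintegral => y _; rewrite d1F scale0r addr0.
rewrite -[LHS]E (_ : (fun _ => _) = cst (\int[mu]_y f y)) ?derive1_cst//.
by apply/funext => t; rewrite /F Rintegral_translation.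
Qed.

Lemma Rintegral_laplacian f : Cinftyc setT f -> \int[mu]_x laplacian f x = 0.
Proof.
move=> Cf; rewrite Rintegral_sumR//.
  by rewrite big1// => i _; apply: Rintegral_partial; exact: Cinftyc_partial.
move=> i; have [C s] := Cinftyc_partial i (Cinftyc_partial i Cf).
exact: integrable_cs (Cinfty_cont C) s.
Qed.

End convolution.

(** * Functions with the same integrals over boxes *)

Section boxes.
Context {R : realType} {n : nat}.
Local Notation mu := (@lebesgue_rV R n).

Definition obox (a b : 'I_n -> R) : set 'rV[R]_n :=
  [set x | forall i, `]a i, b i[%classic (x ord0 i)].

Lemma measurable_obox a b : measurable (obox a b).
Proof. exact: (@measurable_box _ n (fun i => `]a i, b i[%classic)). Qed.

Lemma obox_open a b : open (obox a b).
Proof.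
rewrite openE => x xab.
have : nbhs x (fun y : 'rV[R]_n => forall i, `]a i, b i[%classic (y ord0 i)).
  apply: (@filter_forall _ _ _ (nbhs x) (nbhs_filter x)) => i.
  have : nbhs (x ord0 i) `]a i, b i[%classic.
    by apply: open_nbhs_nbhs; split; [exact: interval_open|exact: xab].
  exact: coord_continuous.
by [].
Qed.

Lemma oboxI a b c d : obox a b `&` obox c d =
  obox (fun i => Num.max (a i) (c i)) (fun i => Num.min (b i) (d i)).
Proof.
apply/seteqP; split=> x /=.
  move=> [h1 h2] i; have := h1 i; have := h2 i; rewrite /= !in_itv/= gt_max lt_min.
  by move=> /andP[-> ->] /andP[-> ->].
move=> h; split=> i; have := h i; rewrite /= !in_itv/= gt_max lt_min;
  by move=> /andP[/andP[? ?] /andP[? ?]]; apply/andP.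
Qed.

Definition oboxes := [set A | exists a b, A = obox a b].

Lemma oboxes_setI : setI_closed oboxes.
Proof.
by move=> _ _ [a [b ->]] [c [d ->]]; rewrite oboxI; do 2 eexists; reflexivity.
Qed.

Lemma oboxes_generate : @measurable _ 'rV[R]_n = <<s oboxes >>.
Proof.
apply/seteqP; split; last first.
  apply: smallest_sub; first exact: sigma_algebra_measurable.
  by move=> _ [a [b ->]]; exact: measurable_obox.
have : measurable_fun [set: g_sigma_algebraType oboxes]
    (id : g_sigma_algebraType oboxes -> 'rV[R]_n).
  apply/measurable_fun_rVP => i.
  apply: (measurability _ (RGenOpens.measurableE R)).
  move=> _ [_ [a [b ->] <-]].
  rewrite setTI (_ : _ @^-1` _ = \bigcup_k obox
    (fun j => if j == i then a else - k%:R) (fun j => if j == i then b else k%:R)).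
    apply: bigcupT_measurable => k; apply: sub_sigma_algebra.
    by do 2 eexists; reflexivity.
  apply/seteqP; split=> x /=; last first.
    by move=> [k _ /(_ i)]; rewrite eqxx.
  move=> xab; exists (Num.bound `|x|) => // j /=.
  case: (j =P i) => [->//|_]; rewrite in_itv/= -ltr_norml.
  apply: le_lt_trans (coord_le_norm _ _) _.
  by have := archi_boundP (normr_ge0 x).
by move=> h A mA; have := h measurableT A mA; rewrite setTI preimage_id.
Qed.

Lemma hyperplane_null i (c : R) : mu [set x : 'rV[R]_n | x ord0 i = c] = 0%E.
Proof.
pose A (j : 'I_n) : set R := if j == i then [set c] else setT.
have mA j : measurable (A j) by rewrite /A; case: ifP.
rewrite (_ : mkset _ = [set x : 'rV[R]_n | forall j, A j (x ord0 j)]).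
  rewrite lebesgue_rV_box// (bigD1 i)//= /A eqxx lebesgue_measure_set1.
  by rewrite mul0e.
apply/seteqP; split=> x /=; last by move=> /(_ i); rewrite /A eqxx.
by move=> xc j; rewrite /A; case: eqP => [->|].
Qed.

(** The boundary of a box lies in finitely many null hyperplanes; off it the
    indicator function of the box is locally constant. *)
Lemma obox_boundary_null (a b : 'I_n -> R) :
  \forall x \ae mu, forall i : 'I_n, (x : 'rV[R]_n) ord0 i != a i /\ x ord0 i != b i.
Proof.
have : \forall x \ae mu, forall i, i \in index_enum 'I_n ->
    (x : 'rV[R]_n) ord0 i != a i /\ x ord0 i != b i.
  elim: (index_enum 'I_n) => [|i s IH]; first exact: aeW.
  have hyp c : \forall x \ae mu, (x : 'rV[R]_n) ord0 i != c.
    exists [set x : 'rV[R]_n | x ord0 i = c]; split; last by move=> x /= /negP/negbNE/eqP.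
      rewrite (_ : [set _ | _] = (fun x : 'rV[R]_n => x ord0 i) @^-1` [set c])//.
      by rewrite -[X in measurable X]setTI; exact: measurable_coord.
    exact: hyperplane_null.
  apply: filterS3 IH (hyp (a i)) (hyp (b i)) => x h h1 h2 j.
  by rewrite inE => /predU1P[->|/h].
by apply: filterS => x h i; apply: h; rewrite mem_index_enum.
Qed.

(** The sets over which f - g has integral 0 are stable under complements and
    disjoint unions and contain the boxes, which are stable under
    intersections and generate the Borel sets. *)
Lemma ae_eq_of_obox (Q : set 'rV[R]_n) (f g : 'rV[R]_n -> R) a b :
  Q = obox a b ->
  mu.-integrable Q (EFin \o f) -> mu.-integrable Q (EFin \o g) ->
  (forall c d, obox c d `<=` Q ->
    \int[mu]_(x in obox c d) f x = \int[mu]_(x in obox c d) g x) ->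
  \forall x \ae mu, Q x -> f x = g x.
Proof.
move=> QE fi gi fg; have mQ : measurable Q by rewrite QE; exact: measurable_obox.
pose h x := f x - g x.
have hi : mu.-integrable Q (EFin \o h) by exact: integrable_subR.
have h0 c d : obox c d `<=` Q -> (\int[mu]_(x in obox c d) (h x)%:E = 0)%E.
  move=> cd; have mcd := measurable_obox c d.
  have fi' := integrableS mQ mcd cd fi; have gi' := integrableS mQ mcd cd gi.
  have fin := integrable_fin_num mcd (integrableS mQ mcd cd hi).
  rewrite -(fineK fin); congr (_%:E).
  by rewrite -[LHS]/(\int[mu]_(x in obox c d) h x) RintegralB// fg// subrr.
have hQ : (\int[mu]_(x in Q) (h x)%:E = 0)%E by rewrite {1}QE h0// QE.
have key E : measurable E -> (\int[mu]_(x in Q `&` E) (h x)%:E = 0)%E.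
  move=> mE; have : <<s oboxes >> E by rewrite -oboxes_generate.
  move: E {mE}; apply: (dynkin_induction oboxes_generate oboxes_setI).
  - by rewrite setIT.
  - move=> _ [c [d ->]]; rewrite QE oboxI h0// -oboxI -QE; exact: subIsetl.
  - move=> E mE E0; have mQE : measurable (Q `&` E) by exact: measurableI.
    have mQCE : measurable (Q `&` ~` E) by apply: measurableI => //; exact: measurableC.
    have QU : Q = (Q `&` E) `|` (Q `&` ~` E) by rewrite -setIUr setUv setIT.
    have := hQ; rewrite {1}QU integral_setU_EFin//.
    + by rewrite E0 add0e.
    + by rewrite -QU; apply/measurable_EFinP; exact: measurable_int hi.
    + apply/disj_setPS => x [[_ Ex] [_ nEx]]; exact: (nEx Ex).
  - move=> F mF tF F0; rewrite setI_bigcupr integral_bigcup//.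
    + by apply: eseries0 => i _ _; exact: F0.
    + exact: trivIset_setIl.
    + by move=> i; exact: measurableI.
    + rewrite -setI_bigcupr; apply: (integrableS mQ _ _ hi).
        by apply: measurableI => //; exact: bigcupT_measurable.
      exact: subIsetl.
have : ae_eq mu Q (EFin \o h) (cst 0%E).
  apply: integral_ae_eq => // E EQ mE; rewrite integral_cst// mul0e.
  by rewrite -(key E mE) setIidr.
by apply: filterS => x hx Qx; have /= [/eqP] := hx Qx; rewrite subr_eq0 => /eqP.
Qed.

Lemma integrable_indic_obox (a b : 'I_n -> R) :
  mu.-integrable setT (EFin \o \1_(obox a b)).
Proof.
have mB := measurable_obox a b.
apply/integrableP; split; first by apply/measurable_EFinP; exact: measurable_indic.
under eq_integral => x _ do rewrite /= ger0_norm//.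
rewrite integral_indic// setIT.
pose A := \sum_i (`|a i| + `|b i|).
have A0 : 0 <= A by apply: sumr_ge0 => i _; rewrite addr_ge0.
apply: le_lt_trans (lebesgue_rV_norm_le n A0).
apply: le_measure; rewrite ?inE//; first exact: measurable_norm_le.
move=> x xab /=; apply: norm_le_coord => // j.
apply: (@le_trans _ _ (`|a j| + `|b j|)).
  have := xab j; rewrite /= in_itv/= => /andP[h1 h2].
  have := ler_norm (b j); have := ler_norm (- a j); rewrite normrN => h3 h4.
  have := normr_ge0 (a j); have := normr_ge0 (b j).
  by rewrite ler_norml => ? ?; apply/andP; split; lra.
rewrite /A (bigD1 j)//= lerDl; apply: sumr_ge0 => i _; exact: addr_ge0.
Qed.

End boxes.

(** * A mollifier whose scale derivative is a Laplacian *)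

Section mollifier.
Context {R : realType} {n : nat}.
Local Notation mu := (@lebesgue_rV R n.+1).
Implicit Types (x y z : 'rV[R]_n.+1) (w : 'rV[R]_n.+1 -> R) (a b : R).

(** The profile has to be the derivative of a bump, which forces the factor
    1/(1-t)^2 in front of exp(-1/(1-t)); see [derive1_primitive] and
    [drho_laplacian]. *)
Definition profile : R -> R := expbump 'X^2.
Definition primitive : R -> R := expbump (- 1).

Lemma smooth_profile : smooth profile. Proof. exact: smooth_expbump. Qed.

Lemma smooth_primitive : smooth primitive. Proof. exact: smooth_expbump. Qed.

Lemma derive1_primitive : derive1 primitive = profile.
Proof.
rewrite /primitive derive1_expbump /expbump_deriv derivN derivC oppr0 sub0r.
by rewrite opprK mulr1.
Qed.

Lemma profile_ge0 (t : R) : 0 <= profile t.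
Proof.
rewrite /profile /expbump; case: ifP => // t1.
by rewrite hornerXn mulr_ge0 ?expR_ge0// exprn_even_ge0.
Qed.

Lemma profile_gt0 (t : R) : t < 1 -> 0 < profile t.
Proof.
move=> t1; rewrite /profile expbump_lt1// hornerXn mulr_gt0 ?expR_gt0//.
by rewrite exprn_even_gt0//= invr_neq0// subr_eq0 gt_eqF.
Qed.

(** The scale is 1/a: this kernel vanishes for |z| >= 1/a, and its integral
    does not depend on a (see [rho_mass]). *)
Definition rho a z : R := a ^+ n.+1 * radial profile (a ^+ 2) 0 z.

(** The derivative of [rho] with respect to a, see [is_derive_rho]. *)
Definition drho a z : R := a ^+ n * (n.+1%:R * profile (a ^+ 2 * sqnorm z) +
  2 * (a ^+ 2 * sqnorm z) * derive1 profile (a ^+ 2 * sqnorm z)).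

Lemma rhoE a z : rho a z = a ^+ n.+1 * profile (a ^+ 2 * sqnorm z).
Proof. by rewrite /rho /radial subr0. Qed.

Lemma rho_ge0 a z : 0 <= a -> 0 <= rho a z.
Proof. by move=> a0; rewrite rhoE mulr_ge0 ?exprn_ge0// profile_ge0. Qed.

Lemma rhoN a z : rho a (- z) = rho a z.
Proof.
rewrite !rhoE (_ : sqnorm (- z) = sqnorm z)//.
by apply: eq_bigr => i _; rewrite mxE sqrrN.
Qed.

Lemma rhoC a x y : rho a (x - y) = rho a (y - x).
Proof. by rewrite -rhoN opprB. Qed.

Lemma rho_support a z : 0 < a -> a^-1 <= `|z| -> rho a z = 0.
Proof.
move=> a0 az; rewrite /rho radial_bump_support ?mulr0 ?exprn_gt0//.
by rewrite subr0 -exprVn lerXn2r// nnegrE// invr_ge0 ltW.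
Qed.

Lemma rho_gt0 a z : 0 < a -> n.+1%:R * `|z| ^+ 2 < a ^- 2 -> 0 < rho a z.
Proof.
move=> a0 az; rewrite rhoE mulr_gt0 ?exprn_gt0// profile_gt0//.
rewrite mulrC -ltr_pdivlMr ?exprn_gt0// mul1r.
exact: le_lt_trans (sqnorm_norm z) az.
Qed.

Lemma Cinftyc_rho a : 0 < a -> Cinftyc setT (rho a).
Proof.
move=> a0.
have [] := @Cinftyc_radial R n.+1 'X^2 (a ^+ 2) (a^-1 + 1) 0 setT.
- by rewrite exprn_gt0.
- by rewrite addr_gt0// invr_gt0.
- by rewrite -exprVn ltrXn2r// ?nnegrE ?addr_ge0 ?invr_ge0 ?ltW// ltrDl.
- by [].
by move=> C s; apply: Cinftyc_scale.
Qed.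

Lemma rho_bounded : exists2 M, 0 <= M &
  forall a z, 0 <= a -> `|rho a z| <= a ^+ n.+1 * M.
Proof.
have [M M0 hM] := @expbump_bounded R 'X^2; exists M => // a z a0.
rewrite rhoE normrM ger0_norm ?exprn_ge0// ler_wpM2l ?exprn_ge0//.
by apply: hM; rewrite mulr_ge0 ?exprn_ge0// sqnorm_ge0.
Qed.

Lemma drho_bounded : exists2 M, 0 <= M &
  forall a z, 0 <= a -> `|drho a z| <= a ^+ n * M.
Proof.
have [M M0 hM] := @expbump_bounded R 'X^2.
have [L L0 hL] := @expbump_bounded R (expbump_deriv 'X^2).
exists (n.+1%:R * M + 2 * L); first by rewrite addr_ge0// mulr_ge0.
move=> a z a0; rewrite normrM ger0_norm ?exprn_ge0// ler_wpM2l ?exprn_ge0//.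
set t := a ^+ 2 * sqnorm z.
have t0 : 0 <= t by rewrite mulr_ge0 ?exprn_ge0// sqnorm_ge0.
move: t t0 => t t0.
apply: le_trans (ler_normD _ _) _; apply: lerD.
  by rewrite normrM ger0_norm// ler_wpM2l//; exact: hM.
rewrite /profile derive1_expbump.
have [t1|t1] := ltP t 1; last by rewrite (expbump_ge1 _ t1) mulr0 normr0 mulr_ge0.
rewrite !normrM (ger0_norm t0) (ger0_norm (_ : 0 <= 2))// -mulrA ler_wpM2l//.
rewrite -[leRHS]mul1r ler_pM//; [exact: ltW|exact: hL].
Qed.

Lemma is_derive_rho a z : is_derive a (1 : R) (rho ^~ z) (drho a z).
Proof.
have d1 : is_derive a (1 : R) (fun a : R => a ^+ n.+1) (n.+1%:R * a ^+ n).
  have := is_derive_poly ('X^(n.+1)) a.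
  rewrite derivXn hornerMn hornerXn -mulr_natl.
  by rewrite (_ : horner _ = fun a => a ^+ n.+1)//; apply/funext => t; rewrite hornerXn.
have d2 : is_derive a (1 : R) (fun a : R => a ^+ 2 * sqnorm z) (2 * a * sqnorm z).
  have := is_derive_poly (sqnorm z *: 'X^2) a.
  rewrite derivZ derivXn hornerZ hornerMn hornerXn expr1 -mulr_natl mulrC.
  rewrite (_ : horner _ = fun a => a ^+ 2 * sqnorm z)//.
  by apply/funext => t; rewrite hornerZ hornerXn mulrC.
have d3 := @is_derive1_comp _ profile (fun a : R => a ^+ 2 * sqnorm z) a _ _
  (smooth_is_derive (a ^+ 2 * sqnorm z) smooth_profile) d2.
rewrite (_ : (fun a => rho a z) = (fun a : R => a ^+ n.+1) *
  (profile \o (fun a : R => a ^+ 2 * sqnorm z))); last first.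
  by apply/funext => t; rewrite rhoE.
apply: (is_derive_eq (is_deriveM d1 d3)).
by rewrite /drho /GRing.scale/= exprS; ring.
Qed.

(** Both sides are multiples of (n+1) h'(t) + 2t h''(t), where h is the
    primitive and t = a^2 |x-y|^2: the right-hand side by [laplacian_radial],
    and the left-hand side because h' is the profile. *)
Lemma drho_laplacian a x y : a != 0 ->
  drho a (x - y) =
  a ^+ n / (2 * a ^+ 2) * laplacian (radial primitive (a ^+ 2) x) y.
Proof.
move=> a0; rewrite laplacian_radial; last exact: smooth_primitive.
rewrite derive1_primitive /drho /radial sqnormC.
by field.
Qed.

(** A mean value property. The a-derivative of w * rho_a at x is the integral of
    w against the Laplacian of a function supported in a ball of radius 1/a,
    which is a test function of D since 1/a < r. *)
Lemma moll_derive0 w (D : set 'rV[R]_n.+1) x r a :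
  mu.-integrable setT (EFin \o w) ->
  (forall f, Cinftyc D f -> \int[mu]_y (w y * laplacian f y) = 0) ->
  ball x r `<=` D -> 0 < r -> r^-1 < a ->
  is_derive a (1 : R) (fun a => convol w (rho a) x) 0.
Proof.
move=> wi w0 xD r0 ra.
have a0 : 0 < a by rewrite (lt_trans _ ra)// invr_gt0.
pose F (t : R) y := w y * rho t (x - y).
have [M M0 hM] := rho_bounded; have [L L0 hL] := drho_bounded.
have mw : measurable_fun setT w.
  by apply/measurable_EFinP; exact: measurable_int wi.
have Ia : `]r^-1, (a + 1)[%classic a by rewrite /= in_itv/= ra ltrDl ltr01.
have I0 t : `]r^-1, (a + 1)[%classic t -> 0 < t.
  by rewrite /= in_itv/= => /andP[+ _]; apply: lt_trans; rewrite invr_gt0.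
have dF t y : is_derive t (1 : R) (F ^~ y) (w y * drho t (x - y)).
  exact: is_deriveZ (is_derive_rho t (x - y)).
have intF t : `]r^-1, (a + 1)[%classic t -> mu.-integrable setT (EFin \o F t).
  move=> /I0 t0; apply: (integrable_convol x wi (Cinfty_cont (Cinftyc_rho t0).1)).
  by move=> y; exact: hM (ltW t0).
pose G y := (a + 1) ^+ n * L * `|w y|.
have iG : mu.-integrable setT (EFin \o G).
  by apply: integrable_scaleR => //; exact: integrable_norm.
have G0 y : 0 <= G y by rewrite !mulr_ge0// exprn_ge0// addr_ge0// ltW.
have derF t y : `]r^-1, (a + 1)[%classic t -> setT y -> derivable (F ^~ y) t 1.
  by move=> _ _; have [] := dF t y.
have d1F t y : partial1of2 F t y = w y * drho t (x - y).
  by rewrite partial1of2E; have [_] := dF t y.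
have Gub t y : `]r^-1, (a + 1)[%classic t -> setT y -> `|partial1of2 F t y| <= G y.
  move=> It _; have t0 := I0 t It; rewrite d1F normrM mulrC ler_wpM2r//.
  apply: le_trans (hL t _ (ltW t0)) _; rewrite ler_wpM2r// lerXn2r ?nnegrE ?ltW//.
    by rewrite addr_gt0.
  by move: It; rewrite /= in_itv/= => /andP[].
have Dv := derivable_under_integral measurableT Ia intF derF G0 iG Gub.
have E := differentiation_under_integral measurableT Ia intF derF G0 iG Gub.
apply: DeriveDef; first exact: Dv.
rewrite -derive1E [LHS]E.
transitivity (\int[mu]_y (a ^+ n / (2 * a ^+ 2) *
    (w y * laplacian (radial primitive (a ^+ 2) x) y))).
  apply: eq_Rintegral => y _; rewrite -[LHS]/(partial1of2 F a y) d1F.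
  by rewrite drho_laplacian ?gt_eqF// mulrCA.
have Cr : Cinftyc D (radial primitive (a ^+ 2) x).
  apply: Cinftyc_radial xD => //; first by rewrite exprn_gt0.
  rewrite -exprVn ltrXn2r// ?nnegrE ?invr_ge0 ?ltW//.
  by rewrite invf_plt.
rewrite RintegralZl// ?w0 ?mulr0//.
have [Cl sl] := Cinftyc_laplacian Cr.
have [B _ hB] := compact_support_bounded (Cinfty_cont Cl) sl.
apply: (integrableM_bdd (M := B)) => //.
exact: measurable_continuous (Cinfty_cont Cl).
Qed.

Lemma moll_const w (D : set 'rV[R]_n.+1) x r a b :
  mu.-integrable setT (EFin \o w) ->
  (forall f, Cinftyc D f -> \int[mu]_y (w y * laplacian f y) = 0) ->
  ball x r `<=` D -> 0 < r -> r^-1 < a -> r^-1 < b ->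
  convol w (rho a) x = convol w (rho b) x.
Proof.
move=> wi w0 xD r0; wlog ab : a b / a < b => [h ra rb|ra _].
  have [ab|ab|->//] := ltgtP a b; first exact: h.
  by apply/esym; exact: h.
have d t : r^-1 < t -> is_derive t (1 : R) (fun a => convol w (rho a) x) 0.
  exact: moll_derive0 wi w0 xD r0.
have [] := @MVT R (fun a => convol w (rho a) x) (cst 0) a b ab.
- move=> t; rewrite in_itv/= => /andP[at_ _]; apply: d; exact: lt_trans ra at_.
- apply: derivable_within_continuous => t; rewrite in_itv/= => /andP[at_ _].
  by have [] := d t (lt_le_trans ra at_).
- by move=> c _ h; apply/esym/eqP; rewrite -subr_eq0 h /= mul0r.
Qed.

End mollifier.

(** * Approximation by mollification *)

Section mollification.
Context {R : realType} {n : nat}.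
Local Notation mu := (@lebesgue_rV R n.+1).
Implicit Types (x y z : 'rV[R]_n.+1) (w : 'rV[R]_n.+1 -> R) (a b : R).

Lemma integrable_rho a : 0 < a -> mu.-integrable setT (EFin \o rho a).
Proof.
by move=> a0; have [C s] := Cinftyc_rho (n := n) a0; exact: integrable_cs (Cinfty_cont C) s.
Qed.

Definition mass : R := \int[mu]_z rho 1 z.

(** No change of variables: the integral of the kernel is also the convolution
    at 0 of the indicator of a ball, which is weakly harmonic inside that
    ball, so that [moll_const] applies. *)
Lemma rho_mass a : 1 <= a -> \int[mu]_z rho a z = mass.
Proof.
have key b : 1 <= b -> \int[mu]_z rho b z =
    convol \1_[set y : 'rV[R]_n.+1 | `|y| <= 2] (rho b) 0.
  move=> b1; apply: eq_Rintegral => y _; rewrite sub0r rhoN indicE.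
  have [y2|y2] := leP `|y| 2; first by rewrite mem_set// mul1r.
  rewrite rho_support ?mulr0//; first exact: lt_le_trans b1.
  rewrite (le_trans _ (ltW y2))// (@le_trans _ _ 1) ?invf_le1 ?ler1n//.
  exact: lt_le_trans b1.
move=> a1; rewrite /mass (key a a1) (key 1 (lexx 1)).
have half b : 1 <= b -> 2^-1 < b.
  by apply: lt_le_trans; rewrite invf_lt1 ?ltr1n.
have wi : mu.-integrable setT
    (EFin \o (\1_[set y : 'rV[R]_n.+1 | `|y| <= 2] : 'rV[R]_n.+1 -> R)).
  have := @integrable_bounded_ball R n.+1 2 1 (ler0n _ _).
  by apply: eq_integrable => // y _ /=; rewrite mul1r.
have w0 f : Cinftyc (ball 0 2) f ->
    \int[mu]_y (\1_[set y : 'rV[R]_n.+1 | `|y| <= 2] y * laplacian f y) = 0.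
  move=> Cf; rewrite -[RHS](Rintegral_laplacian (Cinftyc_sub_dom (@subsetT _ _) Cf)).
  apply: eq_Rintegral => y _; rewrite indicE.
  have [y2|y2] := pselect (ball 0 2 y); last first.
    by rewrite (laplacian_off Cf.2 y2) mulr0.
  rewrite mem_set ?mul1r//=; move: y2.
  by rewrite -ball_normE/= sub0r normrN => /ltW.
by apply: (moll_const wi w0 (@subset_refl _ _) _ (half a a1) (half 1 (lexx 1))).
Qed.

Lemma mass_gt0 : 0 < mass.
Proof.
have m0 : 0 <= mass by apply: Rintegral_ge0 => z _; exact: rho_ge0.
rewrite lt_neqAle m0 andbT eq_sym; apply/eqP => mass0.
have : \forall z \ae mu, setT z -> rho 1 z = 0.
  apply: Rintegral_ge0_eq0 => //; first exact: integrable_rho.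
    by apply: aeW => z _; exact: rho_ge0.
  by rewrite -/mass mass0.
pose c : R := n.+2%:R^-1.
have c0 : 0 < c by rewrite invr_gt0.
move=> [N [mN N0 hN]].
have sub : [set z : 'rV[R]_n.+1 | `|z| <= c] `<=` N.
  move=> z /= zc; apply: hN => /= /(_ I); apply/eqP; rewrite gt_eqF// rho_gt0//.
  rewrite expr1n invr1.
  apply: (@le_lt_trans _ _ (n.+1%:R * c)).
    rewrite ler_wpM2l// expr2 -[leRHS]mulr1 ler_pM// (le_trans zc)//.
    by rewrite invf_le1// ler1n.
  by rewrite ltr_pdivrMr// mul1r ltr_nat.
have : (mu [set z : 'rV[R]_n.+1 | `|z| <= c]%R <= 0)%E.
  rewrite -N0; apply: le_measure => //; rewrite inE//.
  exact: measurable_norm_le (ltW c0).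
rewrite (norm_le_box n.+1 (ltW c0)).
rewrite (@lebesgue_rV_box _ n.+1 (fun=> `[(- c)%R, c]%classic))// => h.
have : (0 < \prod_(i < n.+1) @lebesgue_measure R `[(- c)%R, c])%E.
  elim/big_ind: _ => [|u v u0 v0|i _].
  - by rewrite lte01.
  - exact: mule_gt0.
  - rewrite lebesgue_measure_itv/= lte_fin; have -> : - c < c.
      by rewrite (@lt_trans _ _ 0) ?oppr_lt0.
    by rewrite lte_fin opprK addr_gt0.
by rewrite ltNge h.
Qed.

Lemma Rintegral_rhoB a y : 1 <= a -> \int[mu]_x rho a (y - x) = mass.
Proof.
move=> a1; rewrite -(rho_mass a1).
transitivity (\int[mu]_x rho a (x + - y)).
  by apply: eq_Rintegral => x _; rewrite rhoC.
by apply: (@Rintegral_translation R n.+1 (- y) (rho a)); apply: integrable_rho; exact: lt_le_trans a1.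
Qed.

Lemma integrable_rhoB a y : 0 < a ->
  mu.-integrable setT (EFin \o (fun x => rho a (y - x))).
Proof.
move=> a0; have := integrable_translation (- y) (integrable_rho a0).
apply: eq_integrable => [|x _]; first exact: measurableT.
by rewrite /= -rhoC.
Qed.

Lemma measurable_rhoB a y : 0 < a -> measurable_fun setT (fun x => rho a (y - x)).
Proof.
by move=> a0; apply: measurable_fun_reflect; exact: Cinfty_cont (Cinftyc_rho (n := n) a0).1.
Qed.

Lemma integrable_indic_rho a (B : set 'rV[R]_n.+1) y : 0 < a -> measurable B ->
  mu.-integrable setT (EFin \o (fun x => \1_B x * rho a (y - x))).
Proof.
move=> a0 mB; apply: (le_integrableR (g := fun x => rho a (y - x))) => //.
- by apply: measurable_funM; [exact: measurable_indic|exact: measurable_rhoB].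
- exact: integrable_rhoB.
- move=> x _; have r0 := rho_ge0 (y - x) (ltW a0).
  by rewrite normrM (ger0_norm r0) ler_piMl// indicE normr_nat; case: (_ \in _).
Qed.

Lemma convol_indic_le a (B : set 'rV[R]_n.+1) y : 1 <= a -> measurable B ->
  `|convol \1_B (rho a) y| <= mass.
Proof.
move=> a1 mB; have a0 : 0 < a by exact: lt_le_trans a1.
rewrite ger0_norm; last first.
  by apply: Rintegral_ge0 => x _; rewrite mulr_ge0// rho_ge0// ltW.
rewrite -(Rintegral_rhoB y a1); apply: le_Rintegral => //.
- exact: integrable_indic_rho.
- exact: integrable_rhoB.
- by move=> x _; rewrite ler_piMl ?rho_ge0 ?(ltW a0).
Qed.

Lemma convol_indic_in a (B : set 'rV[R]_n.+1) y r : 1 <= a ->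
  ball y r `<=` B -> 0 < r -> r^-1 < a -> convol \1_B (rho a) y = mass.
Proof.
move=> a1 yB r0 ra; have a0 : 0 < a by exact: lt_le_trans a1.
rewrite -(Rintegral_rhoB y a1); apply: eq_Rintegral => x _; rewrite indicE.
have [xB|xB] := pselect (ball y r x); first by rewrite mem_set ?mul1r//; exact: yB.
rewrite rho_support ?mulr0//; move: xB; rewrite -ball_normE/= => /negP.
by rewrite -leNgt; apply: le_trans; rewrite invf_ple// ltW.
Qed.

Lemma convol_indic_out a (B : set 'rV[R]_n.+1) y r : 1 <= a ->
  ball y r `<=` ~` B -> 0 < r -> r^-1 < a -> convol \1_B (rho a) y = 0.
Proof.
move=> a1 yB r0 ra; have a0 : 0 < a by exact: lt_le_trans a1.
rewrite /convol (_ : (fun _ => _) = cst 0) ?Rintegral_cst ?mul0r//.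
apply/funext => x; rewrite indicE.
have [xB|xB] := pselect (ball y r x).
  by rewrite memNset ?mul0r//; exact: yB.
rewrite rho_support ?mulr0//; move: xB; rewrite -ball_normE/= => /negP.
by rewrite -leNgt; apply: le_trans; rewrite invf_ple// ltW.
Qed.

Lemma convol_indic_cvg (c d : 'I_n.+1 -> R) :
  \forall y \ae mu, convol \1_(obox c d) (rho k.+1%:R) y @[k --> \oo] -->
    mass * \1_(obox c d) y.
Proof.
have ev r : 0 < r -> \forall k \near \oo, r^-1 < k.+1%:R :> R.
  move=> r0; have [k _ hk] := near_infty_natSinv_lt (PosNum r0).
  exists k => // j /hk h; rewrite invf_plt ?posrE//; exact: h.
apply: filterS (obox_boundary_null c d) => y hy.
have [yB|yB] := pselect (obox c d y).
  rewrite indicE mem_set// mulr1.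
  have /nbhs_ballP[r /= r0 rB] := open_nbhs_nbhs (conj (@obox_open R n.+1 c d) yB).
  apply: cvg_near_cst; apply: filterS (ev r r0) => k rk.
  by apply: convol_indic_in rB r0 rk; rewrite ler1n.
rewrite indicE memNset// mulr0.
have [i /negP] : exists i, ~ `]c i, d i[%classic (y ord0 i).
  by apply/existsNP => h; exact: yB.
rewrite in_itv/= negb_and -!leNgt => ycd.
have [r r0 rB] : exists2 r, 0 < r & ball y r `<=` ~` obox c d.
  have [nc nd] := hy i.
  have coord x : `|(y - x) ord0 i| <= `|y - x| by exact: coord_le_norm.
  case/orP : ycd => ycd.
    exists (c i - y ord0 i); first by rewrite subr_gt0 lt_neqAle nc.
    move=> x; rewrite -ball_normE/= => /(le_lt_trans (coord x)); rewrite !mxE.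
    rewrite ltr_norml => /andP[h _] /(_ i); rewrite /= in_itv/= => /andP[h' _].
    by move: h h'; lra.
  exists (y ord0 i - d i); first by rewrite subr_gt0 lt_neqAle eq_sym nd.
  move=> x; rewrite -ball_normE/= => /(le_lt_trans (coord x)); rewrite !mxE.
  rewrite ltr_norml => /andP[_ h] /(_ i); rewrite /= in_itv/= => /andP[_ h'].
  by move: h h'; lra.
apply: cvg_near_cst; apply: filterS (ev r r0) => k rk.
by apply: convol_indic_out rB r0 rk; rewrite ler1n.
Qed.

(** Tonelli, integrating first in p.1, where the kernel contributes its mass. *)
Lemma integrable_convol2 w a (B : set 'rV[R]_n.+1) : 1 <= a -> measurable B ->
  mu.-integrable setT (EFin \o w) ->
  (mu \x mu)%E.-integrable setT
    (EFin \o (fun p : 'rV[R]_n.+1 * 'rV[R]_n.+1 => \1_B p.1 * (w p.2 * rho a (p.1 - p.2)))).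
Proof.
move=> a1 mB wi; have a0 : 0 < a by exact: lt_le_trans a1.
have mw : measurable_fun setT w.
  by apply/measurable_EFinP; exact: measurable_int wi.
have mr : measurable_fun [set: ('rV[R]_n.+1 * 'rV[R]_n.+1)%type] (fun p : 'rV[R]_n.+1 * 'rV[R]_n.+1 => rho a (p.1 - p.2)).
  have mrho := measurable_continuous (Cinfty_cont (Cinftyc_rho (n := n) a0).1).
  apply: (measurableT_comp (f := rho a) mrho).
  apply/measurable_fun_rVP => i.
  rewrite (_ : (fun _ => _) = (fun p : 'rV[R]_n.+1 * 'rV[R]_n.+1 => p.1 ord0 i - p.2 ord0 i)).
    by apply: measurable_funB;
      [exact: (measurableT_comp (@measurable_coord _ _ i) measurable_fst)
      |exact: (measurableT_comp (@measurable_coord _ _ i) measurable_snd)].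
  by apply/funext => p; rewrite !mxE.
have mF : measurable_fun setT
    (fun p : 'rV[R]_n.+1 * 'rV[R]_n.+1 => \1_B p.1 * (w p.2 * rho a (p.1 - p.2))).
  apply: measurable_funM.
    exact: (measurableT_comp (measurable_indic mB) measurable_fst).
  apply: measurable_funM => //.
  exact: (measurableT_comp mw measurable_snd).
apply/integrable21ltyP; first exact/measurable_EFinP.
apply: (@le_lt_trans _ _ (\int[mu]_y (mass * `|w y|)%:E)%E); last first.
  have /integrableP[_] := integrable_scaleR mass measurableT (integrable_norm wi).
  apply: le_lt_trans; apply: ge0_le_integral => //.
  - by move=> y _; rewrite lee_fin mulr_ge0// ltW// mass_gt0.
  - by apply/measurable_EFinP; apply: measurable_funM => //; exact: measurableT_comp.
  - by do 2 apply: measurableT_comp => //; apply: measurable_funM => //; exact: measurableT_comp.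
  - by move=> y _; rewrite /= lee_fin ler_norm.
apply: ge0_le_integral => //.
- by move=> y _; exact: integral_ge0.
- apply: (measurable_fun_fubini_tonelli_G
    (fun p : 'rV[R]_n.+1 * 'rV[R]_n.+1 => `|(\1_B p.1 * (w p.2 * rho a (p.1 - p.2)))%:E|%E)) => //.
  by apply: measurableT_comp => //; exact/measurable_EFinP.
- by apply/measurable_EFinP; apply: measurable_funM => //; exact: measurableT_comp.
move=> y _.
have iy := integrable_scaleR `|w y| measurableT (integrable_rhoB y a0).
have -> : ((mass * `|w y|)%:E = \int[mu]_x (`|w y| * rho a (y - x))%:E)%E.
  rewrite -(EFin_Rintegral measurableT iy); congr (_%:E).
  by rewrite mulrC -(Rintegral_rhoB y a1) -RintegralZl//; exact: integrable_rhoB.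
have mFy : measurable_fun setT (fun x => \1_B x * (w y * rho a (x - y))).
  apply: measurable_funM; first exact: measurable_indic.
  apply: measurable_funM => //.
  rewrite (_ : (fun x => rho a (x - y)) = (fun x => rho a (y - x))).
    exact: measurable_rhoB.
  by apply/funext => x; rewrite rhoC.
apply: ge0_le_integral => //.
- by apply: measurableT_comp => //; exact/measurable_EFinP.
- by apply/measurable_EFinP; apply: measurable_funM => //; exact: measurable_rhoB.
- move=> x _; rewrite /= lee_fin normrM [X in _ * X]normrM (rhoC a x y) (ger0_norm (rho_ge0 _ (ltW a0))).
  apply: ler_piMl; last by rewrite indicE normr_nat; case: (_ \in _).
  by rewrite mulr_ge0// rho_ge0// ltW.
Qed.

Lemma integrable_convolT w a : 1 <= a -> mu.-integrable setT (EFin \o w) ->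
  mu.-integrable setT (EFin \o convol w (rho a)).
Proof.
move=> a1 wi; have := integrable_fubini_F (integrable_convol2 a1 measurableT wi).
apply: eq_integrable => // x _.
have a0 : 0 < a by exact: lt_le_trans a1.
have [M M0 hM] := rho_bounded (R := R) (n := n).
have h := integrable_convol x wi (Cinfty_cont (Cinftyc_rho (n := n) a0).1) (fun z => hM a z (ltW a0)).
rewrite [RHS](EFin_Rintegral measurableT h).
by apply: eq_integral => y _; rewrite /= indicE in_setT mul1r.
Qed.

Lemma Rintegral_convol w a (B : set 'rV[R]_n.+1) : 1 <= a -> measurable B ->
  mu.-integrable setT (EFin \o w) ->
  \int[mu]_(x in B) convol w (rho a) x =
  \int[mu]_y (w y * convol \1_B (rho a) y).
Proof.
move=> a1 mB wi; have a0 : 0 < a by exact: lt_le_trans a1.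
have [M M0 hM] := rho_bounded (R := R) (n := n).
have h x := integrable_convol x wi (Cinfty_cont (Cinftyc_rho (n := n) a0).1) (fun z => hM a z (ltW a0)).
have := Fubini (integrable_convol2 a1 mB wi).
rewrite Rintegral_mkcond => F; congr fine; transitivity
  (\int[mu]_x \int[mu]_y ((\1_B x * (w y * rho a (x - y)))%:E))%E.
  apply: eq_integral => x _.
  rewrite -(EFin_Rintegral measurableT (integrable_scaleR (\1_B x) measurableT (h x))).
  congr (_%:E).
  rewrite [RHS](@RintegralZl _ _ _ _ _ _ (\1_B x) measurableT (h x)).
  by rewrite patchE indicE; case: ifP; rewrite ?mul1r ?mul0r.
rewrite [LHS]F; apply: eq_integral => y _.
have iy := integrable_scaleR (w y) measurableT (integrable_indic_rho y a0 mB).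
transitivity (\int[mu]_x (w y * (\1_B x * rho a (y - x)))%:E)%E.
  by apply: eq_integral => x _; rewrite /= mulrCA (rhoC a x y).
rewrite -(EFin_Rintegral measurableT iy); congr (_%:E).
by rewrite [LHS](@RintegralZl _ _ _ _ _ _ (w y) measurableT (integrable_indic_rho y a0 mB)).
Qed.

(** By Fubini the convolution can be moved to the indicator of the box; there
    it converges off the boundary of the box and stays bounded by the mass,
    so dominated convergence applies to any integrable w. *)
Lemma convol_obox_cvg w (c d : 'I_n.+1 -> R) :
  mu.-integrable setT (EFin \o w) ->
  \int[mu]_(x in obox c d) convol w (rho k.+1%:R) x @[k --> \oo] -->
  mass * \int[mu]_(x in obox c d) w x.
Proof.
move=> wi; have mB := measurable_obox c d.
have mw : measurable_fun setT w.
  by apply/measurable_EFinP; exact: measurable_int wi.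
under eq_fun => k do rewrite Rintegral_convol ?ler1n//.
have -> : mass * \int[mu]_(x in obox c d) w x =
    \int[mu]_y (w y * (mass * \1_(obox c d) y)).
  rewrite Rintegral_mkcond -RintegralZl//.
    apply: eq_Rintegral => y _; rewrite patchE indicE.
    by case: ifP; rewrite ?mulr1 ?mulr0// mulrC.
  by rewrite -restrict_EFin; apply/(integrable_mkcond _ mB); exact: integrableS wi.
apply: (Rintegral_dominated_cvg (g := fun y => mass * `|w y|)) => //.
- move=> k; apply: measurable_funM => //.
  have k0 : 0 < k.+1%:R :> R by [].
  have [M M0 hM] := rho_bounded (R := R) (n := n).
  apply: measurable_continuous.
  apply: (convol_continuous (M := k.+1%:R ^+ n.+1 * M)) => //.
  + exact: integrable_indic_obox.
  + exact: (Cinfty_cont (Cinftyc_rho (n := n) k0).1).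
  + by move=> z; apply: hM.
- by apply: measurable_funM => //; apply: measurable_funM.
- apply: filterS (convol_indic_cvg c d) => y hy _.
  by apply: (@cvgM _ _ _ _ (cst (w y))); [exact: cvg_cst|exact: hy].
- by apply: integrable_scaleR => //; exact: integrable_norm.
- move=> k y _; rewrite normrM mulrC ler_wpM2r//.
  by apply: convol_indic_le => //; rewrite ler1n.
Qed.

End mollification.

(** * Weyl's lemma *)

Section weyl.
Context {R : realType} {n : nat}.
Local Notation mu := (@lebesgue_rV R n.+1).
Local Notation Z := (@mass R n).
Implicit Types (x y z : 'rV[R]_n.+1) (w : 'rV[R]_n.+1 -> R) (a b : R).

(** An open set is the union of the countably many rational boxes it contains. *)
Lemma ae_open_of_obox (U : set 'rV[R]_n.+1) (P : 'rV[R]_n.+1 -> Prop) : open U ->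
  (forall c d, obox c d `<=` U -> \forall x \ae mu, obox c d x -> P x) ->
  \forall x \ae mu, U x -> P x.
Proof.
move=> oU h.
pose Q (c : {ffun 'I_n.+1 -> rat} * nat) := obox
  (fun i => ratr (c.1 i) - c.2.+1%:R^-1 : R) (fun i => ratr (c.1 i) + c.2.+1%:R^-1).
have H : \forall x \ae mu, forall k : nat, forall c, unpickle k = Some c ->
    Q c `<=` U -> Q c x -> P x.
  apply: ae_foralln => k; case E : (unpickle k) => [c|]; last exact: aeW.
  have [cU|cU] := pselect (Q c `<=` U); last by apply: aeW => x c' [<-].
  by apply: filterS (h _ _ cU) => x hx c' [<-].
apply: filterS H => x hx Ux.
have /nbhs_ballP[e /= e0 xeU] := open_nbhs_nbhs (conj oU Ux).
have [k ke] : exists k, (k.+1%:R^-1 < e / 2 :> R)%R.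
  have [k _ /(_ k (leqnn k))] := near_infty_natSinv_lt (PosNum (divr_gt0 e0 (ltr0n R 2))).
  by exists k.
have /choice[q qx] : forall i, exists r : rat,
    x ord0 i - k.+1%:R^-1 < ratr r < x ord0 i + k.+1%:R^-1.
  move=> i.
  have [|r] := @rat_in_itvoo R (x ord0 i - k.+1%:R^-1) (x ord0 i + k.+1%:R^-1).
    by rewrite ltrD2l (@lt_trans _ _ 0%R) ?oppr_lt0 ?invr_gt0.
  by rewrite in_itv/= => ?; exists r.
pose c : {ffun 'I_n.+1 -> rat} * nat := ([ffun i => q i], k).
apply: (hx (pickle c) c); first by rewrite pickleK.
- move=> y yc; apply: xeU; rewrite -ball_normE/=.
  apply: (@le_lt_trans _ _ (2 * k.+1%:R^-1)); last first.
    by rewrite mulrC -ltr_pdivlMr.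
  apply: norm_le_coord => [|i]; first by rewrite mulr_ge0// invr_ge0.
  have /andP[q1 q2] := qx i; have := yc i; rewrite /= ffunE in_itv/= !mxE.
  move=> /andP[y1 y2]; rewrite ler_norml.
  by move: q1 q2 y1 y2; set s := k.+1%:R^-1 => *; apply/andP; split; lra.
- move=> i /=; rewrite ffunE in_itv/=; have /andP[q1 q2] := qx i.
  by move: q1 q2; set s := k.+1%:R^-1 => *; apply/andP; split; lra.
Qed.

(** The scales at which the kernel centred at x only sees D. The bound 1 <= a is
    the one under which [rho_mass] holds. *)
Definition admissible (D : set 'rV[R]_n.+1) x a :=
  1 <= a /\ exists2 r, 0 < r & r^-1 < a /\ ball x r `<=` D.

Lemma admissible_exists D x : open D -> D x -> exists a, admissible D x a.
Proof.
move=> oD Dx; have /nbhs_ballP[r /= r0 rD] := open_nbhs_nbhs (conj oD Dx).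
exists (1 + r^-1); split; first by rewrite lerDl invr_ge0 ltW.
by exists r => //; split=> //; rewrite ltrDr.
Qed.

Lemma admissible_in D x a : admissible D x a -> D x.
Proof. by move=> [_ [r r0 [_ xD]]]; apply: xD; exact: ballxx. Qed.

Lemma admissible_le D x a b : a <= b -> admissible D x a -> admissible D x b.
Proof.
move=> ab [a1 [r r0 [ra xD]]]; split; first exact: le_trans ab.
by exists r => //; split=> //; exact: lt_le_trans ab.
Qed.

Lemma admissible_near D x a : admissible D x a -> \forall y \near x, admissible D y a.
Proof.
move=> [a1 [r r0 [ra xD]]]; have a0 : 0 < a by exact: lt_le_trans a1.
have ar : a^-1 < r by rewrite invf_plt ?posrE.
have ai : 0 < a^-1 by rewrite invr_gt0.
pose r' := (r + a^-1) / 2.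
have r'r : r' < r by rewrite /r'; lra.
have ar' : a^-1 < r' by rewrite /r'; lra.
have r'0 : 0 < r' by exact: lt_trans ar'.
apply/nbhs_ballP; exists (r - r') => /=; first by rewrite subr_gt0.
move=> y xy; split=> //; exists r' => //; split; first by rewrite invf_plt ?posrE.
move=> z yz; apply: xD; have := ball_triangle xy yz.
by rewrite subrK.
Qed.

Lemma moll_indep w D x a b : mu.-integrable setT (EFin \o w) ->
  (forall f, Cinftyc D f -> \int[mu]_y (w y * laplacian f y) = 0) ->
  admissible D x a -> admissible D x b ->
  convol w (rho a) x = convol w (rho b) x.
Proof.
move=> wi w0 [a1 [r r0 [ra xrD]]] [b1 [s s0 [sb xsD]]].
have [rs|sr] := leP r s.
  apply: (moll_const wi w0 xsD s0) => //; apply: le_lt_trans ra.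
  by rewrite lef_pV2 ?posrE.
apply: (moll_const wi w0 xrD r0) => //; apply: le_lt_trans sb.
by rewrite lef_pV2 ?posrE// ltW.
Qed.

(** On a box of points admissible at scale k+1 the mollifications of all finer
    scales coincide, so the limit in [convol_obox_cvg] is already attained
    and w has there the same integrals as its normalized mollification. *)
Lemma weyl_ae w D k : mu.-integrable setT (EFin \o w) ->
  (forall f, Cinftyc D f -> \int[mu]_y (w y * laplacian f y) = 0) ->
  \forall x \ae mu, admissible D x k.+1%:R ->
    w x = Z^-1 * convol w (rho k.+1%:R) x.
Proof.
move=> wi w0; have Z0 := @mass_gt0 R n.
have k1 : 1 <= k.+1%:R :> R by rewrite ler1n.
apply: (@ae_open_of_obox [set x | admissible D x k.+1%:R]).
  by rewrite openE => x hx; exact: admissible_near.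
move=> c d cdD; have mB := measurable_obox c d.
have ci := integrable_convolT k1 wi.
apply: (@ae_eq_of_obox _ _ _ w _ c d erefl).
- exact: integrableS wi.
- by apply: (integrable_scaleR Z^-1) => //; exact: integrableS ci.
move=> c' d' sub; have mB' := measurable_obox c' d'.
rewrite RintegralZl//; last exact: integrableS ci.
apply: (mulfI (lt0r_neq0 Z0)); rewrite mulrA mulfV ?lt0r_neq0// mul1r.
have lim1 := convol_obox_cvg (c := c') (d := d') wi.
have ev j : (k <= j)%N -> \int[mu]_(x in obox c' d') convol w (rho j.+1%:R) x =
    \int[mu]_(x in obox c' d') convol w (rho k.+1%:R) x.
  move=> kj; apply: eq_Rintegral => x; rewrite inE => /sub/cdD hx.
  apply: (moll_indep wi w0 _ hx).
  by apply: admissible_le hx; rewrite ler_nat.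
have lim2 : \int[mu]_(x in obox c' d') convol w (rho j.+1%:R) x @[j --> \oo] -->
    \int[mu]_(x in obox c' d') convol w (rho k.+1%:R) x.
  apply: cvg_near_cst; exists k; first by [].
  exact: ev.
exact: (cvg_unique _ lim1 lim2).
Qed.

(** Locally v is one normalized mollification of w, hence smooth. If w >= 0
    and v vanishes at x, then w vanishes almost everywhere on the set where
    the kernel centred at x is positive, which is a neighbourhood of x; so v
    vanishes near x. This last part is a strong maximum principle. *)
Lemma weyl w D : open D -> mu.-integrable setT (EFin \o w) ->
  (forall f, Cinftyc D f -> \int[mu]_y (w y * laplacian f y) = 0) ->
  exists v : 'rV[R]_n.+1 -> R,
  [/\ Cinfty D v, \forall x \ae mu, D x -> w x = v x &
    (\forall x \ae mu, 0 <= w x) -> forall x, D x ->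
      0 <= v x /\ (v x = 0 -> \forall y \near x, v y = 0)].
Proof.
move=> oD wi w0; have Z0 := @mass_gt0 R n.
have /choice[A hA] : forall x, exists a, D x -> admissible D x a.
  move=> x; have [Dx|nDx] := pselect (D x); last by exists 0.
  by have [a ha] := admissible_exists oD Dx; exists a.
pose v x := Z^-1 * convol w (rho (A x)) x.
have vE x a : admissible D x a -> v x = Z^-1 * convol w (rho a) x.
  by move=> ha; rewrite /v (moll_indep wi w0 (hA x (admissible_in ha)) ha).
have adm0 x a : admissible D x a -> 0 < a.
  by move=> [a1 _]; exact: lt_le_trans a1.
have [M M0 hM] := rho_bounded (R := R) (n := n).
have ir x a : 0 < a -> mu.-integrable setT (EFin \o (fun y => w y * rho a (x - y))).
  move=> a0; apply: (integrable_convol x wi (Cinfty_cont (Cinftyc_rho (n := n) a0).1)).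
  by move=> z; exact: hM (ltW a0).
exists v; split.
- move=> k; apply: Ck_local => x Dx; have ha := hA x Dx.
  exists [set y | admissible D y (A x)], (fun y => Z^-1 * convol w (rho (A x)) y).
  split.
  + by rewrite openE => y hy; exact: admissible_near.
  + exact: ha.
  + apply: (@CkS _ _ _ _ setT) => //; apply: CkM; first exact: openT.
      exact: Ck_cst.
    by apply: convol_Cinfty => //; exact: Cinftyc_rho (adm0 _ _ ha).
  + by move=> y; rewrite inE => hy; exact: vE.
- have : \forall x \ae mu, forall k, admissible D x k.+1%:R ->
      w x = Z^-1 * convol w (rho k.+1%:R) x.
    by apply: ae_foralln => k; exact: weyl_ae.
  apply: filterS => x hx Dx; have ha := hA x Dx.
  have hk : admissible D x (Num.bound (A x)).+1%:R.
    apply: admissible_le ha; have := archi_boundP (ltW (adm0 _ _ (hA x Dx))).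
    by move=> /ltW /le_trans; apply; rewrite ler_nat.
  by rewrite (hx _ hk) (vE _ _ hk).
move=> wge0 x Dx; have ha := hA x Dx; have a0 := adm0 _ _ ha.
have wr0 y b : 0 < b -> \forall z \ae mu, setT z -> 0 <= w z * rho b (y - z).
  by move=> b0; apply: filterS wge0 => z wz _; rewrite mulr_ge0// rho_ge0// ltW.
split.
  rewrite /v mulr_ge0 ?invr_ge0 ?(ltW Z0)//.
  have <- : \int[mu]_y (cst 0 y) = 0 :> R by rewrite Rintegral_cst// mul0r.
  apply: le_Rintegral_ae => //; [|exact: ir|exact: wr0].
  by apply: (eq_integrable measurableT (cst 0%E)) => //; exact: integrable0.
rewrite /v => /eqP; rewrite mulf_eq0 invr_eq0 gt_eqF//= => /eqP conv0.
have wrx : \forall z \ae mu, setT z -> w z * rho (A x) (x - z) = 0.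
  apply: Rintegral_ge0_eq0 => //; [exact: ir|exact: wr0|].
  by rewrite -/(convol w (rho (A x)) x) conv0.
(* The kernel at x is positive on the sup-norm ball of radius c, by [rho_gt0]. *)
pose c := (A x)^-1 * n.+2%:R^-1.
have c0 : 0 < c by rewrite mulr_gt0 ?invr_gt0.
have wc : \forall z \ae mu, `|x - z| < c -> w z = 0.
  apply: filterS wrx => z /(_ I) /eqP; rewrite mulf_eq0 => /orP[/eqP//|/eqP r0 xz].
  exfalso; move: r0; apply/eqP; rewrite gt_eqF// rho_gt0//.
  apply: (@lt_le_trans _ _ (n.+1%:R * c ^+ 2)).
    by rewrite ltr_pM2l// ltrXn2r// ?nnegrE// ltW.
  rewrite /c exprMn -exprVn mulrCA ler_piMr ?exprn_ge0 ?invr_ge0 ?(ltW a0)//.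
  rewrite exprVn ler_pdivrMr ?exprn_gt0// mul1r expr2.
  by rewrite -natrM ler_nat mulSn -[X in (X <= _)%N]addn0 leq_add.
(* At this scale, and for y at distance less than c/2 from x, the kernel at y
is supported in that ball. *)
pose b := A x + (c / 2)^-1.
have c20 : 0 < c / 2 by rewrite divr_gt0.
have b0 : 0 < b by rewrite addr_gt0// invr_gt0.
have hb : \forall y \near x, admissible D y b.
  by apply: admissible_near; apply: admissible_le ha; rewrite lerDl invr_ge0 ltW.
have nx : \forall y \near x, ball x (c / 2) y by exact: nbhsx_ballx.
apply: filterS2 hb nx => y hy; rewrite -ball_normE/= => xy.
rewrite -/(v y) (vE _ _ hy); apply/eqP; rewrite mulf_eq0; apply/orP; right; apply/eqP.
rewrite /convol -[RHS](_ : \int[mu]_y (cst 0 y) = 0 :> R); last first.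
  by rewrite Rintegral_cst// mul0r.
apply: ae_eq_Rintegral => //.
  by apply/measurable_EFinP; exact: measurable_int (ir y b b0).
apply: filterS wc => z wz _ /=.
have [yz|yz] := leP b^-1 `|y - z|; first by rewrite rho_support ?mulr0.
rewrite wz ?mul0r//.
have -> : x - z = (x - y) + (y - z) by rewrite addrA subrK.
apply: le_lt_trans (ler_normD _ _) _; rewrite [ltRHS](splitr c) ltrD//.
apply: lt_le_trans yz _; rewrite invf_ple ?posrE//.
by rewrite lerDr ltW.
Qed.

End weyl.

(** * Slices in one more dimension *)

Lemma contraction_continuous (R : realType) (V W : normedModType R) (f : V -> W) :
  (forall x y, `|f x - f y| <= `|x - y|) -> continuous f.
Proof.
move=> h x; apply/cvgrPdist_lt => e e0; near=> y.
by apply: le_lt_trans (h _ _) _; near: y; exact: cvgr_dist_lt.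
Unshelve. all: by end_near. Qed.

Section extra_dimension.
Context {R : realType} {n : nat}.
Implicit Types (x y : 'rV[R]_n) (z : 'rV[R]_n.+1) (f : 'rV[R]_n.+1 -> R).

Lemma cons_rV_shift0 (s t : R) x :
  cons_rV (s, x) + t *: delta_mx ord0 ord0 = cons_rV (s + t, x).
Proof.
apply/rowP => i; rewrite /cons_rV !mxE eqxx/=.
by case: (unliftP ord0 i) => [j|] ->; rewrite ?liftK ?unlift_none/= ?mulr0 ?mulr1 ?addr0.
Qed.

Lemma cons_rV_shiftS (s t : R) x j :
  cons_rV (s, x) + t *: delta_mx ord0 (lift ord0 j) =
  cons_rV (s, x + t *: delta_mx ord0 j).
Proof.
apply/rowP => i; rewrite /cons_rV !mxE eqxx/=.
case: (unliftP ord0 i) => [k|] ->; rewrite ?liftK ?unlift_none/= ?mxE ?eqxx/=.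
  by rewrite (inj_eq lift_inj).
by rewrite mulr0 addr0.
Qed.

Lemma norm_cons_rVB (s : R) x y : `|cons_rV (s, x) - cons_rV (s, y)| <= `|x - y|.
Proof.
apply: norm_le_coord => // i; rewrite /cons_rV !mxE.
case: (unliftP ord0 i) => [j|] _ /=.
  by have := coord_le_norm (x - y) j; rewrite !mxE.
by rewrite subrr normr0.
Qed.

Lemma continuous_cons_rV (s : R) : continuous (fun x : 'rV[R]_n => cons_rV (s, x)).
Proof. by apply: contraction_continuous => x y; exact: norm_cons_rVB. Qed.

Lemma norm_behead_rVB (z1 z2 : 'rV[R]_n.+1) :
  `|(behead_rV z1).2 - (behead_rV z2).2| <= `|z1 - z2|.
Proof.
apply: norm_le_coord => // i; rewrite /= !mxE.
by have := coord_le_norm (z1 - z2) (lift ord0 i); rewrite !mxE.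
Qed.

Lemma continuous_behead_rV : continuous (fun z : 'rV[R]_n.+1 => (behead_rV z).2).
Proof. by apply: contraction_continuous => x y; exact: norm_behead_rVB. Qed.

Definition slice f (s : R) : 'rV[R]_n -> R := fun x => f (cons_rV (s, x)).

Lemma slice_growth f s x j : (fun h : R => h^-1 *:
    (slice f s (h *: delta_mx ord0 j + x) - slice f s x)) =
  (fun h : R => h^-1 *: (f (h *: delta_mx ord0 (lift ord0 j) + cons_rV (s, x)) -
      f (cons_rV (s, x)))).
Proof.
apply/funext => h; rewrite /slice [h *: _ + x]addrC -cons_rV_shiftS.
by rewrite [cons_rV _ + _]addrC.
Qed.

Lemma partial_slice f s j :
  partial j (slice f s) = slice (partial (lift ord0 j) f) s.
Proof. by apply/funext => x; rewrite /partial /derive slice_growth. Qed.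

Lemma Ck_slice k (D : set 'rV[R]_n.+1) f s : Ck k D f ->
  Ck k [set x | D (cons_rV (s, x))] (slice f s).
Proof.
have cont k' f' x : Ck k' D f' -> D (cons_rV (s, x)) ->
    {for x, continuous (slice f' s)}.
  move=> Cf Dx; apply: (@continuous_comp _ _ _ (fun x : 'rV[R]_n => cons_rV (s, x)) f').
    exact: continuous_cons_rV.
  exact: Ck_cont Cf Dx.
elim: k f => [|k IH] f Cf; split.
- by move=> x; exact: cont Cf.
- by [].
- by move=> x; exact: cont Cf.
- move=> j; split=> [x Dx|].
    rewrite /derivable slice_growth; exact: (Ck_derivable (i := lift ord0 j) Cf Dx).
  by rewrite partial_slice; apply: IH; exact: Ck_partial Cf.
Qed.

Lemma Cinftyc_slice (D : set 'rV[R]_n.+1) (U : set 'rV[R]_n) f s :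
  (forall x, D (cons_rV (s, x)) -> U x) -> Cinftyc D f ->
  Cinftyc U (slice f s).
Proof.
move=> DU [Cf sf]; split.
  by move=> k; exact: (Ck_slice s (Cf k)).
have [K [cK clK KD f0]] := compact_supportE sf.
apply: (@compact_supportI _ _ [set x | K (cons_rV (s, x))]).
- apply: bounded_closed_compact.
    have [M [Mr hM]] := compact_bounded cK; exists M; split=> // M' MM' x /= Kx.
    apply: le_trans (hM M' MM' _ Kx); apply: norm_le_coord => // j.
    have := coord_le_norm (cons_rV (s, x)) (lift ord0 j).
    by rewrite cons_rVS.
  apply: (@closed_comp _ _ (fun x : 'rV[R]_n => cons_rV (s, x)) K) => // x _.
  exact: continuous_cons_rV.
- by move=> x /KD /DU.
- by move=> x nK; exact: f0.
Qed.

Lemma is_derive_cons0 f s x : Cinfty setT f ->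
  is_derive s (1 : R) (fun t => f (cons_rV (t, x))) (partial ord0 f (cons_rV (s, x))).
Proof.
move=> Cf; have : is_derive (cons_rV (0, x) + s *: delta_mx ord0 ord0)
    (delta_mx ord0 ord0) f (partial ord0 f (cons_rV (s, x))).
  rewrite cons_rV_shift0 add0r; apply: DeriveDef => //; exact: Cinfty_derivable.
move=> /is_derive_line; congr is_derive; apply/funext => t.
by rewrite cons_rV_shift0 add0r.
Qed.

Lemma laplacian_cons f s x : laplacian f (cons_rV (s, x)) =
  partial ord0 (partial ord0 f) (cons_rV (s, x)) + laplacian (slice f s) x.
Proof.
have -> : laplacian (slice f s) x =
    \sum_(j < n) partial (lift ord0 j) (partial (lift ord0 j) f) (cons_rV (s, x)).
  by apply: eq_bigr => j _; rewrite !partial_slice.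
exact: big_ord_recl.
Qed.

End extra_dimension.

Section one_dimensional.
Context {R : realType}.
Local Notation leb := (@lebesgue_measure R).

Lemma continuous_expRM (k : R) : continuous (fun s : R => expR (k * s)).
Proof.
move=> s; apply: (@continuous_comp _ _ _ (fun s => k * s) expR).
  exact: mulrl_continuous.
exact: continuous_expR.
Qed.

(** The exponential is cut off to be integrable. The functions it is tested
    against vanish for |s| >= 1, so they do not see the cut. *)
Definition expcut (k s : R) : R := \1_(`[-1, 1]%classic) s * expR (k * s).

Lemma measurable_expcut k : measurable_fun setT (expcut k).
Proof.
apply: measurable_funM; first exact: measurable_indic.
exact: continuous_measurable_fun (@continuous_expRM k).
Qed.

Lemma expcut_restrict k (h : R -> R) :
  (fun s => expcut k s * h s) = (fun s => expR (k * s) * h s) \_ `[-1, 1]%classic.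
Proof.
apply/funext => s; rewrite patchE /expcut indicE.
by case: ifP; rewrite ?mul1r ?mul0r.
Qed.

Lemma integrable_expcut k (h : R -> R) : continuous h ->
  leb.-integrable setT (EFin \o (fun s => expcut k s * h s)).
Proof.
move=> ch; rewrite expcut_restrict -restrict_EFin.
have mI : measurable (`[-1, 1]%classic : set (measurableTypeR R)).
  exact: measurable_itv.
apply: (@integrable_mkcond _ _ _ leb _ (EFin \o (fun s => expR (k * s) * h s)) mI).1.
apply: continuous_compact_integrable; first exact: segment_compact.
apply: continuous_subspaceT.
by move=> s; exact: (continuousM (@continuous_expRM k s) (ch s)).
Qed.

(** Two integrations by parts at once: e^(ks) (h' - k h) has derivative
    e^(ks) (h'' - k^2 h) and vanishes at -1 and 1. *)
Lemma expcut_second_derivative k (h h1 h2 : R -> R) :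
  (forall s : R, is_derive s (1 : R) h (h1 s)) ->
  (forall s : R, is_derive s (1 : R) h1 (h2 s)) -> continuous h2 ->
  (forall s, 1 <= `|s| -> h s = 0 /\ h1 s = 0) ->
  \int[leb]_s (expcut k s * h2 s) = k ^+ 2 * \int[leb]_s (expcut k s * h s).
Proof.
move=> dh dh1 ch2 h0.
have cont (f f' : R -> R) : (forall s : R, is_derive s (1 : R) f (f' s)) -> continuous f.
  move=> df s; apply: differentiable_continuous; apply/derivable1_diffP.
  by have [] := df s.
have ch := cont _ _ dh; have ch1 := cont _ _ dh1.
pose G s := expR (k * s) * (h1 s - k * h s).
pose G' s := expR (k * s) * (h2 s - k ^+ 2 * h s).
have dG s : is_derive s (1 : R) G (G' s).
  have de : is_derive s (1 : R) (fun s => expR (k * s)) (k * expR (k * s)).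
    have d1 : is_derive s (1 : R) (fun s => k * s) k.
      by have := is_deriveZ k (is_derive_id s (1 : R)); rewrite /GRing.scale/= mulr1.
    have := @is_derive1_comp _ expR (fun s => k * s) s _ _ (is_derive_expR _) d1.
    by rewrite mulrC.
  have dk := is_deriveB (dh1 s) (is_deriveZ k (dh s)).
  apply: (is_derive_eq (is_deriveM de dk)).
  rewrite (_ : (h1 - k \*: h) s = h1 s - k * h s)//.
  by rewrite /G' /GRing.scale/=; ring.
have cG := cont _ _ dG.
have cE := @continuous_expRM k.
have cG' : continuous G'.
  move=> s; apply: (continuousM (cE s)).
  apply: (continuousB (ch2 s)).
  exact: (continuousM (@cst_continuous _ _ (k ^+ 2) s) (ch s)).
have N1 : (-1 : R) < 1 by rewrite ltrN10 || by lra.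
have := @continuous_FTC2 R G' G (-1) 1 N1 (continuous_subspaceT cG').
have -> : G 1 = 0.
  by rewrite /G; have [] := h0 1; rewrite ?normr1// => -> ->; rewrite mulr0 subr0 mulr0.
have -> : G (-1) = 0.
  by rewrite /G; have [] := h0 (-1); rewrite ?normrN1// => -> ->; rewrite mulr0 subr0 mulr0.
move=> FTC.
have {}FTC : (\int[leb]_(s in `[(-1)%R, 1%R]) (G' s)%:E = 0)%E.
  rewrite FTC ?sube0//.
    split; [by move=> s _; have [] := dG s| |].
    - by apply: cvg_at_right_filter; exact: cG.
    - by apply: cvg_at_left_filter; exact: cG.
  by move=> s _; rewrite derive1E; have [_] := dG s.
have i2 := integrable_expcut k ch2; have ih := integrable_expcut k ch.
apply/eqP; rewrite -subr_eq0 -RintegralZl//.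
rewrite -RintegralB//; last exact: integrable_scaleR.
rewrite (_ : (fun _ => _) = (fun s => expcut k s * (h2 s - k ^+ 2 * h s))); last first.
  by apply/funext => s; rewrite mulrBr mulrCA.
rewrite expcut_restrict -Rintegral_mkcond; apply/eqP.
by rewrite /Rintegral FTC.
Qed.

End one_dimensional.

(** * Integrals over the product of the line with R^n *)

Section tensor.
Context {R : realType} {n : nat}.
Local Notation mu := (@lebesgue_rV R n).
Local Notation leb := (@lebesgue_measure R).
Local Notation nu := (@lebesgue_rV R n.+1).
Local Notation XY := (measurableTypeR R * 'rV[R]_n)%type.

Let mc : measurable_fun [set: XY] (@cons_rV R n).
Proof. exact: measurable_cons_rV. Qed.

Lemma integrable_rVS (F : 'rV[R]_n.+1 -> R) : measurable_fun setT F ->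
  (leb \x mu)%E.-integrable [set: XY] (EFin \o (F \o @cons_rV R n)) ->
  nu.-integrable setT (EFin \o F).
Proof.
move=> mF Fi; apply/integrableP; split; first exact/measurable_EFinP.
have mF' : measurable_fun [set: XY] (EFin \o (F \o @cons_rV R n)).
  by apply/measurable_EFinP; exact: measurableT_comp.
rewrite (@ge0_integral_rVS R n (fun z => `|(F z)%:E|%E)) => [||z]; last 2 first.
- by apply: measurableT_comp => //; exact/measurable_EFinP.
- exact: abse_ge0.
exact: (integrable12ltyP leb mu mF').1 Fi.
Qed.

Lemma Rintegral_rVS (F : 'rV[R]_n.+1 -> R) : measurable_fun setT F ->
  (leb \x mu)%E.-integrable [set: XY] (EFin \o (F \o @cons_rV R n)) ->
  \int[nu]_z F z = fine (\int[leb \x mu]_p (F (cons_rV p))%:E)%E.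
Proof.
move=> mF Fi; congr fine.
have mEF : measurable_fun setT (EFin \o F) by exact/measurable_EFinP.
have Fi' : (leb \x mu)%E.-integrable (@cons_rV R n @^-1` setT) ((EFin \o F) \o @cons_rV R n).
  by rewrite preimage_setT.
have := @integral_pushforward _ _ _ _ R _ mc (leb \x mu)%E setT (EFin \o F)
  mEF Fi' measurableT.
rewrite preimage_setT => <-.
by apply: eq_measure_integral => A mA _; exact: lebesgue_rVS.
Qed.

Variables (g : R -> R) (u : 'rV[R]_n -> R).
Hypothesis gi : leb.-integrable [set: measurableTypeR R] (EFin \o g).
Hypothesis ui : mu.-integrable setT (EFin \o u).

Let mg : measurable_fun [set: measurableTypeR R] g.
Proof. by apply/measurable_EFinP; exact: measurable_int gi. Qed.

Let mu_ : measurable_fun setT u.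
Proof. by apply/measurable_EFinP; exact: measurable_int ui. Qed.

(** The integrand of a product g(s) u(x) tested against H. *)
Definition tensor (H : 'rV[R]_n.+1 -> R) (p : XY) : R :=
  g p.1 * (u p.2 * H (cons_rV p)).

Section bounded_factor.
Variables (H : 'rV[R]_n.+1 -> R) (M : R).
Hypothesis mH : measurable_fun setT H.
Hypothesis HM : forall z, `|H z| <= M.

Let mtensor : measurable_fun [set: XY] (tensor H).
Proof.
apply: measurable_funM.
  exact: (measurableT_comp mg measurable_fst).
apply: measurable_funM.
  exact: (measurableT_comp mu_ measurable_snd).
exact: (measurableT_comp mH mc).
Qed.

Let mslice s : measurable_fun setT (fun x : 'rV[R]_n => H (cons_rV (s, x))).
Proof.
apply: (measurableT_comp mH (g := fun x : 'rV[R]_n => cons_rV (s, x))).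
exact: (measurableT_comp mc (measurable_pair1 s)).
Qed.

Let mslice2 x : measurable_fun [set: measurableTypeR R] (fun s => H (cons_rV (s, x))).
Proof.
apply: (measurableT_comp mH (g := fun s : measurableTypeR R => cons_rV (s, x))).
exact: (measurableT_comp mc (measurable_pair2 x)).
Qed.

Let islice s : mu.-integrable setT (EFin \o (fun x => u x * H (cons_rV (s, x)))).
Proof. exact: (integrableM_bdd (M := M)). Qed.

Let islice2 x : leb.-integrable [set: measurableTypeR R]
  (EFin \o (fun s => g s * H (cons_rV (s, x)))).
Proof. exact: (integrableM_bdd (M := M)). Qed.

Lemma integrable_tensor : (leb \x mu)%E.-integrable [set: XY] (EFin \o tensor H).
Proof.
apply/integrable12ltyP; first exact/measurable_EFinP.
pose C := \int[mu]_x `|u x|.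
have iCg := integrable_scaleR (M * C) measurableT (integrable_norm gi).
have /integrableP[_] := iCg; apply: le_lt_trans.
have mF : measurable_fun [set: measurableTypeR R]
    (fun s => \int[mu]_x `|(tensor H (s, x))%:E|)%E.
  apply: (measurable_fun_fubini_tonelli_F (fun p : XY => `|(tensor H p)%:E|%E)) => //.
  by apply: measurableT_comp => //; exact/measurable_EFinP.
apply: ge0_le_integral => //.
- by move=> s _; exact: integral_ge0.
- by apply: measurableT_comp => //; exact: measurable_int iCg.
move=> s _.
have iu := integrable_norm ui.
have b := integrable_scaleR (`|g s| * M) measurableT iu.
have mt : measurable_fun setT (fun x => tensor H (s, x)).
  rewrite /tensor /=; apply: measurable_funM; first exact: measurable_cst.
  by apply: measurable_funM; [exact: mu_|exact: mslice].
apply: (@le_trans _ _ (\int[mu]_x (`|g s| * M * `|u x|)%:E)%E).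
  apply: ge0_le_integral => //.
  - by apply: measurableT_comp => //; exact/measurable_EFinP.
  - exact: measurable_int b.
  - move=> x _; rewrite /tensor /= lee_fin !normrM -mulrA ler_wpM2l//.
    by rewrite mulrC ler_wpM2r.
rewrite -(EFin_Rintegral measurableT b) /= lee_fin RintegralZl//.
apply: le_trans (ler_norm _); rewrite -/C le_eqVlt; apply/orP; left; apply/eqP.
by ring.
Qed.

Lemma tensor_int12 : fine (\int[leb \x mu]_p (tensor H p)%:E)%E =
  \int[leb]_s (g s * \int[mu]_x (u x * H (cons_rV (s, x)))).
Proof.
congr fine; rewrite -(integral12_prod_meas1 integrable_tensor).
apply: eq_integral => s _.
rewrite -[RHS]/((g s * \int[mu]_x (u x * H (cons_rV (s, x))))%:E).
rewrite -RintegralZl//; apply/esym.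
exact: (EFin_Rintegral measurableT (integrable_scaleR (g s) measurableT (islice s))).
Qed.

Lemma tensor_int21 : fine (\int[leb \x mu]_p (tensor H p)%:E)%E =
  \int[mu]_x (u x * \int[leb]_s (g s * H (cons_rV (s, x)))).
Proof.
congr fine; rewrite -(integral21_prod_meas1 integrable_tensor).
apply: eq_integral => x _.
have i := integrable_scaleR (u x) measurableT (islice2 x).
transitivity (\int[leb]_s (u x * (g s * H (cons_rV (s, x))))%:E)%E.
  by apply: eq_integral => s _; rewrite /tensor /= mulrCA.
rewrite -(EFin_Rintegral measurableT i); congr (_%:E).
by rewrite RintegralZl.
Qed.

End bounded_factor.
End tensor.

(** * Regularity of eigenfunctions *)

Lemma behead_cons_rV {R : realType} {n : nat} (s : R) (x : 'rV[R]_n) : (behead_rV (cons_rV (s, x))).2 = x.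
Proof. by rewrite cons_rVK. Qed.

Section slices_of_null_sets.
Context {R : realType} {n : nat}.
Local Notation mu := (@lebesgue_rV R n).
Local Notation leb := (@lebesgue_measure R).
Local Notation nu := (@lebesgue_rV R n.+1).
Local Notation XY := (measurableTypeR R * 'rV[R]_n)%type.

(** By Tonelli, the measure of the slices of a null set has integral 0. *)
Lemma ae_slice (P : 'rV[R]_n.+1 -> Prop) : (\forall z \ae nu, P z) ->
  \forall s \ae leb, \forall x \ae mu, P (cons_rV (s, x)).
Proof.
move=> [N [mN N0 PN]].
have mc : measurable_fun [set: XY] (@cons_rV R n) by exact: measurable_cons_rV.
have m1 : measurable_fun setT (fun z => (\1_N z)%:E : \bar R).
  by apply/measurable_EFinP; exact: measurable_indic.
pose F (s : measurableTypeR R) := (\int[mu]_x (\1_N (cons_rV (s, x)))%:E)%E.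
have mF : measurable_fun [set: measurableTypeR R] F.
  apply: (measurable_fun_fubini_tonelli_F (fun p : XY => (\1_N (cons_rV p))%:E)).
    exact: (measurableT_comp m1 mc).
  by move=> p; rewrite lee_fin.
have F0 s : (0 <= F s)%E by apply: integral_ge0 => x _; rewrite lee_fin.
have : (\int[leb]_s `|F s| = 0)%E.
  under eq_integral do rewrite gee0_abs//.
  rewrite -(@ge0_integral_rVS R n (fun z => (\1_N z)%:E)) => [|//|z]; last by rewrite lee_fin.
  by rewrite integral_indic// setIT.
move=> /(ae_eq_integral_abs leb measurableT mF).1.
apply: filterS => s /= /(_ I) Fs0.
have mNs : measurable [set x : 'rV[R]_n | N (cons_rV (s, x))].
  have := measurableT_comp mc (measurable_pair1 s) measurableT mN.
  by rewrite setTI.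
exists [set x : 'rV[R]_n | N (cons_rV (s, x))]; split=> //; last by move=> x /= /PN.
transitivity (\int[mu]_x (\1_[set x : 'rV[R]_n | N (cons_rV (s, x))] x)%:E)%E.
  by rewrite integral_indic// setIT.
rewrite -[RHS]Fs0.
by apply: eq_integral => x _; rewrite !indicE.
Qed.

Lemma ae_behead (P : 'rV[R]_n -> Prop) : (\forall x \ae mu, P x) ->
  \forall z \ae nu, P (behead_rV z).2.
Proof.
move=> [N [mN N0 PN]].
have mb : measurable_fun setT (fun z : 'rV[R]_n.+1 => (behead_rV z).2).
  exact: (measurableT_comp measurable_snd (@measurable_behead_rV R n)).
have mN' : measurable [set z : 'rV[R]_n.+1 | N (behead_rV z).2].
  by have := mb measurableT N mN; rewrite setTI.
exists [set z : 'rV[R]_n.+1 | N (behead_rV z).2]; split=> //; last by move=> z /= /PN.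
transitivity (\int[nu]_z (\1_[set z : 'rV[R]_n.+1 | N (behead_rV z).2] z)%:E)%E.
  by rewrite integral_indic// setIT.
rewrite (@ge0_integral_rVS R n (fun z => (\1_[set z : 'rV[R]_n.+1 | N (behead_rV z).2] z)%:E)).
- transitivity (\int[leb]_s 0)%E; last by rewrite integral0.
  apply: eq_integral => s _; transitivity (\int[mu]_x (\1_N x)%:E)%E; last by rewrite integral_indic// setIT.
  by apply: eq_integral => x _; rewrite !indicE -{2}(behead_cons_rV s x).
- by apply/measurable_EFinP; exact: measurable_indic.
- by move=> z; rewrite lee_fin.
Qed.

End slices_of_null_sets.

Section eigenfunction_regularity.
Context {R : realType} {n : nat}.
Local Notation mu := (@lebesgue_rV R n).
Local Notation leb := (@lebesgue_measure R).
Local Notation nu := (@lebesgue_rV R n.+1).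
Local Notation XY := (measurableTypeR R * 'rV[R]_n)%type.

Definition slab (Omega : set 'rV[R]_n) : set 'rV[R]_n.+1 :=
  [set z : 'rV[R]_n.+1 | `|z ord0 ord0| < 1 /\ Omega (behead_rV z).2].

Lemma slab_cons Omega (s : R) x : slab Omega (cons_rV (s, x)) <-> `|s| < 1 /\ Omega x.
Proof. by rewrite -[X in _ /\ Omega X](behead_cons_rV s) -[X in `|X| < 1](cons_rV0 (s, x)). Qed.

Lemma slab_open Omega : open Omega -> open (slab Omega).
Proof.
move=> oO; apply: openI.
  apply: (@open_comp _ _ (fun z : 'rV[R]_n.+1 => z ord0 ord0) [set t : R | `|t| < 1]).
    by move=> z _; exact: coord_continuous.
  rewrite (_ : [set t : R | _] = ball 0 1); first exact: ball_open.
  by apply/seteqP; split=> t /=; rewrite -ball_normE/= sub0r normrN.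
apply: (@open_comp _ _ (fun z : 'rV[R]_n.+1 => (behead_rV z).2) Omega) => // z _.
exact: continuous_behead_rV.
Qed.

Variables (Omega : set 'rV[R]_n) (u : 'rV[R]_n -> R) (k : R).
Hypothesis oO : open Omega.
Hypothesis ui : mu.-integrable Omega (EFin \o u).
Hypothesis u_weak : forall f, Cinftyc Omega f ->
  \int[mu]_(x in Omega) (u x * laplacian f x) =
  - k ^+ 2 * \int[mu]_(x in Omega) (u x * f x).

Let mO : measurable Omega. Proof. exact: open_measurable_rV. Qed.

Definition zero_ext := u \_ Omega.

Lemma integrable_zero_ext : mu.-integrable setT (EFin \o zero_ext).
Proof. by rewrite -restrict_EFin; apply/(integrable_mkcond _ mO). Qed.

Lemma Rintegral_zero_ext (f : 'rV[R]_n -> R) :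
  \int[mu]_x (zero_ext x * f x) = \int[mu]_(x in Omega) (u x * f x).
Proof.
rewrite [RHS]Rintegral_mkcond; apply: eq_Rintegral => x _.
by rewrite /zero_ext !patchE; case: ifP; rewrite ?mul0r.
Qed.

(** If - Laplacian u = k^2 u, then e^(ks) u(x) is harmonic in (s, x). The extra
    variable reduces eigenfunctions to harmonic functions. *)
Definition lift_fun (z : 'rV[R]_n.+1) : R :=
  expcut k (z ord0 ord0) * zero_ext (behead_rV z).2.

Let gi : leb.-integrable [set: measurableTypeR R] (EFin \o expcut k).
Proof.
have := @integrable_expcut R k (cst 1) (@cst_continuous _ _ _).
by apply: eq_integrable => // s _ /=; rewrite mulr1.
Qed.

Lemma measurable_lift_fun : measurable_fun setT lift_fun.
Proof.
apply: measurable_funM.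
  exact: (measurableT_comp (measurable_expcut k) (measurable_coord ord0)).
have mu0 : measurable_fun setT zero_ext.
  by apply/measurable_EFinP; exact: measurable_int integrable_zero_ext.
apply: (measurableT_comp (f := zero_ext) mu0 (g := fun z : 'rV[R]_n.+1 => (behead_rV z).2)).
exact: (measurableT_comp measurable_snd (@measurable_behead_rV R n)).
Qed.

Lemma lift_fun_tensor (H : 'rV[R]_n.+1 -> R) :
  (fun z => lift_fun z * H z) \o @cons_rV R n = tensor (expcut k) zero_ext H.
Proof.
apply/funext => -[s x].
transitivity (expcut k (cons_rV (s, x) ord0 ord0) *
  zero_ext (behead_rV (cons_rV (s, x))).2 * H (cons_rV (s, x))); first by [].
by rewrite cons_rV0 behead_cons_rV -mulrA.
Qed.

Lemma integrable_lift_fun : nu.-integrable setT (EFin \o lift_fun).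
Proof.
apply: integrable_rVS; first exact: measurable_lift_fun.
have -> : lift_fun \o @cons_rV R n = tensor (expcut k) zero_ext (cst 1).
  rewrite -lift_fun_tensor; congr (_ \o _); apply/funext => z.
  by rewrite mulr1.
apply: (integrable_tensor gi integrable_zero_ext (M := 1)) => //.
by move=> z; rewrite normr1.
Qed.

Lemma lift_fun_int H : Cinftyc setT H ->
  \int[nu]_z (lift_fun z * H z) =
  fine (\int[leb \x mu]_p (tensor (expcut k) zero_ext H p)%:E)%E.
Proof.
move=> [CH sH]; have cH := Cinfty_cont CH; have mH := measurable_continuous cH.
have [M M0 hM] := compact_support_bounded cH sH.
have it := integrable_tensor gi integrable_zero_ext mH hM.
rewrite Rintegral_rVS.
- by rewrite -[fun p => _]/(EFin \o ((fun z => lift_fun z * H z) \o @cons_rV R n)) lift_fun_tensor.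
- by apply: measurable_funM => //; exact: measurable_lift_fun.
- by rewrite lift_fun_tensor.
Qed.

(** The Laplacian in R^(n+1) is the sum of the second derivative in s, handled
    for fixed x by [expcut_second_derivative], and of the Laplacian of the
    slices, handled for fixed s by the equation of u; the two contributions
    k^2 and - k^2 cancel. *)
Lemma lift_fun_weak f : Cinftyc (slab Omega) f ->
  \int[nu]_z (lift_fun z * laplacian f z) = 0.
Proof.
move=> Cf.
have CfT : Cinftyc setT f := Cinftyc_sub_dom (@subsetT _ _) Cf.
have [Cf0 sf0] := CfT; have cf := Cinfty_cont Cf0.
have [M M0 hM] := compact_support_bounded cf sf0.
pose A := partial ord0 (partial ord0 f).
have CA : Cinftyc setT A by apply: Cinftyc_partial; exact: Cinftyc_partial.
have cA := Cinfty_cont CA.1; have [MA _ hA] := compact_support_bounded cA CA.2.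
have CL := Cinftyc_laplacian CfT.
pose B z := laplacian f z - A z.
have CB : Cinftyc setT B by exact: Cinftyc_sub.
have cB := Cinfty_cont CB.1; have [MB _ hB] := compact_support_bounded cB CB.2.
have icv (H : 'rV[R]_n.+1 -> R) : Cinftyc setT H ->
    nu.-integrable setT (EFin \o (fun z => lift_fun z * H z)).
  move=> [CH sH]; have [M' _ hM'] := compact_support_bounded (Cinfty_cont CH) sH.
  apply: (integrableM_bdd (M := M')) => //; first exact: integrable_lift_fun.
  exact: measurable_continuous (Cinfty_cont CH).
transitivity (\int[nu]_z (lift_fun z * A z) + \int[nu]_z (lift_fun z * B z)).
  rewrite -RintegralD//; [|exact: icv..].
  by apply: eq_Rintegral => z _; rewrite /B -mulrDr addrC subrK.
have scale (a : R) : a * \int[nu]_z (lift_fun z * f z) =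
    fine (\int[leb \x mu]_p (tensor (expcut k) zero_ext (fun z => a * f z) p)%:E)%E.
  rewrite -(lift_fun_int (Cinftyc_scale a CfT)) -RintegralZl//; last exact: icv.
  by apply: eq_Rintegral => z _; rewrite mulrCA.
have mscale a : measurable_fun setT (fun z => a * f z).
  by apply: measurable_funM => //; exact: measurable_continuous.
have hscale a z : `|a * f z| <= `|a| * M by rewrite normrM ler_wpM2l.
have -> : \int[nu]_z (lift_fun z * A z) = k ^+ 2 * \int[nu]_z (lift_fun z * f z).
  rewrite (lift_fun_int CA) scale.
  rewrite (tensor_int21 gi integrable_zero_ext (measurable_continuous cA) hA).
  rewrite (tensor_int21 gi integrable_zero_ext (mscale _) (hscale _)).
  apply: eq_Rintegral => x _; congr (_ * _).
  have cfs : continuous (fun s : R => f (cons_rV (s, x))).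
    move=> s; apply: differentiable_continuous; apply/derivable1_diffP.
    by have [] := is_derive_cons0 s x Cf0.
  have cAs : continuous (fun s : R => A (cons_rV (s, x))).
    move=> s; apply: differentiable_continuous; apply/derivable1_diffP.
    by have [] := is_derive_cons0 s x CA.1.
  have d1 (s : R) : is_derive s (1 : R) (fun s => f (cons_rV (s, x)))
      (partial ord0 f (cons_rV (s, x))) by exact: is_derive_cons0.
  have d2 (s : R) : is_derive s (1 : R) (fun s => partial ord0 f (cons_rV (s, x)))
      (A (cons_rV (s, x))) by apply: is_derive_cons0; exact: Cinfty_partial.
  have v (s : R) : 1 <= `|s| -> f (cons_rV (s, x)) = 0 /\
      partial ord0 f (cons_rV (s, x)) = 0.
    move=> s1; have off : ~ slab Omega (cons_rV (s, x)).
      by move=> /slab_cons[]; rewrite ltNge s1.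
    have [_ /compact_supportE[K [_ _ KD ->]]] := Cf; last by move=> /KD.
    by have [_ /compact_supportE[L [_ _ LD ->]]] := Cinftyc_partial ord0 Cf; last by move=> /LD.
  rewrite (expcut_second_derivative k d1 d2 cAs v).
  rewrite -RintegralZl//; last exact: integrable_expcut.
  by apply: eq_Rintegral => s _; rewrite mulrCA.
have -> : \int[nu]_z (lift_fun z * B z) = - k ^+ 2 * \int[nu]_z (lift_fun z * f z).
  rewrite (lift_fun_int CB) scale.
  rewrite (tensor_int12 gi integrable_zero_ext (measurable_continuous cB) hB).
  rewrite (tensor_int12 gi integrable_zero_ext (mscale _) (hscale _)).
  apply: eq_Rintegral => s _; congr (_ * _).
  have Cs : Cinftyc Omega (slice f s).
    by apply: Cinftyc_slice Cf => x /slab_cons[].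
  transitivity (\int[mu]_x (zero_ext x * laplacian (slice f s) x)).
    by apply: eq_Rintegral => x _; rewrite /B laplacian_cons addrAC subrr add0r.
  rewrite Rintegral_zero_ext u_weak// -(Rintegral_zero_ext (slice f s)).
  rewrite -RintegralZl//; first by apply: eq_Rintegral => x _; rewrite mulrCA.
  have [M' _ hM'] := compact_support_bounded (Cinfty_cont Cs.1) Cs.2.
  apply: (integrableM_bdd (M := M')) => //; first exact: integrable_zero_ext.
  exact: measurable_continuous (Cinfty_cont Cs.1).
by rewrite mulNr subrr.
Qed.

(** Weyl's lemma makes the lifted function equal almost everywhere to a smooth W;
    by Fubini this holds on the slice at some s in (-1, 1), and then
    v(x) = e^(-ks) W(s, x). *)
Lemma eigenfunction_regular : exists v : 'rV[R]_n -> R,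
  [/\ Cinfty Omega v, \forall x \ae mu, Omega x -> u x = v x &
    (\forall x \ae mu, Omega x -> 0 <= u x) -> forall x, Omega x ->
      0 <= v x /\ (v x = 0 -> \forall y \near x, v y = 0)].
Proof.
have [W [CW uW posW]] := weyl (slab_open oO) integrable_lift_fun lift_fun_weak.
have [s [s1 us]] : exists s : R, `|s| < 1 /\
    \forall x \ae mu, slab Omega (cons_rV (s, x)) -> lift_fun (cons_rV (s, x)) = W (cons_rV (s, x)).
  apply: contrapT => /forallNP h.
  have [N [mN N0 hN]] := ae_slice uW.
  have : (leb `](-1)%R, 1%R[ <= leb N)%E.
    apply: le_measure; rewrite ?inE// => s; rewrite /= in_itv/= -ltr_norml => s1.
    by apply: hN => /= hs; apply: (h s); split.
  rewrite N0 lebesgue_measure_itv/= lte_fin ifT ?ltrN10 ?(lt_trans (ltrN10 _) ltr01)//.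
  by rewrite -EFinB lee_fin opprK leNgt addr_gt0.
have e0 : 0 < expR (k * s) by exact: expR_gt0.
pose v x := (expR (k * s))^-1 * W (cons_rV (s, x)).
have inD x : Omega x -> slab Omega (cons_rV (s, x)) by move=> Ox; apply/slab_cons.
exists v; split.
- move=> j; apply: CkM => //; first exact: Ck_cst.
  apply: (@CkS _ _ _ _ [set x | slab Omega (cons_rV (s, x))]); first exact: inD.
  exact: (Ck_slice s (CW j)).
- apply: filterS us => x hx Ox; have := hx (inD x Ox).
  rewrite /v => <-; rewrite /lift_fun cons_rV0 behead_cons_rV /zero_ext patchE mem_set//.
  rewrite /expcut indicE mem_set ?mul1r ?mulrA ?mulVf ?mul1r ?gt_eqF//=.
  by rewrite in_itv/= -ler_norml ltW.
move=> u0 x Ox.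
have lift0 : \forall z \ae nu, 0 <= lift_fun z.
  apply: filterS (ae_behead u0) => z hz; rewrite /lift_fun mulr_ge0//.
    by rewrite /expcut mulr_ge0// expR_ge0.
  by rewrite /zero_ext patchE; case: ifPn => //; rewrite inE => /hz.
have [W0 Wn] := posW lift0 _ (inD x Ox); split.
  by rewrite /v mulr_ge0// invr_ge0 ltW.
rewrite /v => /eqP; rewrite mulf_eq0 invr_eq0 gt_eqF//= => /eqP /Wn.
move=> W0n; have : \forall y \near x, W (cons_rV (s, y)) = 0.
  exact: (@continuous_cons_rV R n s x [set z | W z = 0] W0n).
apply: (@filterS _ (nbhs x) (nbhs_filter x)) => y W0y.
by rewrite [W _]W0y mulr0.
Qed.

End eigenfunction_regularity.

(** * The energy of a stable solution *)

Section truncation.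
Context d (T : measurableType d) (R : realType) (mu : {measure set T -> \bar R}).

(** Monotone convergence as the truncation level j of the weight grows. *)
Lemma truncation_integrable (D : set T) (m e : T -> R) (b : R) : measurable D ->
  measurable_fun D m -> mu.-integrable D (EFin \o e) ->
  (forall x, D x -> 0 <= m x) -> (forall x, D x -> 0 <= e x) ->
  (forall j : nat, \int[mu]_(x in D) (e x * Num.min (m x) j%:R) <= b) ->
  mu.-integrable D (EFin \o (fun x => e x * m x)) /\
  \int[mu]_(x in D) (e x * m x) <= b.
Proof.
move=> mD mm ei m0 e0 hb.
have me : measurable_fun D e by apply/measurable_EFinP; exact: measurable_int ei.
have mt (j : nat) : measurable_fun D (fun x => Num.min (m x) j%:R).
  exact: measurable_minr.
have t0 (j : nat) x : D x -> 0 <= Num.min (m x) j%:R.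
  by move=> Dx; rewrite le_min m0//= ler0n.
have ti (j : nat) : mu.-integrable D (EFin \o (fun x => e x * Num.min (m x) j%:R)).
  apply: (integrableM_bdd (M := j%:R)) => // x Dx.
  by rewrite ger0_norm ?t0// ge_min lexx orbT.
have mem : measurable_fun D (fun x => e x * m x) by exact: measurable_funM.
have : (\int[mu]_(x in D) (e x * m x)%:E <= b%:E)%E.
  pose F (j : nat) x := (e x * Num.min (m x) j%:R)%:E.
  have Fc x : D x -> F j x @[j --> \oo] --> (e x * m x)%:E.
    move=> Dx; have [N mN] : exists N : nat, m x < N%:R.
      exists (Num.bound (m x)); apply: le_lt_trans (archi_boundP (m0 x Dx)).
      exact: lexx.
    apply: cvg_near_cst; exists N => // j /= Nj; rewrite /F min_l//.
    by rewrite (le_trans (ltW mN))// ler_nat.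
  have cv := @cvg_monotone_convergence _ _ _ mu D mD F
    (fun j => (measurable_EFinP _ _).2 (measurable_funM me (mt j))).
  have Fl : (\int[mu]_(x in D) F j x @[j --> \oo] --> \int[mu]_(x in D) limn (F ^~ x))%E.
    apply: cv => [j x Dx|x Dx i j ij]; rewrite lee_fin.
      by rewrite mulr_ge0 ?e0 ?t0.
    by rewrite ler_wpM2l ?e0// le_min !ge_min lexx/= ler_nat ij orbT.
  have -> : (\int[mu]_(x in D) (e x * m x)%:E = \int[mu]_(x in D) limn (F ^~ x))%E.
    apply: eq_integral => x; rewrite inE => Dx; apply/esym/cvg_lim => //.
    exact: Fc.
  rewrite -(cvg_lim _ Fl)//; apply: lime_le; first exact: (cvgP _ Fl).
  apply: nearW => j.
  by rewrite -(EFin_Rintegral mD (ti j)) lee_fin.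
move=> le; have emi : mu.-integrable D (EFin \o (fun x => e x * m x)).
  apply/integrableP; split; first exact/measurable_EFinP.
  rewrite (le_lt_trans _ (ltry b))//; apply: le_trans le.
  rewrite le_eqVlt; apply/orP; left; apply/eqP; apply: eq_integral => x.
  by rewrite inE => Dx; rewrite /= ger0_norm// mulr_ge0 ?e0 ?m0.
by split=> //; rewrite -lee_fin (EFin_Rintegral mD emi).
Qed.

End truncation.

Section square_integrable.
Context {R : realType} {n : nat}.
Local Notation mu := (@lebesgue_rV R n).
Implicit Types (D Omega : set 'rV[R]_n) (f g w phi : 'rV[R]_n -> R).

Lemma measurable_compact (K : set 'rV[R]_n) : compact K -> measurable K.
Proof.
move=> cK; rewrite -(setCK K); apply: measurableC; apply: open_measurable_rV.
by apply: closed_openC; apply: compact_closed => //; exact: norm_hausdorff.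
Qed.

Lemma integrable_cst_bounded (A : set 'rV[R]_n) (a : R) : measurable A ->
  bounded_set A -> mu.-integrable A (EFin \o (fun=> a)).
Proof.
move=> mA /= [M [_ hM]]; pose B := `|M| + 1.
have B0 : 0 <= B by rewrite addr_ge0.
have AB x : A x -> `|x| <= B.
  by move=> Ax; apply: (hM B _ x Ax); rewrite (le_lt_trans (ler_norm M))// ltrDl ltr01.
have := @integrableS _ _ _ mu _ _ _ measurableT mA (@subsetT _ _)
    (@integrable_bounded_ball R n B a B0).
apply: eq_integrable => // x; rewrite inE => /AB /= xB; congr (_%:E).
by rewrite indicE mem_set// mulr1.
Qed.

Lemma L2_mul D f g : measurable D -> L2 D f -> L2 D g ->
  mu.-integrable D (EFin \o (fun x => f x * g x)).
Proof.
move=> mD [mf fi] [mg gi].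
apply: (@le_integrableR _ _ _ _ D _ (fun x => f x ^+ 2 + g x ^+ 2) mD).
- exact: measurable_funM.
- exact: (integrable_addR mD fi gi).
- move=> x _; rewrite normrM -(real_normK (num_real (f x))) -(real_normK (num_real (g x))).
  have := sqr_ge0 (`|f x| - `|g x|); have := normr_ge0 (f x); have := normr_ge0 (g x).
  nra.
Qed.

Lemma L2_sub D f g : measurable D -> L2 D f -> L2 D g ->
  L2 D (fun x => f x - g x).
Proof.
move=> mD Lf Lg; have [mf fi] := Lf; have [mg gi] := Lg.
split; first exact: measurable_funB.
have fgi := L2_mul mD Lf Lg.
have := integrable_addR mD (integrable_addR mD fi gi) (integrable_scaleR (-2) mD fgi).
apply: eq_integrable => // x _ /=; congr (_%:E).
by rewrite sqrrB; ring.
Qed.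

Lemma L2_test Omega phi : open Omega -> continuous phi ->
  compact_support Omega phi -> L2 Omega phi.
Proof.
move=> oO cphi sphi; have mO := open_measurable_rV oO.
have mphi : measurable_fun Omega phi.
  by apply: (measurable_funS measurableT) => //; exact: measurable_continuous.
split=> //; have [M _ hM] := compact_support_bounded cphi sphi.
have i1 := @integrableS _ _ _ mu _ _ _ measurableT mO (@subsetT _ _) (integrable_cs cphi sphi).
exact: (integrableM_bdd mO i1 mphi (fun x _ => hM x)).
Qed.

Lemma L1loc_test Omega w phi : open Omega -> L1loc Omega w -> continuous phi ->
  compact_support Omega phi ->
  mu.-integrable Omega (EFin \o (fun x => w x * phi x)).
Proof.
move=> oO [mw wi] cphi sphi; have mO := open_measurable_rV oO.
have [M _ hM] := compact_support_bounded cphi sphi.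
have mphi : measurable_fun Omega phi.
  by apply: (measurable_funS measurableT) => //; exact: measurable_continuous.
have [K [cK clK KO phi0]] := compact_supportE sphi.
have mK := measurable_compact cK.
have wK : mu.-integrable Omega (EFin \o (w \_ K)).
  apply: (@integrableS _ _ _ mu _ _ _ measurableT mO (@subsetT _ _)).
  by rewrite -restrict_EFin; apply/(integrable_mkcond _ mK); exact: wi.
have := integrableM_bdd mO wK mphi (fun x _ => hM x).
apply: eq_integrable => // x _ /=; congr (_%:E); rewrite patchE.
by case: ifPn => //; rewrite notin_setE => /phi0 ->; rewrite !mulr0.
Qed.

Lemma L1loc_test_sqr Omega w phi : open Omega -> L1loc Omega w ->
  continuous phi -> compact_support Omega phi ->
  mu.-integrable Omega (EFin \o (fun x => w x * phi x ^+ 2)).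
Proof.
move=> oO Lw cphi sphi; apply: L1loc_test => //.
  by move=> x; exact: (continuousM (cphi x) (cphi x)).
have [K [cK clK KD phi0]] := compact_supportE sphi.
by apply: (compact_supportI cK KD) => x /phi0 ->; rewrite expr0n.
Qed.

Lemma L2_integrable Omega u : measurable Omega -> bounded_set Omega ->
  L2 Omega u -> mu.-integrable Omega (EFin \o u).
Proof.
move=> mO bO [mu' ui].
apply: (@le_integrableR _ _ _ _ Omega _ (fun x => 1 + u x ^+ 2) mO mu').
  exact: (integrable_addR mO (integrable_cst_bounded 1 mO bO) ui).
move=> x _; rewrite -(real_normK (num_real (u x))).
by have := sqr_ge0 (`|u x| - 1); have := normr_ge0 (u x); nra.
Qed.

End square_integrable.

(** The right-hand side minus the left-hand side is
    (1/t) (ta - b/2)^2 + (3/4)(1/t) b^2. *)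
Lemma young {R : realFieldType} (t a b : R) : 0 < t ->
  a * b <= t * a ^+ 2 + t^-1 * b ^+ 2.
Proof.
move=> t0; have ti0 : 0 < t^-1 by rewrite invr_gt0.
have e : t * t^-1 = 1 by rewrite mulfV ?gt_eqF.
have : 0 <= t^-1 * (2 * t * a - b) ^+ 2 by rewrite mulr_ge0 ?sqr_ge0// ltW.
have -> : t^-1 * (2 * t * a - b) ^+ 2 =
  (t * t^-1) * (4 * t * a ^+ 2 - 4 * a * b) + t^-1 * b ^+ 2 by ring.
rewrite e mul1r; have := mulr_ge0 (ltW t0) (sqr_ge0 a).
have := mulr_ge0 (ltW ti0) (sqr_ge0 b); rewrite -!mulrA.
move: (t * a ^+ 2) (t^-1 * b ^+ 2) (a * b) => x y z; lra.
Qed.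

(** This bounds m u^2 - h u at u by its value at u + d, up to errors that are
    small relative to m u^2 or controlled by m d^2. *)
Lemma weighted_young {R : realFieldType} (m h u d t : R) : 0 < t -> 0 <= m ->
  `|h| <= m * `|u| ->
  m * u ^+ 2 - h * u <= m * (u + d) ^+ 2 - h * (u + d) +
    (3 * t * (m * u ^+ 2) + 3 * t^-1 * (d ^+ 2 * m)).
Proof.
move=> t0 m0 hm.
have hd : h * d <= m * (t * u ^+ 2 + t^-1 * d ^+ 2).
  rewrite (le_trans (ler_norm _))// normrM.
  rewrite (le_trans (ler_wpM2r (normr_ge0 d) hm))// -mulrA ler_wpM2l//.
  by rewrite -(real_normK (num_real u)) -(real_normK (num_real d)) young.
have ud : m * - (u * d) <= m * (t * u ^+ 2 + t^-1 * d ^+ 2).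
  by rewrite ler_wpM2l// -mulNr -(sqrrN u) young.
have md := mulr_ge0 m0 (sqr_ge0 d); rewrite -subr_ge0.
have -> : m * (u + d) ^+ 2 - h * (u + d) +
    (3 * t * (m * u ^+ 2) + 3 * t^-1 * (d ^+ 2 * m)) - (m * u ^+ 2 - h * u) =
  m * d ^+ 2 + (m * (t * u ^+ 2 + t^-1 * d ^+ 2) - h * d) +
    2 * (m * (t * u ^+ 2 + t^-1 * d ^+ 2) - m * - (u * d)) by ring.
apply: addr_ge0; first by apply: addr_ge0 => //; rewrite subr_ge0.
by apply: mulr_ge0 => //; rewrite subr_ge0.
Qed.

Section energy_estimate.
Context {R : realType} {n : nat}.
Local Notation mu := (@lebesgue_rV R n).
Variables (Omega : set 'rV[R]_n) (u : 'rV[R]_n -> R) (g : 'I_n -> 'rV[R]_n -> R).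
Variable phi : ('rV[R]_n -> R)^nat.
Hypothesis oO : open Omega.
Hypothesis Lu : L2 Omega u.
Hypothesis Lg : forall i, L2 Omega (g i).
Hypothesis Cphi : forall k, Cinftyc Omega (phi k).
Hypothesis phi_cvg :
  (\int[mu]_(x in Omega) ((phi k x - u x) ^+ 2 +
       \sum_(i < n) (partial i (phi k) x - g i x) ^+ 2)%:E)%E
      @[k --> \oo] --> 0%E.

Let mO : measurable Omega. Proof. exact: open_measurable_rV. Qed.

(** The density of the squared H^1-distance between u and its k-th
    approximation by a test function. *)
Definition gap (k : nat) x := (phi k x - u x) ^+ 2 +
  \sum_(i < n) (partial i (phi k) x - g i x) ^+ 2.

Let Lphi k : L2 Omega (phi k).
Proof. by have [C s] := Cphi k; exact: L2_test (Cinfty_cont C) s. Qed.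

Let Lpphi k i : L2 Omega (partial i (phi k)).
Proof.
by have [C s] := Cinftyc_partial i (Cphi k); exact: L2_test (Cinfty_cont C) s.
Qed.

Lemma integrable_gap k : mu.-integrable Omega (EFin \o gap k).
Proof.
apply: (integrable_addR mO (L2_sub mO (Lphi k) Lu).2).
by apply: (integrable_sumR mO) => i; exact: (L2_sub mO (Lpphi k i) (Lg i)).2.
Qed.

Lemma gap_cvg0 : \int[mu]_(x in Omega) gap k x @[k --> \oo] --> (0 : R).
Proof. exact: (@fine_cvg _ _ _ _ _ (0 : R) phi_cvg). Qed.

Lemma gap_ge0 k x : 0 <= gap k x.
Proof. by rewrite addr_ge0 ?sqr_ge0// sumr_ge0// => i _; exact: sqr_ge0. Qed.

Lemma sqr_le_gap k x : (phi k x - u x) ^+ 2 <= gap k x.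
Proof. by rewrite lerDl sumr_ge0// => i _; exact: sqr_ge0. Qed.

Lemma gap_small (b e : R) : 0 <= b -> 0 < e ->
  exists k, b * \int[mu]_(x in Omega) gap k x <= e.
Proof.
move=> b0 e0; have b1 : 0 < b + 1 by rewrite ltr_wpDl.
have [k _ /(_ k (leqnn k))] : \forall k \near \oo,
    `|0 - \int[mu]_(x in Omega) gap k x| < e / (b + 1).
  by move/cvgrPdist_lt: gap_cvg0; apply; rewrite divr_gt0.
rewrite sub0r normrN ltr_pdivlMr// => h; exists k.
have I0 : 0 <= \int[mu]_(x in Omega) gap k x.
  by apply: Rintegral_ge0 => x _; exact: gap_ge0.
by move: h; rewrite ger0_norm//; nra.
Qed.

Variables (c : R) (m h : 'rV[R]_n -> R).
Hypothesis m_L1loc : L1loc Omega m.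
Hypothesis h_L1loc : L1loc Omega h.
Hypothesis m_ge0 : forall x, 0 <= m x.
Hypothesis h_le : \forall x \ae mu, Omega x -> `|h x| <= m x * `|u x|.
Hypothesis stability : forall f, Cinftyc Omega f ->
  \int[mu]_(x in Omega) (m x * f x ^+ 2) + c * \int[mu]_(x in Omega) (f x ^+ 2) <=
  \int[mu]_(x in Omega) grad_norm2 f x.
Hypothesis weak_eq : forall f, Cinftyc Omega f ->
  \int[mu]_(x in Omega) (h x * f x) + c * \int[mu]_(x in Omega) (u x * f x) =
  \int[mu]_(x in Omega) (\sum_(i < n) g i x * partial i f x).

Let mm : measurable_fun Omega m. Proof. by case: m_L1loc. Qed.

Let mh : measurable_fun Omega h. Proof. by case: h_L1loc. Qed.

Let test_sqr f : Cinftyc Omega f -> mu.-integrable Omega (EFin \o (fun x => m x * f x ^+ 2)).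
Proof.
by move=> [C s]; exact: (L1loc_test_sqr oO m_L1loc (Cinfty_cont C) s).
Qed.

Let grad_int f : Cinftyc Omega f -> mu.-integrable Omega (EFin \o grad_norm2 f).
Proof.
move=> Cf; apply: (integrable_sumR mO) => i.
by have [C s] := Cinftyc_partial i Cf; have [] := L2_test oO (Cinfty_cont C) s.
Qed.

(** Stability, tested with phi_k - phi_l. *)
Lemma weighted_cauchy k l :
  \int[mu]_(x in Omega) (m x * (phi k x - phi l x) ^+ 2) <=
  2 * (1 + `|c|) * (\int[mu]_(x in Omega) gap k x + \int[mu]_(x in Omega) gap l x).
Proof.
have Cf : Cinftyc Omega (fun x => phi k x - phi l x) := Cinftyc_sub (Cphi k) (Cphi l).
set f := fun x => _ in Cf.
have [_ sqf] : L2 Omega f by exact: L2_test (Cinfty_cont Cf.1) Cf.2.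
rewrite -[X in X <= _](addrK (c * \int[mu]_(x in Omega) (f x ^+ 2))) lerBlDr.
apply: le_trans (stability Cf) _.
rewrite -RintegralD//; [|exact: integrable_gap..].
have igg := integrable_addR mO (integrable_gap k) (integrable_gap l).
rewrite -(@RintegralZl _ _ _ _ _ _ _ mO igg) -(@RintegralZl _ _ _ _ _ _ _ mO sqf).
rewrite -RintegralD//; [|exact: (integrable_scaleR _ mO igg)|exact: (integrable_scaleR _ mO sqf)].
apply: le_Rintegral => //; first exact: grad_int.
  exact: (integrable_addR mO (integrable_scaleR _ mO igg) (integrable_scaleR _ mO sqf)).
move=> x Ox.
have -> : grad_norm2 f x = \sum_(i < n) (partial i (phi k) x - partial i (phi l) x) ^+ 2.
  by apply: eq_bigr => i _; rewrite partial_sub; [|exact: (Cphi k).1|exact: (Cphi l).1].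
have S : \sum_(i < n) (partial i (phi k) x - partial i (phi l) x) ^+ 2 <=
  2 * (\sum_(i < n) (partial i (phi k) x - g i x) ^+ 2 +
       \sum_(i < n) (partial i (phi l) x - g i x) ^+ 2).
  rewrite -big_split/= mulr_sumr; apply: ler_sum => i _.
  by have := sqr_ge0 ((partial i (phi k) x - g i x) + (partial i (phi l) x - g i x)); nra.
rewrite /gap; move: S; rewrite /f.
have : 0 <= \sum_(i < n) (partial i (phi k) x - g i x) ^+ 2 by apply: sumr_ge0 => i _; exact: sqr_ge0.
have : 0 <= \sum_(i < n) (partial i (phi l) x - g i x) ^+ 2 by apply: sumr_ge0 => i _; exact: sqr_ge0.
set S0 := \sum_(i < n) _; set S1 := \sum_(i < n) _; set S2 := \sum_(i < n) _.
move=> S00 S10 S2le.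
pose a := phi k x - u x; pose b := phi l x - u x.
have -> : phi k x - phi l x = a - b by rewrite /a /b; ring.
rewrite -/a -/b; have c0 := normr_ge0 c.
have cN : - c <= `|c| by rewrite lerNl; have := ler_norm (- c); rewrite normrN; lra.
have cc : - `|c| * (a - b) ^+ 2 <= c * (a - b) ^+ 2.
  by rewrite ler_wpM2r ?sqr_ge0//; lra.
have ab := mulr_ge0 c0 (sqr_ge0 (a + b)).
have := mulr_ge0 c0 S00; have := mulr_ge0 c0 S10.
have := sqr_ge0 a; have := sqr_ge0 b.
nra.
Qed.

(** In [weighted_cauchy] one wants to let l tend to infinity, but the weight m is
    only locally integrable while phi_l tends to u in L^2. So the weight is
    first truncated at j; the limit in l gives a bound which does not depend
    on j, and [truncation_integrable] removes the truncation. *)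
Lemma weighted_gap k :
  mu.-integrable Omega (EFin \o (fun x => (phi k x - u x) ^+ 2 * m x)) /\
  \int[mu]_(x in Omega) ((phi k x - u x) ^+ 2 * m x) <=
    4 * (1 + `|c|) * \int[mu]_(x in Omega) gap k x.
Proof.
have d2 l := (L2_sub mO (Lphi l) Lu).2.
apply: truncation_integrable => //; [exact: d2|by move=> x _; exact: sqr_ge0|].
move=> j; apply/ler_addgt0Pr => e e0.
have b0 : 0 <= 4 * (1 + `|c|) + 2 * j%:R by rewrite addr_ge0// mulr_ge0// addr_ge0.
have [l hl] := gap_small b0 e0.
have tj x : 0 <= Num.min (m x) j%:R <= j%:R.
  by rewrite le_min m_ge0 ler0n ge_min lexx orbT.
have mt : measurable_fun Omega (fun x => Num.min (m x) j%:R) by exact: measurable_minr.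
have it l' : mu.-integrable Omega (EFin \o (fun x => (phi l' x - u x) ^+ 2 * Num.min (m x) j%:R)).
  apply: (integrableM_bdd (M := j%:R) mO (d2 l') mt) => x _.
  by have /andP[? ?] := tj x; rewrite ger0_norm.
have ikl := test_sqr (Cinftyc_sub (Cphi k) (Cphi l)).
have il := integrable_scaleR j%:R mO (integrable_gap l).
have : \int[mu]_(x in Omega) ((phi k x - u x) ^+ 2 * Num.min (m x) j%:R) <=
    \int[mu]_(x in Omega) (2 * (m x * (phi k x - phi l x) ^+ 2) + 2 * (j%:R * gap l x)).
  apply: le_Rintegral => //.
    exact: (integrable_lin 2 2 mO ikl il).
  move=> x _; have /andP[t0 tj'] := tj x.
  have tm : Num.min (m x) j%:R <= m x by rewrite ge_min lexx.
  set t := Num.min _ _ in t0 tj' tm *.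
  have e1 : t * (phi k x - phi l x) ^+ 2 <= m x * (phi k x - phi l x) ^+ 2.
    by rewrite ler_wpM2r ?sqr_ge0.
  have e2 : t * (phi l x - u x) ^+ 2 <= j%:R * gap l x.
    by apply: ler_pM => //; [exact: sqr_ge0|exact: sqr_le_gap].
  have := mulr_ge0 t0 (sqr_ge0 ((phi k x - phi l x) - (phi l x - u x))).
  nra.
move=> /le_trans; apply.
rewrite RintegralD//; [|exact: (integrable_scaleR 2 mO ikl)|exact: (integrable_scaleR 2 mO il)].
rewrite (@RintegralZl _ _ _ _ _ _ _ mO ikl) (@RintegralZl _ _ _ _ _ _ _ mO il).
rewrite (@RintegralZl _ _ _ _ _ _ _ mO (integrable_gap l)).
have := weighted_cauchy k l; move: hl.
set Ik := \int[mu]_(x in Omega) gap k x; set Il := \int[mu]_(x in Omega) gap l x.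
set I := \int[mu]_(x in Omega) _; nra.
Qed.

Lemma integrable_weight : mu.-integrable Omega (EFin \o (fun x => m x * u x ^+ 2)).
Proof.
have [i1 _] := weighted_gap 0; have i2 := test_sqr (Cphi 0).
apply: (@le_integrableR _ _ _ _ Omega _ _ mO _ (integrable_lin 2 2 mO i1 i2)).
  by apply: measurable_funM => //; apply: measurable_funX; exact: Lu.1.
move=> x _; rewrite ger0_norm; last exact: (mulr_ge0 (m_ge0 x) (sqr_ge0 _)).
have := mulr_ge0 (m_ge0 x) (sqr_ge0 ((phi 0 x - u x) + phi 0 x)); nra.
Qed.

Lemma integrable_source : mu.-integrable Omega (EFin \o (fun x => h x * u x)).
Proof.
(* h u is clamped to [- m u^2, m u^2], since the bound on |h| only holds almost
everywhere. *)
pose w x := Num.min (m x * u x ^+ 2) (Num.max (- (m x * u x ^+ 2)) (h x * u x)).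
have mhu : measurable_fun Omega (fun x => h x * u x) by apply: measurable_funM => //; exact: Lu.1.
have mW : measurable_fun Omega (fun x => m x * u x ^+ 2).
  by apply/measurable_EFinP; exact: measurable_int integrable_weight.
have mw : measurable_fun Omega w.
  apply: measurable_minr => //; apply: measurable_maxr => //.
  exact: measurableT_comp.
have wE : \forall x \ae mu, Omega x -> w x = h x * u x.
  apply: filterS h_le => x hx Ox.
  have : `|h x * u x| <= m x * u x ^+ 2.
    by rewrite normrM -(real_normK (num_real (u x))) expr2 mulrA ler_wpM2r// hx.
  by rewrite ler_norml => /andP[l1 l2]; rewrite /w max_r// min_r.
apply: (ae_eq_integrable mO mw mhu wE).
apply: (@le_integrableR _ _ _ _ Omega _ _ mO mw integrable_weight) => x _.
have W0 := mulr_ge0 (m_ge0 x) (sqr_ge0 (u x)).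
by rewrite ler_norml ge_min lexx /w andbT le_min le_max lexx/= andbT; lra.
Qed.

(** Since |h| <= m |u|, the function m u^2 - h u is nonnegative, and it suffices
    that its integral be at most 0. If u were a test function, this would be
    the difference between stability and the weak equation, both tested with
    u. The approximations phi_k give the same up to errors controlled by
    the H^1-distance from phi_k to u and by the integral of
    m (phi_k - u)^2, which tends to 0 by [weighted_gap]. *)
Lemma source_eq_weight : \forall x \ae mu, Omega x -> m x * u x ^+ 2 = h x * u x.
Proof.
have iw := integrable_weight; have is_ := integrable_source.
have id_ : mu.-integrable Omega (EFin \o (fun x => m x * u x ^+ 2 - h x * u x)).
  exact: integrable_subR.
suff : \forall x \ae mu, Omega x -> m x * u x ^+ 2 - h x * u x = 0.
  by apply: filterS => x hx /hx /eqP; rewrite subr_eq0 => /eqP.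
apply: (Rintegral_ge0_eq0 mO id_).
  apply: filterS h_le => x hx Ox; rewrite subr_ge0.
  rewrite (le_trans (ler_norm _))// normrM -(real_normK (num_real (u x))).
  by rewrite expr2 mulrA ler_wpM2r// hx.
set A := Rintegral _ _ _.
have Sg_int : mu.-integrable Omega (EFin \o (fun x => \sum_(i < n) g i x ^+ 2)).
  by apply: (integrable_sumR mO) => i; exact: (Lg i).2.
have c0 := normr_ge0 c.
pose V x := (\sum_(i < n) g i x ^+ 2 + `|c| * u x ^+ 2) + 3 * (m x * u x ^+ 2).
have iV0 : mu.-integrable Omega (EFin \o (fun x => \sum_(i < n) g i x ^+ 2 + `|c| * u x ^+ 2)).
  exact: (integrable_addR mO Sg_int (integrable_scaleR _ mO Lu.2)).
have iV : mu.-integrable Omega (EFin \o V).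
  exact: (integrable_addR mO iV0 (integrable_scaleR _ mO iw)).
have V0 : 0 <= \int[mu]_(x in Omega) V x.
  apply: Rintegral_ge0 => x _; rewrite /V.
  have : 0 <= \sum_(i < n) g i x ^+ 2 by apply: sumr_ge0 => i _; exact: sqr_ge0.
  have := mulr_ge0 c0 (sqr_ge0 (u x)); have := mulr_ge0 (m_ge0 x) (sqr_ge0 (u x)).
  lra.
(* t is the parameter of [young]: the first error is small because t is, the
second, for fixed t, because k is large. *)
have key (t : R) k : 0 < t -> A <= t * \int[mu]_(x in Omega) V x +
    (1 + `|c|) * (13 * t^-1 + 1) * \int[mu]_(x in Omega) gap k x.
  move=> t0; have [id2 hd2] := weighted_gap k.
  have sk := stability (Cphi k); have wk := weak_eq (Cphi k).
  have gi := grad_int (Cphi k); have [_ p2i] := Lphi k.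
  have upi := L2_mul mO Lu (Lphi k).
  have mp2i := test_sqr (Cphi k).
  have hpi : mu.-integrable Omega (EFin \o (fun x => h x * phi k x)).
    exact: (L1loc_test oO h_L1loc (Cinfty_cont (Cphi k).1) (Cphi k).2).
  have gpi : mu.-integrable Omega (EFin \o (fun x => \sum_(i < n) g i x * partial i (phi k) x)).
    by apply: (integrable_sumR mO) => i; exact: L2_mul.
  have i1 := integrable_subR mO gi gpi.
  have i2 := integrable_subR mO p2i upi.
  pose P x := m x * phi k x ^+ 2 - h x * phi k x.
  have iP : mu.-integrable Omega (EFin \o P) by exact: integrable_subR.
  pose Q x := (grad_norm2 (phi k) x - \sum_(i < n) g i x * partial i (phi k) x) +
    (- c) * (phi k x ^+ 2 - u x * phi k x).
  have iQ : mu.-integrable Omega (EFin \o Q).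
    exact: (integrable_addR mO i1 (integrable_scaleR _ mO i2)).
  have PQ : \int[mu]_(x in Omega) P x <= \int[mu]_(x in Omega) Q x.
    rewrite /Q RintegralD//; last exact: (integrable_scaleR _ mO i2).
    rewrite (@RintegralZl _ _ _ _ _ _ _ mO i2) /P !RintegralB//.
    by move: sk wk; lra.
  have iS := integrable_gap k.
  have QV : \int[mu]_(x in Omega) Q x <= \int[mu]_(x in Omega)
      (t * (\sum_(i < n) g i x ^+ 2 + `|c| * u x ^+ 2) + (1 + `|c|) * (t^-1 + 1) * gap k x).
    apply: le_Rintegral => //; first exact: (integrable_lin _ _ mO iV0 iS).
    move=> x _; rewrite /Q /gap.
    have ti0 : 0 < t^-1 by rewrite invr_gt0.
    have S : grad_norm2 (phi k) x - \sum_(i < n) g i x * partial i (phi k) x <=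
        t * (\sum_(i < n) g i x ^+ 2) +
        (t^-1 + 1) * (\sum_(i < n) (partial i (phi k) x - g i x) ^+ 2).
      rewrite /grad_norm2 -sumrB !mulr_sumr -big_split/=; apply: ler_sum => i _.
      have := young (g i x) (partial i (phi k) x - g i x) t0.
      set q := partial i (phi k) x; set G := g i x.
      have -> : q ^+ 2 - G * q = G * (q - G) + (q - G) ^+ 2 by ring.
      by rewrite mulrDl mul1r addrA lerD2r.
    have Q0 : 0 <= \sum_(i < n) (partial i (phi k) x - g i x) ^+ 2.
      by apply: sumr_ge0 => i _; exact: sqr_ge0.
    set Sq := \sum_(i < n) (_ - _) ^+ 2 in S Q0 *.
    set d := phi k x - u x.
    have -> : phi k x ^+ 2 - u x * phi k x = u x * d + d ^+ 2 by rewrite /d; ring.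
    have yc : (- c) * (u x * d) <= `|c| * (t * u x ^+ 2 + t^-1 * d ^+ 2).
      rewrite (le_trans (ler_norm _))// normrM normrN ler_wpM2l//.
      by rewrite normrM -(real_normK (num_real (u x))) -(real_normK (num_real d)) young.
    have yc2 : (- c) * d ^+ 2 <= `|c| * d ^+ 2.
      by rewrite ler_wpM2r ?sqr_ge0// (le_trans (ler_norm _))// normrN.
    have := mulr_ge0 (ltW ti0) Q0; have := mulr_ge0 (ltW ti0) (sqr_ge0 d).
    have := mulr_ge0 c0 Q0; have := mulr_ge0 (mulr_ge0 c0 (ltW ti0)) Q0.
    have := sqr_ge0 d.
    move: S yc yc2; set a1 := _ - _; set a2 := \sum_(i < n) _.
    rewrite [X in a1 + X]mulrDr; move: (- c * (u x * d)) (- c * d ^+ 2) => a3 a4.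
    move: (d ^+ 2) (u x ^+ 2) t^-1 => d2 u2 ti; nra.
  have AP : A <= \int[mu]_(x in Omega)
      (P x + (3 * t * (m x * u x ^+ 2) + 3 * t^-1 * ((phi k x - u x) ^+ 2 * m x))).
    apply: le_Rintegral_ae => //.
      by apply: (integrable_addR mO iP); exact: integrable_lin.
    apply: filterS h_le => x hx Ox; have {}hx := hx Ox.
    have := weighted_young (phi k x - u x) t0 (m_ge0 x) hx.
    by rewrite (addrC (u x)) subrK.
  apply: le_trans AP _.
  rewrite RintegralD//; last by exact: integrable_lin.
  rewrite [X in _ + X <= _]RintegralD//; [|exact: (integrable_scaleR _ mO iw)|exact: (integrable_scaleR _ mO id2)].
  rewrite (@RintegralZl _ _ _ _ _ _ _ mO iw) (@RintegralZl _ _ _ _ _ _ _ mO id2).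
  have := le_trans PQ QV.
  rewrite [X in _ <= X -> _]RintegralD//; [|exact: (integrable_scaleR _ mO iV0)|exact: (integrable_scaleR _ mO iS)].
  rewrite (@RintegralZl _ _ _ _ _ _ _ mO iV0) (@RintegralZl _ _ _ _ _ _ _ mO iS).
  have VE : \int[mu]_(x in Omega) V x =
      \int[mu]_(x in Omega) (\sum_(i < n) g i x ^+ 2 + `|c| * u x ^+ 2) +
      3 * \int[mu]_(x in Omega) (m x * u x ^+ 2).
    rewrite /V RintegralD//; last exact: (integrable_scaleR _ mO iw).
    by rewrite (@RintegralZl _ _ _ _ _ _ _ mO iw).
  have := ler_wpM2l (ltW (_ : 0 < t^-1)) hd2; rewrite invr_gt0 => /(_ t0).
  rewrite VE; move: (\int[mu]_(x in Omega) P x) => p.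
  move: (\int[mu]_(x in Omega) gap k x) => G.
  move: (\int[mu]_(x in Omega) (m x * u x ^+ 2)) => w.
  move: (\int[mu]_(x in Omega) ((phi k x - u x) ^+ 2 * m x)) => e.
  move: (\int[mu]_(x in Omega) (\sum_(i < n) g i x ^+ 2 + `|c| * u x ^+ 2)) => v.
  move: t^-1 => ti h1 h2; rewrite -subr_ge0.
  have -> : t * (v + 3 * w) + (1 + `|c|) * (13 * ti + 1) * G -
      (p + (3 * t * w + 3 * ti * e)) =
    (t * v + (1 + `|c|) * (ti + 1) * G - p) +
    3 * (ti * (4 * (1 + `|c|) * G) - ti * e) by ring.
  by apply: addr_ge0; [rewrite subr_ge0|apply: mulr_ge0 => //; rewrite subr_ge0].
apply/ler_addgt0Pr => e e0; rewrite add0r.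
pose t := e / 2 / (\int[mu]_(x in Omega) V x + 1).
have V1 : 0 < \int[mu]_(x in Omega) V x + 1 by rewrite ltr_wpDl.
have t0 : 0 < t by rewrite !divr_gt0.
have K0 : 0 <= (1 + `|c|) * (13 * t^-1 + 1).
  by rewrite mulr_ge0 ?addr_ge0// mulr_ge0// invr_ge0 ltW.
have e2 : 0 < e / 2 by rewrite divr_gt0.
have [k hk] := gap_small K0 e2; apply: le_trans (key t k t0) _.
have tV : t * \int[mu]_(x in Omega) V x <= e / 2.
  rewrite /t -mulrA ler_piMr ?(ltW e2)// mulrC ler_pdivrMr// mul1r lerDl ler01//.
by rewrite [leRHS]splitr; exact: lerD.
Qed.

End energy_estimate.

(** * Convex functions, and lower bounds for Dirichlet eigenvalues *)

Section convex_C1.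
Context {R : realType}.
Variable f : R -> R.
Hypothesis f_C1 : C1_real f.
Hypothesis f_convex : @convex_function R R^o setT f.
Hypothesis f0 : f 0 = 0.

Lemma convex_combination (x y t : R) : 0 <= t <= 1 ->
  f (x + t * (y - x)) <= f x + t * (f y - f x).
Proof.
move=> /andP[t0 t1].
have := f_convex (Itv01 t0 t1) (in_setT y) (in_setT x); rewrite convRE/=.
rewrite -[X in f X]/(t * y + (1 - t) * x) -[X in _ <= X]/(t * f y + (1 - t) * f x).
have -> : t * y + (1 - t) * x = x + t * (y - x) by ring.
by have -> : t * f y + (1 - t) * f x = f x + t * (f y - f x) by ring.
Qed.

(** For 0 < t <= 1 convexity bounds (f(x + t (y - x)) - f(x)) / t by f(y) - f(x);
    let t tend to 0. *)
Lemma convex_tangent (x y : R) : f x + derive1 f x * (y - x) <= f y.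
Proof.
have dx := f_C1.1 x.
rewrite -lerBrDl derive1E.
pose q (t : R) := t^-1 * (f (t * (y - x) + x) - f x).
have qcv : q t @[t --> 0^'] --> 'D_1 f x * (y - x).
  have df : differentiable f x by exact/derivable1_diffP.
  have -> : 'D_1 f x * (y - x) = 'D_(y - x) f x.
    rewrite (deriveE _ df) (deriveE _ df).
    have := linearZ_LR ('d f x : {linear _ -> _}) (y - x) 1.
    by rewrite [(y - x) *: 1]mulr1 => ->; rewrite mulrC.
  exact: (diff_derivable df).
apply: (cvgr_to_le (cvg_dnbhs_at_right qcv)).
near=> t; have t0 : 0 < t by near: t; exact: nbhs_right_gt.
have t1 : t <= 1 by near: t; apply: nbhs_right_le.
rewrite /q mulrC ler_pdivrMr// lerBlDl (addrC _ x) (mulrC _ t).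
by apply: convex_combination; rewrite (ltW t0).
Unshelve. all: by end_near. Qed.

Lemma convex_ge_slope0 t : derive1 f 0 * t <= f t.
Proof. by have := convex_tangent 0 t; rewrite f0 add0r subr0. Qed.

Lemma convex_le_slope t : f t <= derive1 f t * t.
Proof.
have := convex_tangent t 0; rewrite f0 sub0r mulrN => h.
by rewrite -subr_ge0 -oppr_le0 opprB.
Qed.

Lemma convex_slope_ge t : 0 <= t -> derive1 f 0 <= derive1 f t.
Proof.
rewrite le_eqVlt => /predU1P[<-//|t0].
by rewrite -(ler_pM2r t0) (le_trans (convex_ge_slope0 t))// convex_le_slope.
Qed.

(** The tangent at a passes through the origin, so on [0, a] the graph of f is
    both above it and below the chord, which is that same line. *)
Lemma convex_affine (a : R) : 0 < a -> derive1 f a * a = f a ->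
  forall t, 0 <= t <= a -> f t = derive1 f 0 * t.
Proof.
move=> a0 fa; set p := derive1 f a in fa.
have fp t : 0 <= t <= a -> f t = p * t.
  move=> /andP[t0 ta]; apply/eqP; rewrite eq_le; apply/andP; split.
    have h : 0 <= t / a <= 1 by rewrite divr_ge0 ?(ltW a0)//= ler_pdivrMr// mul1r.
    have := convex_combination 0 a h; rewrite f0 !subr0 !add0r -fa.
    by rewrite divfK ?gt_eqF// mulrCA divfK ?gt_eqF.
  by have := convex_tangent a t; rewrite -/p -fa; lra.
(* The slope of this line is the derivative at 0 because the derivative is
continuous there. *)
have dp t : 0 < t < a -> derive1 f t = p.
  move=> /andP[t0 ta]; apply/eqP; rewrite eq_le; apply/andP; split.
    have := convex_tangent t a; rewrite (fp t) ?(ltW t0) ?(ltW ta)// -fa => h.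
    have at0 : 0 < a - t by rewrite subr_gt0.
    by rewrite -(ler_pM2r at0); lra.
  by have := convex_le_slope t; rewrite (fp t) ?(ltW t0) ?(ltW ta)// ler_pM2r.
suff -> : derive1 f 0 = p by exact: fp.
have c1 : derive1 f t @[t --> 0^'+] --> derive1 f 0.
  by apply: cvg_at_right_filter; exact: f_C1.2.
have c2 : derive1 f t @[t --> 0^'+] --> p.
  apply: cvg_near_cst; near=> t; apply: dp; apply/andP; split.
    by near: t; exact: nbhs_right_gt.
  by near: t; exact: nbhs_right_lt.
exact: (cvg_unique _ c1 c2).
Unshelve. all: by end_near. Qed.

End convex_C1.

Section weak_formulation.
Context {R : realType} {n : nat}.
Local Notation mu := (@lebesgue_rV R n).
Implicit Types (Omega : set 'rV[R]_n) (u v w F : 'rV[R]_n -> R).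

Lemma weak_equation Omega u (g : 'I_n -> 'rV[R]_n -> R) F : open Omega ->
  H1grad Omega u g -> distr_poisson Omega u F -> forall f, Cinftyc Omega f ->
  \int[mu]_(x in Omega) (F x * f x) =
  \int[mu]_(x in Omega) (\sum_(i < n) g i x * partial i f x).
Proof.
move=> oO [_ Hg] [Lu _ eqF] f Cf; have mO := open_measurable_rV oO.
rewrite -(eqF f Cf).
have C1 i := Cinftyc_partial i Cf.
have C2 i := Cinftyc_partial i (C1 i).
have i1 i : mu.-integrable Omega (EFin \o (fun x => u x * partial i (partial i f) x)).
  exact: (L1loc_test oO Lu (Cinfty_cont (C2 i).1) (C2 i).2).
have i2 i : mu.-integrable Omega (EFin \o (fun x => g i x * partial i f x)).
  have [_ [_ Lg _]] := Hg i.
  exact: (L1loc_test oO Lg (Cinfty_cont (C1 i).1) (C1 i).2).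
rewrite (Rintegral_sumR mO i2).
transitivity (- \int[mu]_(x in Omega) (\sum_(i < n) u x * partial i (partial i f) x)).
  by congr (- _); apply: eq_Rintegral => x _; rewrite /laplacian mulr_sumr.
rewrite (Rintegral_sumR mO i1) -sumrN; apply: eq_bigr => i _.
by have [_ [_ _ ->]] := Hg i; rewrite ?opprK//; exact: C1.
Qed.

Lemma L1loc_cst Omega (a : R) : L1loc Omega (fun=> a).
Proof.
split=> [|K cK _]; first exact: measurable_cst.
exact: integrable_cst_bounded (measurable_compact cK) (compact_bounded cK).
Qed.

Lemma L1loc_lin Omega v w (a b : R) : L1loc Omega v -> L1loc Omega w ->
  L1loc Omega (fun x => a * v x + b * w x).
Proof.
move=> [mv vi] [mw wi]; split=> [|K cK KO].
  by apply: measurable_funD; apply: measurable_funM.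
have mK := measurable_compact cK.
exact: (integrable_lin a b mK (vi K cK KO) (wi K cK KO)).
Qed.

Lemma L1loc_max0 Omega v : measurable Omega -> L1loc Omega v ->
  L1loc Omega (fun x => Num.max 0 (v x)).
Proof.
move=> mO [mv vi]; have mm : measurable_fun Omega (fun x => Num.max 0 (v x)).
  exact: measurable_maxr.
split=> // K cK KO; have mK := measurable_compact cK.
have iN : mu.-integrable K (EFin \o (fun x => `|v x|)) by exact: integrable_norm (vi K cK KO).
apply: (@le_integrableR _ _ _ _ K _ _ mK _ iN); first exact: measurable_funS mm.
by move=> x _; rewrite ger0_norm ?le_max ?lexx// ge_max normr_ge0 ler_norm.
Qed.

(** If lambda < kappa, an eigenfunction w satisfies the hypotheses of
    [source_eq_weight] with c = lambda, h = 0 and the constant weight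
    kappa - lambda; hence (kappa - lambda) w^2 = 0. *)
Lemma eigenvalue_ge Omega (kappa lambda : R) w : open Omega ->
  (forall f, Cinftyc Omega f ->
    kappa * \int[mu]_(x in Omega) (f x ^+ 2) <= \int[mu]_(x in Omega) grad_norm2 f x) ->
  dirichlet_eigenfunction Omega lambda w -> kappa <= lambda.
Proof.
move=> oO hk [[g Hw [phi Cphi cphi]] w0 dw]; rewrite leNgt; apply/negP => lk.
have mO := open_measurable_rV oO.
have [Lw Hg] := Hw; have [Lwl _ _] := dw.
have E : \forall x \ae mu, Omega x -> (kappa - lambda) * w x ^+ 2 = 0 * w x.
  apply: (@source_eq_weight R n Omega w g phi oO Lw _ Cphi cphi lambda
    (fun=> kappa - lambda) (fun=> 0)).
  - by move=> i; exact: (Hg i).1.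
  - exact: L1loc_cst.
  - exact: L1loc_cst.
  - by move=> x; rewrite subr_ge0 ltW.
  - by apply: aeW => x _; rewrite normr0 mulr_ge0// subr_ge0 ltW.
  - move=> f Cf; have [_ f2] := L2_test oO (Cinfty_cont Cf.1) Cf.2.
    by rewrite (@RintegralZl _ _ _ _ _ _ _ mO f2) mulrBl subrK; exact: hk.
  - move=> f Cf; rewrite -(weak_equation oO Hw dw Cf).
    have wf := L1loc_test oO Lwl (Cinfty_cont Cf.1) Cf.2.
    rewrite -(@RintegralZl _ _ _ _ _ _ _ mO wf).
    under eq_Rintegral do rewrite mul0r.
    rewrite Rintegral_cst// mul0r add0r.
    by apply: eq_Rintegral => x _; rewrite mulrA.
apply: w0; apply: filterS E => x hx /hx /eqP.
by rewrite mul0r mulf_eq0 sqrf_eq0 subr_eq0 gt_eqF//= => /eqP.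
Qed.

Section almost_everywhere_equal.
Variables (Omega : set 'rV[R]_n) (u v : 'rV[R]_n -> R).
Hypothesis oO : open Omega.
Hypothesis mv : measurable_fun Omega v.
Hypothesis uv : \forall x \ae mu, Omega x -> u x = v x.

Let mO : measurable Omega. Proof. exact: open_measurable_rV. Qed.

Lemma L2_ae : L2 Omega u -> L2 Omega v.
Proof.
move=> [mu' ui]; split=> //.
apply: (ae_eq_integrable mO _ _ _ ui).
- exact: measurable_funX.
- exact: measurable_funX.
- by apply: filterS uv => x h /h ->.
Qed.

Lemma L1loc_ae : L1loc Omega u -> L1loc Omega v.
Proof.
move=> [mu' ui]; split=> // K cK KO; have mK := measurable_compact cK.
apply: (ae_eq_integrable mK _ _ _ (ui K cK KO)).
- exact: measurable_funS mu'.
- exact: measurable_funS mv.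
- by apply: filterS uv => x h /KO /h.
Qed.

Lemma Rintegral_ae (f : 'rV[R]_n -> R) : measurable_fun Omega u ->
  measurable_fun Omega f ->
  \int[mu]_(x in Omega) (u x * f x) = \int[mu]_(x in Omega) (v x * f x).
Proof.
move=> mu' mf; apply: ae_eq_Rintegral => //; [exact: measurable_funM..|].
by apply: filterS uv => x h /h ->.
Qed.

Let mtest f : Cinftyc Omega f -> measurable_fun Omega f.
Proof.
move=> [C _]; apply: (measurable_funS measurableT) => //.
exact: measurable_continuous (Cinfty_cont C).
Qed.

Lemma H10_ae : H10 Omega u -> H10 Omega v.
Proof.
move=> [g [Lu Hg] [phi Cphi cphi]]; have mu' := Lu.1; exists g.
  split; first exact: L2_ae.
  move=> i; have [Lg [Lul Lgl wk]] := Hg i; split=> //; split=> // [|f Cf].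
    exact: L1loc_ae.
  by rewrite -(wk f Cf) Rintegral_ae//; exact: mtest (Cinftyc_partial i Cf).
exists phi => //; move: cphi.
suff -> : (fun k => \int[mu]_(x in Omega) ((phi k x - u x) ^+ 2 +
    \sum_(i < n) (partial i (phi k) x - g i x) ^+ 2)%:E)%E =
  (fun k => \int[mu]_(x in Omega) ((phi k x - v x) ^+ 2 +
    \sum_(i < n) (partial i (phi k) x - g i x) ^+ 2)%:E)%E by [].
apply/funext => k.
have mS : measurable_fun Omega (fun x => \sum_(i < n) (partial i (phi k) x - g i x) ^+ 2).
  apply: measurable_sum => i; apply: measurable_funX; apply: measurable_funB.
    exact: mtest (Cinftyc_partial i (Cphi k)).
  by have [[]] := Hg i.
apply: ae_eq_integral => //.
- apply/measurable_EFinP; apply: measurable_funD => //; apply: measurable_funX.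
  by apply: measurable_funB => //; exact: mtest.
- apply/measurable_EFinP; apply: measurable_funD => //; apply: measurable_funX.
  by apply: measurable_funB => //; exact: mtest.
- by apply: filterS uv => x h /h ->.
Qed.

Lemma dirichlet_eigenfunction_ae (lambda : R) :
  dirichlet_eigenfunction Omega lambda u -> dirichlet_eigenfunction Omega lambda v.
Proof.
move=> [Hu u0 [Lu Llu eq_u]]; have mu' := Lu.1; split; first exact: H10_ae.
  move=> v0; apply: u0; apply: filterS2 uv v0 => x h1 h2 Ox.
  by rewrite (h1 Ox) (h2 Ox).
have Lv := L1loc_ae Lu; split=> //.
  by have := L1loc_lin lambda 0 Lv Lv; congr L1loc; apply/funext => x; rewrite mul0r addr0.
move=> f Cf; have := eq_u f Cf.
rewrite (Rintegral_ae mu' (mtest (Cinftyc_laplacian Cf))) => ->.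
have mf := mtest Cf.
apply: ae_eq_Rintegral => //.
- by apply: measurable_funM => //; apply: measurable_funM.
- by apply: measurable_funM => //; apply: measurable_funM.
- by apply: filterS uv => x h /h ->.
Qed.

End almost_everywhere_equal.

End weak_formulation.

(** * Stable solutions with a convex nonlinearity *)

Section main_steps.
Context {R : realType} {N : nat}.
Local Notation mu := (@lebesgue_rV R N).
Variables (Omega : set 'rV[R]_N) (f : R -> R) (u : 'rV[R]_N -> R).
Hypothesis oO : open Omega.
Hypothesis f_C1 : C1_real f.
Hypothesis f_convex : @convex_function R R^o setT f.
Hypothesis f0 : f 0 = 0.
Hypothesis u_H10 : H10 Omega u.
Hypothesis u_stable : stable_solution Omega f u.
Hypothesis u_ge0 : \forall x \ae mu, Omega x -> 0 <= u x.

Let mO : measurable Omega. Proof. exact: open_measurable_rV. Qed.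

Local Notation c := (derive1 f 0).

(** [source_eq_weight] with m = f'(u) - f'(0) and h = f(u) - f'(0) u. Convexity
    and f(0) = 0 give 0 <= h <= m u where u >= 0. *)
Lemma stable_slope_eq : \forall x \ae mu, Omega x ->
  0 <= u x /\ derive1 f (u x) * u x = f (u x).
Proof.
have [g Hu [phi Cphi cphi]] := u_H10; have [Lu Hg] := Hu.
have [_ Lfu dw Ldf st] := u_stable; have [Lul _ _] := dw.
(* The maximum makes m nonnegative everywhere, and not only where u >= 0. *)
pose m x := Num.max 0 (derive1 f (u x) - c).
pose h x := f (u x) - c * u x.
have mE : \forall x \ae mu, Omega x -> m x = derive1 f (u x) - c.
  apply: filterS u_ge0 => x ux Ox; rewrite /m max_r// subr_ge0.
  exact: convex_slope_ge f_C1 f_convex f0 _ (ux Ox).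
have Lm : L1loc Omega m.
  apply: L1loc_max0 => //; have := L1loc_lin 1 (-1) Ldf (L1loc_cst Omega c).
  by congr L1loc; apply/funext => x; rewrite /= mul1r mulN1r.
have Lh : L1loc Omega h.
  have := L1loc_lin 1 (- c) Lfu Lul.
  by congr L1loc; apply/funext => x; rewrite /= mul1r mulNr.
have m0 x : 0 <= m x by rewrite /m le_max lexx.
have hm : \forall x \ae mu, Omega x -> `|h x| <= m x * `|u x|.
  apply: filterS2 u_ge0 mE => x ux mx Ox; rewrite mx// (ger0_norm (ux Ox)).
  rewrite ger0_norm /h; last by rewrite subr_ge0; exact: convex_ge_slope0.
  by rewrite mulrBl lerD2r; exact: convex_le_slope.
have mt (F : 'rV[R]_N -> R) : Cinftyc Omega F -> measurable_fun Omega F.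
  by move=> CF; have [] := L2_test oO (Cinfty_cont CF.1) CF.2.
have E : \forall x \ae mu, Omega x -> m x * u x ^+ 2 = h x * u x.
  apply: (@source_eq_weight R N Omega u g phi oO Lu _ Cphi cphi c m h) => //.
  - by move=> i; exact: (Hg i).1.
  - move=> F CF; have cF := Cinfty_cont CF.1.
    have iF2 := (L2_test oO cF CF.2).2.
    have imF := L1loc_test_sqr oO Lm cF CF.2.
    rewrite -(@RintegralZl _ _ _ _ _ _ _ mO iF2) -RintegralD//; last exact: integrable_scaleR.
    apply: le_trans (st F (Cinftyc_Ckc 1 CF)).
    rewrite le_eqVlt; apply/orP; left; apply/eqP; apply: ae_eq_Rintegral => //.
    + have mF := mt F CF; apply: measurable_funD; apply: measurable_funM => //; last exact: measurable_funX.
        by case: Lm.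
      exact: measurable_funX.
    + apply: measurable_funM; first by case: Ldf.
      by apply: measurable_funX; exact: mt.
    + by apply: filterS mE => x mx Ox; rewrite mx// mulrBl subrK.
  - move=> F CF; rewrite -(weak_equation oO Hu dw CF).
    have cF := Cinfty_cont CF.1.
    have iuF := L1loc_test oO Lul cF CF.2; have ihF := L1loc_test oO Lh cF CF.2.
    rewrite -(@RintegralZl _ _ _ _ _ _ _ mO iuF) -RintegralD//; last exact: integrable_scaleR.
    by apply: eq_Rintegral => x _; rewrite /h mulrBl -mulrA subrK.
apply: filterS3 u_ge0 mE E => x ux mx Ex Ox; have u0 := ux Ox; split=> //.
have := Ex Ox; rewrite (mx Ox) /h; move: u0; rewrite le_eqVlt => /predU1P[<-|u0].
  by move=> _; rewrite mulr0 f0.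
by rewrite expr2 mulrA => /(mulIf (lt0r_neq0 u0)); rewrite mulrBl => /addIr.
Qed.

Lemma stable_linear : \forall x \ae mu, Omega x ->
  0 <= u x /\ forall t, 0 <= t <= u x -> f t = c * t.
Proof.
apply: filterS stable_slope_eq => x hx Ox; have [u0 e] := hx Ox; split=> //.
move: u0; rewrite le_eqVlt => /predU1P[<-|u0].
  by move=> t t0; have -> : t = 0 by [apply/eqP; rewrite eq_le andbC]; rewrite f0 mulr0.
exact: convex_affine.
Qed.

(** If t is below the essential supremum, some point x at which [stable_linear]
    holds has t < u(x). *)
Lemma stable_below_sup t : 0 < t -> (t%:E < ess_sup_on Omega u)%E -> f t = c * t.
Proof.
move=> t0 tu; apply: contrapT => ft; move: tu; apply/negP; rewrite -leNgt.
apply: ereal_inf_lbound => /=.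
apply: filterS stable_linear => x hx Ox; rewrite lee_fin leNgt; apply/negP => tx.
by have [_ /(_ t)] := hx Ox; rewrite !ltW// => /(_ isT).
Qed.

Hypothesis u_neq0 : ~ (u = cst 0 %[ae mu in Omega]).

Lemma stable_eigenfunction : dirichlet_eigenfunction Omega c u.
Proof.
have [_ Lfu [Lul _ dw] _ _] := u_stable; split=> //; split=> // [|F CF].
  have := L1loc_lin c 0 Lul Lul.
  by congr L1loc; apply/funext => x; rewrite mul0r addr0.
have mF : measurable_fun Omega F.
  by have [] := L2_test oO (Cinfty_cont CF.1) CF.2.
have mu' := Lul.1; rewrite dw//; apply: ae_eq_Rintegral => //.
- by apply: measurable_funM => //; case: Lfu.
- by apply: measurable_funM => //; exact: measurable_funM.
- apply: filterS stable_linear => x hx Ox; have [u0 h] := hx Ox.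
  by rewrite /= h// u0 lexx.
Qed.

Lemma grad_norm2_ge0 (F : 'rV[R]_N -> R) : 0 <= \int[mu]_(x in Omega) grad_norm2 F x.
Proof.
by apply: Rintegral_ge0 => x _; apply: sumr_ge0 => i _; exact: sqr_ge0.
Qed.

Lemma stable_slope_ge0 : 0 <= c.
Proof.
apply: (eigenvalue_ge oO) stable_eigenfunction => F _.
by rewrite mul0r grad_norm2_ge0.
Qed.

(** The slope is an eigenvalue, with eigenfunction u; and since f' >= f'(0) on
    [0, +oo[, stability makes it a lower bound of the Rayleigh quotient, hence
    of all eigenvalues. *)
Lemma stable_slope_principal : c = principal_eigenvalue Omega.
Proof.
have lb lambda : dirichlet_eigenvalue Omega lambda -> c <= lambda.
  move=> [w]; apply: (eigenvalue_ge oO) => F CF.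
  have [_ _ _ Ldf st] := u_stable; apply: le_trans (st F (Cinftyc_Ckc 1 CF)).
  have cF := Cinfty_cont CF.1.
  have [mF iF2] := L2_test oO cF CF.2.
  rewrite -(@RintegralZl _ _ _ _ _ _ _ mO iF2); apply: le_Rintegral_ae => //.
  - exact: integrable_scaleR.
  - exact: (L1loc_test_sqr oO Ldf cF CF.2).
  - apply: filterS u_ge0 => x ux Ox; rewrite ler_wpM2r ?sqr_ge0//.
    exact: convex_slope_ge f_C1 f_convex f0 _ (ux Ox).
have mem : dirichlet_eigenvalue Omega c by exists u; exact: stable_eigenfunction.
apply/eqP; rewrite eq_le; apply/andP; split.
  by apply: lb_le_inf; [exists c|exact: lb].
by apply: ge_inf => //; exists c; exact: lb.
Qed.

End main_steps.

Section strong_maximum_principle.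
Context {R : realType} {n : nat}.
Local Notation mu := (@lebesgue_rV R n).

(** The zeros of v form a subset of Omega that is both open and closed in it. *)
Lemma positive_of_open_zeros (Omega : set 'rV[R]_n) (v : 'rV[R]_n -> R) :
  open Omega -> connected Omega -> (forall x, Omega x -> {for x, continuous v}) ->
  (forall x, Omega x -> 0 <= v x /\ (v x = 0 -> \forall y \near x, v y = 0)) ->
  (exists2 x, Omega x & v x != 0) -> forall x, Omega x -> 0 < v x.
Proof.
move=> oO cO cv hv [a Oa va] x Ox; have [vx0 hx] := hv x Ox.
rewrite lt_neqAle vx0 andbT eq_sym; apply/eqP => vx.
pose Z := [set y | Omega y /\ v y = 0].
have oZ : open Z.
  rewrite openE => y [Oy vy]; apply: filterI; first exact: open_nbhs_nbhs.
  exact: (hv y Oy).2.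
have oN : open [set y | Omega y /\ v y != 0].
  rewrite openE => y [Oy vy]; apply: filterI; first exact: open_nbhs_nbhs.
  have := cv y Oy _ (open_nbhs_nbhs (conj (@open_neq R 0) vy)).
  exact.
have ZO : Z = Omega.
  apply: cO; first by exists x.
    by exists Z => //; apply/seteqP; split=> [y [Oy vy]|y []].
  exists (~` [set y | Omega y /\ v y != 0]); first exact: open_closedC.
  apply/seteqP; split=> [y [Oy vy]|y [Oy nvy]].
    by split=> // -[_]; rewrite vy eqxx.
  by split=> //; apply/eqP/negPn/negP => vy; apply: nvy.
by have [_ /eqP] : Z a by [rewrite ZO]; rewrite (negPf va).
Qed.

End strong_maximum_principle.

Theorem theorem1 (R : realType) (N : nat) (hN : (1 <= N)%N)
  (Omega : set 'rV[R]_N) (hOmega : domain Omega) (bOmega : bounded_set Omega)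
  (f : R -> R) (f_C1 : C1_real f)
  (f_convex : @convex_function R R^o setT f) (f0 : f 0 = 0)
  (u : 'rV[R]_N -> R) (u_H10 : H10 Omega u) (fu_L1loc : L1loc Omega (f \o u))
  (u_stable : stable_solution Omega f u)
  (u_ge0 : \forall x \ae @lebesgue_rV R N, Omega x -> 0 <= u x) :
  u = cst 0 %[ae @lebesgue_rV R N in Omega] \/
  ((forall t, 0 < t -> (t%:E < ess_sup_on Omega u)%E ->
      f t = principal_eigenvalue Omega * t) /\
   exists v : 'rV[R]_N -> R,
     [/\ u = v %[ae @lebesgue_rV R N in Omega],
         Cinfty Omega v,
         H10 Omega v,
         forall x, Omega x -> 0 < v x &
         dirichlet_eigenfunction Omega (principal_eigenvalue Omega) v]).
Proof.
have [oO cO _] := hOmega.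
have [u0|u0] := pselect (u = cst 0 %[ae @lebesgue_rV R N in Omega]); [by left|right].
have cE := stable_slope_principal oO f_C1 f_convex f0 u_H10 u_stable u_ge0 u0.
have eig := stable_eigenfunction oO f_C1 f_convex f0 u_H10 u_stable u_ge0 u0.
have c0 := stable_slope_ge0 oO f_C1 f_convex f0 u_H10 u_stable u_ge0 u0.
split; first by move=> t; rewrite -cE; exact: stable_below_sup.
have ui : (@lebesgue_rV R N).-integrable Omega (EFin \o u).
  by have [g [Lu _] _] := u_H10; exact: (L2_integrable (open_measurable_rV oO)).
have uw F : Cinftyc Omega F ->
  \int[@lebesgue_rV R N]_(x in Omega) (u x * laplacian F x) =
  - (Num.sqrt (derive1 f 0)) ^+ 2 * \int[@lebesgue_rV R N]_(x in Omega) (u x * F x).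
  move=> CF; have [_ _ [Lu _ dw]] := eig.
  rewrite sqr_sqrtr// mulNr; apply: oppr_inj; rewrite opprK dw//.
  have iuF := L1loc_test oO Lu (Cinfty_cont CF.1) CF.2.
  rewrite -(@RintegralZl _ _ _ _ _ _ _ (open_measurable_rV oO) iuF).
  by apply: eq_Rintegral => x _; rewrite mulrA.
have [v [Cv uv vpos]] := eigenfunction_regular oO ui uw.
have cv x : Omega x -> {for x, continuous v} by move=> Ox; exact: (Ck_cont (Cv 0%N) Ox).
have mv : measurable_fun Omega v by exact: measurable_fun_open.
exists v; split=> //.
- exact: H10_ae u_H10.
- apply: positive_of_open_zeros => //; first exact: vpos.
  apply: contrapT => h; apply: u0; apply: filterS uv => x uvx Ox.
  rewrite uvx//; apply/eqP/negPn/negP => vx; apply: h; by exists x.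
- by rewrite -cE; exact: dirichlet_eigenfunction_ae eig.
Qed.
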